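(* Let $M$ be a $C^\infty$ real hypersurface in $\mathbb{C}^n$ and $p\in M$. If there exists an $\mathcal{N}$-canonical coordinate $(z)$ for $M$ at $p$, then the following five conditions are equivalent: (1) $\Delta_1(M,p)=\infty$; (2) $\Delta_1^{\rm reg}(M,p)=\infty$; (3) there exists $\gamma\in\Gamma^{\rm reg}$ tangent to $M$ at $p$ to infinite order; (4) there exists $\gamma\in\Gamma$ tangent to $M$ at $p$ to infinite order; (5) there exists a holomorphic coordinate $(z)$ at $p$ with $p=0$ such that a local defining function for $M$ in $(z)$ is not convenient.
   Context: A local defining function $r$ for $M$ near $p$ is a real-valued $C^\infty$ function with $M=\{r=0\}$ near $p$ and $\nabla r\neq0$ on $M$. $\operatorname{ord}(h)$ denotes the order of vanishing at $0$. $\Gamma$ is the set of germs of nonconstant holomorphic maps $\gamma:(\mathbb{C},0)\to(\mathbb{C}^n,p)$ (with good parametrization: each image point corresponds to one $t$). $\Delta_1(M,p)=\sup_{\gamma\in\Gamma}\operatorname{ord}(r\circ\gamma)/\operatorname{ord}(\gamma-p)$; $\Gamma^{\rm reg}=\{\gamma\in\Gamma:\operatorname{ord}(\gamma-p)=1\}$; $\Delta_1^{\rm reg}(M,p)=\sup_{\gamma\in\Gamma^{\rm reg}}\operatorname{ord}(r\circ\gamma)$. $\gamma$ is tangent to $M$ at $p$ to infinite order if $(r\circ\gamma)(t)=O(t^N)$ for all $N$. Newton polyhedron: for real-valued smooth $F$ near $0\in\mathbb{C}^n$ with Taylor series $\sum C_{\alpha\beta}z^\alpha\bar z^\beta$,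 $S(F)=\{\alpha+\beta:C_{\alpha\beta}\ne0\}$, $\mathcal{N}_+(F)=$ convex hull of $\bigcup_{\alpha+\beta\in S(F)}(\alpha+\beta+\mathbb{R}_+^n)$. $F$ is convenient if $\mathcal{N}_+(F)$ meets every coordinate axis. For a compact face $\kappa$ of $\mathcal{N}_+(F)$, the $\kappa$-part is $F_\kappa=\sum_{\alpha+\beta\in\kappa}C_{\alpha\beta}z^\alpha\bar z^\beta$, and $\Gamma_\kappa$ is the set of curves $t\mapsto(c_1t^{a_1},\dots,c_nt^{a_n})$ with $c\in(\mathbb{C}\setminus\{0\})^n$ and $a\in\mathbb{N}^n$ such that $\{\xi\in\mathcal{N}_+(F):\sum a_j\xi_j=l\}=\kappa$ for some $l\in\mathbb{N}$. $F_\kappa$ is $\mathcal{N}$-nondegenerate if $F_\kappa\circ\gamma\not\equiv0$ for all $\gamma\in\Gamma_\kappa$; $F$ is $\mathcal{N}$-nondegenerate if $F_\kappa$ is for every compact face $\kappa$. A holomorphic coordinate $(z)$ at $p$ (with $p=0$) is $\mathcal{N}$-canonical for $M$ at $p$ if a local defining function for $M$ in the coordinate $(z)$ is $\mathcal{N}$-nondegenerate. *)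

(* Defs.v *)
From HB Require Import structures.
From mathcomp Require Import all_boot all_order all_algebra.
From mathcomp Require Import complex.
From mathcomp Require Import classical_sets boolp fsbigop reals ereal topology normedtype derive.

Set Implicit Arguments.
Unset Strict Implicit.
Unset Printing Implicit Defensive.

Import Order.TTheory GRing.Theory Num.Theory numFieldNormedType.Exports.
Local Open Scope classical_set_scope.
Local Open Scope ring_scope.

Section Defs.
Variable R : realType.
Variable n : nat.

Local Notation C := (R[i]).

Definition pt := 'I_n -> C.

Definition cabs (z : C) : R := Normc.normc z.

Definition origin : pt := fun _ => 0.

Definition polydisc (q : pt) (e : R) : set pt :=
  [set z | forall j, cabs (z j - q j) < e].

(* real coordinate directions: (j,false) = Re z_j, (j,true) = Im z_j *)
Definition dir := ('I_n * bool)%type.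

Definition shift (z : pt) (d : dir) (t : R) : pt :=
  fun k => if k == d.1 then z k + (if d.2 then (Complex 0 t) else (Complex t 0)) else z k.

Definition pd (d : dir) (f : pt -> R) : pt -> R :=
  fun z => derive1 (fun t : R => f (shift z d t)) 0.

Definition iter_pd (w : seq dir) (f : pt -> R) : pt -> R := foldr pd f w.

Definition cont_at (g : pt -> R) (z : pt) :=
  forall e : R, 0 < e -> exists2 d : R, 0 < d &
    forall y, polydisc z d y -> `|g y - g z| < e.

Definition smooth_on (U : set pt) (f : pt -> R) :=
  forall w : seq dir,
    (forall z, U z -> forall d : dir,
        derivable (fun t : R => iter_pd w f (shift z d t)) 0 1) /\
    (forall z, U z -> cont_at (iter_pd w f) z).

Definition local_defining_function (M : set pt) (q : pt) (r : pt -> R) :=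
  exists2 e : R, 0 < e &
    [/\ smooth_on (polydisc q e) r,
        (forall z, polydisc q e z -> (M z <-> r z = 0)) &
        (forall z, polydisc q e z -> M z -> exists d : dir, pd d r z != 0)].

Definition real_hypersurface (M : set pt) :=
  forall q, M q -> exists r, local_defining_function M q r.

Definition cdiff_at (g : C -> C) (z0 : C) :=
  exists l : C, forall e : R, 0 < e -> exists2 d : R, 0 < d &
    forall h : C, 0 < cabs h < d -> cabs ((g (z0 + h) - g z0) / h - l) < e.

Definition ccont_at (f : pt -> C) (z : pt) :=
  forall e : R, 0 < e -> exists2 d : R, 0 < d &
    forall y, polydisc z d y -> cabs (f y - f z) < e.

Definition upd (z : pt) (j : 'I_n) (s : C) : pt :=
  fun k => if k == j then s else z k.

(* holomorphic near q: continuous and holomorphic in each variable (Osgood) *)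
Definition holo_near (f : pt -> C) (q : pt) :=
  exists2 e : R, 0 < e & forall z, polydisc q e z ->
    ccont_at f z /\ forall j, cdiff_at (fun s => f (upd z j s)) (z j).

Definition holo_curve (g : C -> pt) :=
  exists2 e : R, 0 < e & forall t, cabs t < e -> forall j, cdiff_at (fun s => g s j) t.

(* Gamma: nonconstant germs of holomorphic maps (C,0) -> (C^n,p), with good
   parametrization (injective near 0) *)
Definition Gamma (p : pt) (g : C -> pt) :=
  [/\ g 0 = p, holo_curve g,
      ~ (exists2 e : R, 0 < e & forall t, cabs t < e -> g t = p) &
      exists2 e : R, 0 < e & forall s t, cabs s < e -> cabs t < e -> g s = g t -> s = t].

Definition vanishes_to (f : C -> R) (k : nat) :=
  exists c e : R, [/\ 0 < c, 0 < e & forall t, cabs t < e -> `|f t| <= c * cabs t ^+ k].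

Definition ord (f : C -> R) : \bar R :=
  ereal_sup [set ((k%:R : R)%:E) | k in [set k | vanishes_to f k]].

Definition cvanishes_to (g : C -> pt) (p : pt) (k : nat) :=
  exists c e : R, [/\ 0 < c, 0 < e &
    forall t, cabs t < e -> forall j, cabs (g t j - p j) <= c * cabs t ^+ k].

Definition ord_curve (g : C -> pt) (p : pt) : \bar R :=
  ereal_sup [set ((k%:R : R)%:E) | k in [set k | cvanishes_to g p k]].

(* Delta_1(M,p) computed with the local defining function r *)
Definition Delta1 (r : pt -> R) (p : pt) : \bar R :=
  ereal_sup [set x | exists g, Gamma p g /\ x = (ord (r \o g) / ord_curve g p)%E].

Definition Gamma_reg (p : pt) (g : C -> pt) := Gamma p g /\ ord_curve g p = 1%E.

Definition Delta1_reg (r : pt -> R) (p : pt) : \bar R :=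
  ereal_sup [set x | exists g, Gamma_reg p g /\ x = ord (r \o g)].

Definition tangent_inf_order (r : pt -> R) (g : C -> pt) :=
  forall N : nat, vanishes_to (r \o g) N.

(* (j,false) = d/dz_j ; (j,true) = d/dzbar_j *)
Fixpoint wirt (os : seq ('I_n * bool)) (f : pt -> R) : pt -> C :=
  match os with
  | [::] => fun z => Complex (f z) 0
  | o :: os' => fun z =>
      (wirt os' (pd (o.1, false) f) z +
       (if o.2 then 'i%C else - 'i%C) * wirt os' (pd (o.1, true) f) z) / 2%:R
  end.

Definition multi_index := {ffun 'I_n -> nat}.

Definition wword (a b : multi_index) : seq ('I_n * bool) :=
  flatten [seq nseq (a j) (j, false) ++ nseq (b j) (j, true) | j <- enum 'I_n].

Definition coef (f : pt -> R) (a b : multi_index) : C :=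
  wirt (wword a b) f origin / ((\prod_j ((a j)`! * (b j)`!)%N)%:R).

Definition madd (a b : multi_index) : multi_index := [ffun j => (a j + b j)%N].

Definition Ssupp (f : pt -> R) : set multi_index :=
  [set g | exists a b, madd a b = g /\ coef f a b != 0].

Definition embed (g : multi_index) : 'rV[R]_n := \row_j ((g j)%:R).

Definition Newton_plus (f : pt -> R) : set 'rV[R]_n :=
  [set xi | exists (m : nat) (lam : 'I_m -> R) (x : 'I_m -> 'rV[R]_n),
     [/\ (forall i, 0 <= lam i), \sum_i lam i = 1,
         (forall i, exists2 g, Ssupp f g & forall j, embed g 0 j <= x i 0 j) &
         xi = \sum_i lam i *: x i]].

Definition convenient (f : pt -> R) :=
  forall j : 'I_n, exists2 xi, Newton_plus f xi & forall k, k != j -> xi 0 k = 0.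

Definition wdot (w xi : 'rV[R]_n) : R := \sum_j w 0 j * xi 0 j.

Definition face (f : pt -> R) (kappa : set 'rV[R]_n) :=
  exists (w : 'rV[R]_n) (m : R),
    [/\ forall xi, Newton_plus f xi -> m <= wdot w xi,
        kappa = [set xi | Newton_plus f xi /\ wdot w xi = m] &
        kappa !=set0].

Definition compact_face (f : pt -> R) (kappa : set 'rV[R]_n) :=
  face f kappa /\ compact kappa.

Definition monom (a b : multi_index) (z : pt) : C :=
  \prod_j (z j ^+ a j * (z j)^*%C ^+ b j).

Definition Fpart (f : pt -> R) (kappa : set 'rV[R]_n) (z : pt) : C :=
  \sum_(ab \in [set ab : multi_index * multi_index | kappa (embed (madd ab.1 ab.2))])
     coef f ab.1 ab.2 * monom ab.1 ab.2 z.

Definition Gamma_kappa (f : pt -> R) (kappa : set 'rV[R]_n) (g : C -> pt) :=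
  exists (c : 'I_n -> C) (a : 'I_n -> nat),
    [/\ forall j, c j != 0,
        (exists l : nat,
           [set xi | Newton_plus f xi /\ wdot (\row_j ((a j)%:R)) xi = l%:R] = kappa) &
        g = fun t j => c j * t ^+ a j].

Definition Nnondeg_part (f : pt -> R) (kappa : set 'rV[R]_n) :=
  forall g, Gamma_kappa f kappa g -> ~ (forall t, Fpart f kappa (g t) = 0).

Definition Nnondeg (f : pt -> R) :=
  forall kappa, compact_face f kappa -> Nnondeg_part f kappa.

Definition holo_coord (p : pt) (Phi Psi : pt -> pt) :=
  [/\ Phi p = origin, Psi origin = p,
      (forall j, holo_near (fun z => Phi z j) p),
      (forall j, holo_near (fun z => Psi z j) origin) &
      exists2 e : R, 0 < e &
        (forall z, polydisc p e z -> Psi (Phi z) = z) /\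
        (forall z, polydisc origin e z -> Phi (Psi z) = z)].

Definition in_coord (M : set pt) (Psi : pt -> pt) : set pt := [set z | M (Psi z)].

Definition N_canonical (M : set pt) (p : pt) (Phi Psi : pt -> pt) :=
  holo_coord p Phi Psi /\
  exists rho, local_defining_function (in_coord M Psi) origin rho /\ Nnondeg rho.

End Defs.

(* Main.v *)
(** Let [rho] be an N-nondegenerate defining function in the given coordinate.

    If [rho] is not convenient, its Taylor coefficients along some coordinate axis all vanish,
    so that axis is a regular curve tangent to [M] to infinite order; the same argument applies
    to any coordinate and gives (5) => (3).

    If [rho] is convenient, contact orders are uniformly bounded. Write the components of a
    curve as [G_j = c_j t^(a_j) + O(t^(a_j + 1))], take [a] as a weight, and let [l] be the
    minimum of this weight on the Newton polyhedron, attained on the compact face [kappa].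
    Then [rho (G (s t0)) = s^l F_kappa (c t0^a) + O(s^(l + 1))] for real [s], and
    nondegeneracy provides [t0] with [F_kappa (c t0^a) <> 0], so the order of [rho o G] is at
    most [l], which convenience bounds by [K * min_j a_j].  Hence (1), (2) and (4) each force
    [rho] not to be convenient.

    Holomorphy is only given as complex differentiability, so Taylor expansions of holomorphic
    functions come from Goursat's bisection argument, applied to trapezoidal sums along
    polygons instead of integrals.  Two defining functions in different coordinates vanish to
    the same order along curves because both are comparable to the distance to [M], which
    requires only Lipschitz bounds and the intermediate value theorem. *)

Require Import Defs.
From HB Require Import structures.
From mathcomp Require Import all_boot all_order all_algebra.
From mathcomp Require Import complex.
From mathcomp Require Import classical_sets boolp fsbigop reals ereal topology normedtype derive.
From mathcomp Require Import ring lra.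

Set Implicit Arguments.
Unset Strict Implicit.
Unset Printing Implicit Defensive.

Import Order.TTheory GRing.Theory Num.Theory numFieldNormedType.Exports.
Local Open Scope classical_set_scope.
Local Open Scope ring_scope.

(** * One-variable Cauchy theory without integrals *)

Section ComplexModulus.
Variable R : realType.
Local Notation C := (R[i]).
Local Notation abs := (@cabs R).
Implicit Types x y z w : C.

(** Convergence of trapezoidal sums to an integral is never established. Sums over triangles tend to
    0, and beyond that only sums of the same level [N] are compared: the sum of [1 / z] around the
    square stands in for [2 pi i] and only has to stay away from 0. Taylor coefficients are limits
    of quotients of two such sums, whose convergence needs its own argument. The defining function
    is merely smooth, so its lowest-order part along a curve is a polynomial in [t] and its
    conjugate, which may vanish in some directions. On a ray [t = s t0] with [s > 0] every monomial
    becomes a power of [s] times a constant, and nondegeneracy supplies a good [t0]. Since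
    [Gamma_kappa] asks for nonzero coefficients and compactness of the face comes from positive
    weights, an identically vanishing component must be given an artificial coefficient and weight.
    Taylor coefficients of [rho] are defined by Wirtinger derivatives in one fixed order, while
    differentiation along rays yields them in every order; hence the need for symmetry of mixed
    derivatives. *)

Definition ofr (t : R) : C := Complex t 0.

Lemma cabsE z : abs z = Num.sqrt (complex.Re z ^+ 2 + complex.Im z ^+ 2).
Proof. by case: z. Qed.
Lemma cabs_ge0 z : 0 <= abs z.
Proof. by rewrite cabsE sqrtr_ge0. Qed.
Lemma cabs_sqr z : abs z ^+ 2 = complex.Re z ^+ 2 + complex.Im z ^+ 2.
Proof. by rewrite cabsE sqr_sqrtr // addr_ge0 // sqr_ge0. Qed.
Lemma cabs0 : abs 0 = 0. Proof. exact: Normc.normc0. Qed.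
Lemma cabs1 : abs 1 = 1. Proof. exact: Normc.normc1. Qed.
Lemma cabsM x y : abs (x * y) = abs x * abs y.
Proof. exact: Normc.normcM. Qed.
Lemma cabsV x : abs x^-1 = (abs x)^-1.
Proof. exact: Normc.normcV. Qed.
Lemma cabsX x k : abs (x ^+ k) = abs x ^+ k.
Proof. by elim: k => [|k IH]; rewrite ?expr0 ?cabs1 // !exprS cabsM IH. Qed.
Lemma cabsN x : abs (- x) = abs x.
Proof. by rewrite !cabsE; case: x => a b /=; rewrite !sqrrN. Qed.
Lemma cabsB x y : abs (x - y) = abs (y - x).
Proof. by rewrite -cabsN opprB. Qed.
Lemma ler_cabsD x y : abs (x + y) <= abs x + abs y.
Proof. exact: le_normcD. Qed.
Lemma ler_cabsB x y : abs (x - y) <= abs x + abs y.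
Proof. by rewrite (le_trans (ler_cabsD _ _)) // cabsN. Qed.
Lemma cabs_eq0 z : (abs z == 0) = (z == 0).
Proof.
apply/eqP/eqP => [|->]; last exact: cabs0.
exact: Normc.eq0_normc.
Qed.
Lemma cabs_gt0 z : (0 < abs z) = (z != 0).
Proof. by rewrite lt_def cabs_ge0 andbT cabs_eq0. Qed.
Lemma cabs_ofr t : abs (ofr t) = `|t|.
Proof. by rewrite cabsE /= expr0n /= addr0 sqrtr_sqr. Qed.
Lemma cabs_Re z : `|complex.Re z| <= abs z.
Proof.
rewrite -(ler_pXn2r (n := 2)) ?nnegrE ?cabs_ge0 // cabs_sqr real_normK ?num_real //.
by rewrite lerDl sqr_ge0.
Qed.
Lemma cabs_Im z : `|complex.Im z| <= abs z.
Proof.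
rewrite -(ler_pXn2r (n := 2)) ?nnegrE ?cabs_ge0 // cabs_sqr real_normK ?num_real //.
by rewrite lerDr sqr_ge0.
Qed.
Lemma cabs_ReIm z : abs z <= `|complex.Re z| + `|complex.Im z|.
Proof.
rewrite -(ler_pXn2r (n := 2)) ?nnegrE ?cabs_ge0 ?addr_ge0 // cabs_sqr sqrrD.
rewrite !real_normK ?num_real // addrAC lerDl.
by rewrite mulrn_wge0 // mulr_ge0.
Qed.
Lemma cabs_conj z : abs (z^*)%C = abs z.
Proof. by rewrite !cabsE; case: z => a b /=; rewrite sqrrN. Qed.
Lemma ler_cabs_sum I (r : seq I) (P : pred I) (F : I -> C) :
  abs (\sum_(i <- r | P i) F i) <= \sum_(i <- r | P i) abs (F i).
Proof.
elim/big_ind2: _ => [|x u y v hx hy|//]; first by rewrite cabs0.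
exact: le_trans (ler_cabsD _ _) (lerD hx hy).
Qed.
Lemma ofr_nat k : ofr k%:R = k%:R.
Proof.
elim: k => [|k IH]; first by [].
by rewrite -!natr1 -IH /ofr; apply/eqP; rewrite eq_complex /= addr0 !eqxx.
Qed.
Lemma cabs_nat k : abs (k%:R) = k%:R.
Proof. by rewrite -ofr_nat cabs_ofr ger0_norm. Qed.
Lemma lerB_cabs x y : abs x - abs y <= abs (x - y).
Proof. by rewrite lerBlDr -{1}(subrK y x) ler_cabsD. Qed.
Lemma ofrD s t : ofr (s + t) = ofr s + ofr t.
Proof. by apply/eqP; rewrite eq_complex /= addr0 !eqxx. Qed.
Lemma ofrM s t : ofr (s * t) = ofr s * ofr t.
Proof. by apply/eqP; rewrite eq_complex /= !mul0r mulr0 subr0 addr0 !eqxx. Qed.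
Lemma ofr0 : ofr 0 = 0. Proof. by []. Qed.
Lemma ofr1 : ofr 1 = 1. Proof. by []. Qed.
Lemma ofrV s : ofr s^-1 = (ofr s)^-1.
Proof.
have [->|s0] := eqVneq s 0; first by rewrite invr0 ofr0 invr0.
have n0 : ofr s != 0 by rewrite eq_complex /= eqxx andbT.
by apply: (mulfI n0); rewrite mulfV // -ofrM mulfV.
Qed.
Lemma ofrX s k : ofr (s ^+ k) = ofr s ^+ k.
Proof. by elim: k => [|k IH]; rewrite ?expr0 // !exprS ofrM IH. Qed.
Lemma ofrN s : ofr (- s) = - ofr s.
Proof. by apply/eqP; rewrite eq_complex /= oppr0 !eqxx. Qed.
Lemma ofrB s t : ofr (s - t) = ofr s - ofr t.
Proof. by rewrite ofrD ofrN. Qed.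

Definition null (u : nat -> C) := forall e : R, 0 < e ->
  exists N0 : nat, forall N, (N0 <= N)%N -> abs (u N) <= e.

Lemma nullD u v : null u -> null v -> null (fun N => u N + v N).
Proof.
move=> hu hv e e0; have e2 : 0 < e / 2 by rewrite divr_gt0.
have [N1 h1] := hu _ e2; have [N2 h2] := hv _ e2.
exists (maxn N1 N2) => N; rewrite geq_max => /andP[/h1 k1 /h2 k2].
by rewrite (le_trans (ler_cabsD _ _)) // (splitr e) lerD.
Qed.
Lemma nullM a u : null u -> null (fun N => a * u N).
Proof.
move=> hu e e0; have c0 : 0 < 1 + abs a by rewrite ltr_wpDr // cabs_ge0.
have [N1 h1] := hu _ (divr_gt0 e0 c0); exists N1 => N /h1 k.
rewrite cabsM (le_trans (ler_wpM2l (cabs_ge0 a) k)) // mulrCA ler_piMr ?(ltW e0) //.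
by rewrite ler_pdivrMr // mul1r lerDr.
Qed.
Lemma null_sum I (r : seq I) (u : I -> nat -> C) : (forall i, null (u i)) ->
  null (fun N => \sum_(i <- r) u i N).
Proof.
move=> hu; elim: r => [|i r IH].
  by move=> e e0; exists 0%N => N _; rewrite big_nil cabs0 ltW.
have h := nullD (hu i) IH; move=> e e0; have [N0 k] := h e e0.
by exists N0 => N /k; rewrite big_cons.
Qed.
Lemma null_ext u v : u =1 v -> null u -> null v.
Proof. by move=> /funext ->. Qed.

Definition ccauchy (u : nat -> C) := forall e : R, 0 < e ->
  exists N0 : nat, forall N M, (N0 <= N)%N -> (N0 <= M)%N -> abs (u N - u M) <= e.

(** The limit is found as the supremum of the eventual lower bounds of the sequence. *)
Lemma real_complete (u : nat -> R) :
  (forall e : R, 0 < e ->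
    exists N0 : nat, forall N M, (N0 <= N)%N -> (N0 <= M)%N -> `|u N - u M| <= e) ->
  exists l, forall e : R, 0 < e ->
    exists N0 : nat, forall N, (N0 <= N)%N -> `|u N - l| <= e.
Proof.
move=> hu; pose S := [set t : R | exists N0 : nat, forall N, (N0 <= N)%N -> t <= u N].
have low (e : R) N0 : (forall N M, (N0 <= N)%N -> (N0 <= M)%N -> `|u N - u M| <= e) ->
    S (u N0 - e).
  move=> h; exists N0 => N hN; have := h N0 N (leqnn _) hN.
  by rewrite ler_norml; lra.
have up (e : R) N0 : (forall N M, (N0 <= N)%N -> (N0 <= M)%N -> `|u N - u M| <= e) ->
    forall t : R, S t -> t <= u N0 + e.
  move=> h t [N1 h1]; have := h (maxn N0 N1) N0 (leq_maxl _ _) (leqnn _).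
  have := h1 _ (leq_maxr N0 N1); rewrite ler_norml; lra.
have hS : has_sup S.
  have [N0 h] := hu 1 ltr01; split; first by exists (u N0 - 1); exact: low.
  by exists (u N0 + 1) => x; exact: up.
exists (sup S) => e e0; have [N0 h] := hu _ (divr_gt0 e0 (ltr0Sn R 1)).
exists N0 => N hN.
have hh M M' : (N <= M)%N -> (N <= M')%N -> `|u M - u M'| <= e / 2.
  by move=> a b; apply: h; exact: leq_trans hN _.
have := ub_le_sup hS.2 (low _ _ hh).
have := ge_sup hS.1 (up _ _ hh).
rewrite ler_norml; lra.
Qed.

Lemma complex_complete (u : nat -> C) : ccauchy u -> exists l, null (fun N => u N - l).
Proof.
move=> hu.
have [a ha] : exists l, forall e : R, 0 < e ->
    exists N0 : nat, forall N, (N0 <= N)%N -> `|complex.Re (u N) - l| <= e.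
  apply: real_complete => e /hu[N0 h]; exists N0 => N M h1 h2.
  by rewrite -raddfB (le_trans (cabs_Re _)) // h.
have [b hb] : exists l, forall e : R, 0 < e ->
    exists N0 : nat, forall N, (N0 <= N)%N -> `|complex.Im (u N) - l| <= e.
  apply: real_complete => e /hu[N0 h]; exists N0 => N M h1 h2.
  by rewrite -raddfB (le_trans (cabs_Im _)) // h.
exists (Complex a b) => e e0; have e2 := divr_gt0 e0 (ltr0Sn R 1).
have [N1 h1] := ha _ e2; have [N2 h2] := hb _ e2.
exists (maxn N1 N2) => N; rewrite geq_max => /andP[/h1 k1 /h2 k2].
rewrite (le_trans (cabs_ReIm _)) // (splitr e) !raddfB /=.
exact: lerD.
Qed.
End ComplexModulus.

(** * Trapezoidal sums along segments and triangles *)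

Section Trapezoid.
Variable R : realType.
Local Notation C := (R[i]).
Local Notation abs := (@cabs R).

Lemma ofr_half : @ofr R (1 / 2) = 2%:R^-1.
Proof. by rewrite mul1r ofrV ofr_nat. Qed.

(* [h = 0] is allowed, unlike in [cdiff_at]. *)
Lemma cdiff_atP (g : C -> C) z0 : cdiff_at g z0 <->
  exists l : C, forall e : R, 0 < e -> exists2 d : R, 0 < d &
    forall h : C, abs h < d -> abs (g (z0 + h) - g z0 - l * h) <= e * abs h.
Proof.
split=> -[l hl]; exists l => e e0.
  have [d d0 hd] := hl e e0; exists d => // h hh.
  have [->|h0] := eqVneq h 0; first by rewrite addr0 subrr mulr0 subrr cabs0 mulr0.
  have := hd h; rewrite cabs_gt0 h0 hh => /(_ isT) /ltW.
  rewrite -(ler_pM2r (x := abs h)) ?cabs_gt0 // -cabsM.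
  by rewrite mulrBl divfK.
have [d d0 hd] := hl _ (divr_gt0 e0 (ltr0Sn R 1)); exists d => // h /andP[h0 hh].
have := hd h hh; have hn : h != 0 by rewrite -cabs_gt0.
have -> : (g (z0 + h) - g z0) / h - l = (g (z0 + h) - g z0 - l * h) / h.
  by rewrite [RHS]mulrBl mulfK.
rewrite cabsM cabsV ltr_pdivrMr // => /le_lt_trans; apply.
by rewrite ltr_pM2r // ltr_pdivrMr // mulr2n mulrDr mulr1 ltrDl.
Qed.

(* Iterated midpoint refinement of the trapezoidal approximation of the integral
   of [f] along the segment [[a, b]]; it is exact for affine [f]. *)
Fixpoint trap N (f : C -> C) (a b : C) : C :=
  match N with
  | 0 => (f a + f b) / 2%:R * (b - a)
  | N'.+1 => trap N' f a ((a + b) / 2%:R) + trap N' f ((a + b) / 2%:R) b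
  end.

Lemma trap0 f a b : trap 0 f a b = (f a + f b) / 2%:R * (b - a).
Proof. by []. Qed.
Lemma trapS N f a b :
  trap N.+1 f a b = trap N f a ((a + b) / 2%:R) + trap N f ((a + b) / 2%:R) b.
Proof. by []. Qed.

Lemma trap_sym N f a b : trap N f b a = - trap N f a b.
Proof.
elim: N a b => [|N IH] a b; first by (rewrite !trap0; field).
by rewrite !trapS (addrC b a) (IH _ b) (IH a); ring.
Qed.

Lemma trap_lin N (u : C) f g a b :
  trap N (fun z => u * f z + g z) a b = u * trap N f a b + trap N g a b.
Proof. by elim: N a b => [|N IH] a b; [rewrite !trap0; field | rewrite !trapS !IH; ring]. Qed.

Lemma trap_affine N (u v : C) a b :
  trap N (fun z => u * z + v) a b = u * (b ^+ 2 - a ^+ 2) / 2%:R + v * (b - a).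
Proof. by elim: N a b => [|N IH] a b; [rewrite !trap0; field | rewrite !trapS !IH; field]. Qed.

(** Closure under midpoints is the right notion here, because [trap] evaluates [f] only at points
    obtained by repeated bisection. *)
Definition midconvex (D : set C) := forall x y, D x -> D y -> D ((x + y) / 2%:R).

Lemma half_segl (a b : C) : (a + b) / 2%:R - a = (b - a) / 2%:R.
Proof. by field. Qed.
Lemma half_segr (a b : C) : b - (a + b) / 2%:R = (b - a) / 2%:R.
Proof. by field. Qed.
Lemma cabs_half (z : C) : abs (z / 2%:R) = abs z / 2%:R.
Proof. by rewrite cabsM cabsV cabs_nat. Qed.

Lemma trap_ext (D : set C) N f g a b : midconvex D -> D a -> D b ->
  (forall z, D z -> f z = g z) -> trap N f a b = trap N g a b.
Proof.
move=> mD + + fg; elim: N a b => [|N IH] a b Da Db; first by rewrite !trap0 !fg.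
by rewrite !trapS !IH //; exact: mD.
Qed.

Lemma trap_bound (D : set C) (B : R) N f a b : midconvex D -> D a -> D b ->
  (forall z, D z -> abs (f z) <= B) -> abs (trap N f a b) <= B * abs (b - a).
Proof.
move=> mD + + fB; elim: N a b => [|N IH] a b Da Db.
  rewrite trap0 cabsM ler_wpM2r ?cabs_ge0 // cabs_half ler_pdivrMr //.
  by rewrite (le_trans (ler_cabsD _ _)) // mulr2n mulrDr mulr1 lerD // fB.
have Dm := mD _ _ Da Db.
rewrite trapS (le_trans (ler_cabsD _ _)) // (le_trans (lerD (IH _ _ Da Dm) (IH _ _ Dm Db))) //.
by rewrite half_segl half_segr cabs_half -mulrDr -splitr.
Qed.

(** Each bisection halves both the increment [b - a] and the bound [m]. This serves to bound the sum
    of [1 / z] around the square from below. *)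
Lemma trap_Im (D : set C) (m : R) N f a b : midconvex D -> D a -> D b ->
  (forall z, D z -> m <= complex.Im (f z * (b - a))) -> m <= complex.Im (trap N f a b).
Proof.
move=> mD; elim: N a b m => [|N IH] a b m Da Db fm.
  rewrite trap0.
  have -> : (f a + f b) / 2%:R * (b - a) = (f a * (b - a) + f b * (b - a)) * (ofr (1/2)).
    rewrite ofr_half.
    by rewrite -mulrDl; ring.
  rewrite mulrC; have := fm _ Da; have := fm _ Db.
  case: (f a * (b - a)) => x y; case: (f b * (b - a)) => x' y' /=.
  lra.
have Dm := mD _ _ Da Db; rewrite trapS raddfD (splitr m).
apply: lerD; apply: IH => // z /fm; rewrite ?half_segl ?half_segr mulrA.
  have -> : f z * (b - a) / 2%:R = ofr (1/2) * (f z * (b - a)).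
    rewrite ofr_half.
    by rewrite mulrC.
  by case: (f z * (b - a)) => x y /=; lra.
have -> : f z * (b - a) / 2%:R = ofr (1/2) * (f z * (b - a)).
  rewrite ofr_half.
  by rewrite mulrC.
by case: (f z * (b - a)) => x y /=; lra.
Qed.

Definition tri N f a b c := trap N f a b + trap N f b c + trap N f c a.

Lemma tri_rot N f a b c : tri N f a b c = tri N f b c a.
Proof. by rewrite /tri -[LHS]addrA [LHS]addrC. Qed.

(** One level of refinement of the outer edges is spent on the bisection, and each inner edge is
    traversed once in either direction, so the inner contributions cancel. *)
Lemma tri_split N f a b c :
  let ab := (a + b) / 2%:R in let bc := (b + c) / 2%:R in let ca := (c + a) / 2%:R in
  tri N.+1 f a b c = tri N f a ab ca + tri N f ab b bc + tri N f bc c ca + tri N f ab bc ca.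
Proof.
move=> ab bc ca; rewrite /tri !trapS -/ab -/bc -/ca.
by rewrite (trap_sym N f ab ca) (trap_sym N f ab bc) (trap_sym N f bc ca); ring.
Qed.

Lemma tri_lin N (u : C) f g a b c :
  tri N (fun z => u * f z + g z) a b c = u * tri N f a b c + tri N g a b c.
Proof. by rewrite /tri !trap_lin; ring. Qed.

Lemma tri_affine N (u v : C) a b c : tri N (fun z => u * z + v) a b c = 0.
Proof. by rewrite /tri !trap_affine; field. Qed.

Lemma tri_bound (D : set C) (B d : R) N f a b c : midconvex D -> D a -> D b -> D c ->
  0 <= B -> abs (b - a) <= d -> abs (c - b) <= d -> abs (a - c) <= d ->
  (forall z, D z -> abs (f z) <= B) -> abs (tri N f a b c) <= 3%:R * (B * d).
Proof.
move=> mD Da Db Dc B0 hab hbc hca fB.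
have t x y : D x -> D y -> abs (y - x) <= d -> abs (trap N f x y) <= B * d.
  move=> Dx Dy h; apply: (le_trans (trap_bound N mD Dx Dy fB)).
  exact: ler_wpM2l.
rewrite /tri (le_trans (ler_cabsD _ _)) //.
have := ler_cabsD (trap N f a b) (trap N f b c).
have := t _ _ Da Db hab; have := t _ _ Db Dc hbc; have := t _ _ Dc Da hca; lra.
Qed.

(** Topological closedness spelled out with [cabs]; it keeps the limit of nested triangles inside
    [D]. *)
Definition limclosed (D : set C) :=
  forall z, (forall e : R, 0 < e -> exists2 y, D y & abs (y - z) < e) -> D z.

Lemma midconvex_ball (w : C) (r : R) : midconvex [set z | abs (z - w) <= r].
Proof.
move=> x y /= hx hy.
have -> : (x + y) / 2%:R - w = ((x - w) + (y - w)) / 2%:R by field.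
rewrite cabs_half ler_pdivrMr // (le_trans (ler_cabsD _ _)) //.
by rewrite mulr2n mulrDr mulr1 lerD.
Qed.

Lemma limclosed_ball (w : C) (r : R) : limclosed [set z | abs (z - w) <= r].
Proof.
move=> z h /=; rewrite leNgt; apply/negP => hr.
have [y /= hy] := h _ (ltac:(rewrite subr_gt0; exact: hr) : 0 < abs (z - w) - r).
have := ler_cabsD (z - y) (y - w); rewrite (cabsB z y).
have -> : z - y + (y - w) = z - w by ring.
lra.
Qed.

Lemma midconvex_half (u w : C) (r : R) : midconvex [set z | r <= complex.Re (u * (z - w))].
Proof.
move=> x y /= hx hy.
have -> : u * ((x + y) / 2%:R - w) = ofr (1/2) * (u * (x - w) + u * (y - w)).
  rewrite ofr_half.
  by field.
move: hx hy; case: (u * (x - w)) => p q; case: (u * (y - w)) => p' q' /=; lra.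
Qed.

Lemma limclosed_half (u w : C) (r : R) : limclosed [set z | r <= complex.Re (u * (z - w))].
Proof.
move=> z h /=; rewrite leNgt; apply/negP => hr.
have c0 : 0 < 1 + abs u by rewrite ltr_pwDl // cabs_ge0.
have dd : 0 < (r - complex.Re (u * (z - w))) / (1 + abs u) by rewrite divr_gt0 // subr_gt0.
have [y /= hy hyz] := h _ dd.
have : complex.Re (u * (y - w)) - complex.Re (u * (z - w)) <= abs u * abs (y - z).
  rewrite -raddfB -mulrBr -cabsM (_ : y - w - (z - w) = y - z); last by ring.
  exact: le_trans (ler_norm _) (cabs_Re _).
have := cabs_ge0 u; have := cabs_ge0 (y - z); move: hyz; rewrite ltr_pdivlMr //; nra.
Qed.

Lemma midconvexI (D E : set C) : midconvex D -> midconvex E -> midconvex (D `&` E).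
Proof. by move=> hD hE x y [? ?] [? ?]; split; [exact: hD | exact: hE]. Qed.

Lemma limclosedI (D E : set C) : limclosed D -> limclosed E -> limclosed (D `&` E).
Proof.
by move=> hD hE z h; split; [apply: hD | apply: hE] => e /h[y [? ?] ?]; exists y.
Qed.

End Trapezoid.

(** * Goursat's theorem for trapezoidal sums *)

Section Goursat.
Variable R : realType.
Local Notation C := (R[i]).
Local Notation abs := (@cabs R).

Lemma exp2_gt (c : R) : exists k : nat, c < 2%:R ^+ k.
Proof.
exists (Num.bound `|c|); rewrite (le_lt_trans (ler_norm c)) //.
rewrite (lt_trans (archi_boundP (normr_ge0 c))) // -natrX ltr_nat.
exact: ltn_expl.
Qed.

Lemma div_exp2_small (d e : R) : 0 < e -> exists k : nat, d / 2%:R ^+ k < e.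
Proof.
move=> e0; have [k hk] := exp2_gt (d / e); exists k.
by rewrite ltr_pdivrMr ?exprn_gt0 // mulrC -ltr_pdivrMr.
Qed.

Lemma div_exp2S (d : R) k : d / 2%:R ^+ k.+1 = d / 2%:R ^+ k / 2%:R.
Proof. by rewrite exprSr invfM mulrA. Qed.

Lemma geometric_limit (u : nat -> C) (d : R) : 0 <= d ->
  (forall k, abs (u k.+1 - u k) <= d / 2%:R ^+ k) ->
  exists l, forall k, abs (u k - l) <= 2%:R * (d / 2%:R ^+ k).
Proof.
move=> d0 hu.
have p0 k : 0 <= d / 2%:R ^+ k by rewrite divr_ge0 // exprn_ge0.
have tel k m : abs (u (k + m)%N - u k) <= 2%:R * (d / 2%:R ^+ k) - 2%:R * (d / 2%:R ^+ (k + m)).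
  elim: m => [|m IH]; first by rewrite addn0 subrr cabs0 subrr.
  rewrite addnS; have := ler_cabsD (u (k + m).+1 - u (k + m)%N) (u (k + m)%N - u k).
  rewrite addrA subrK; have := hu (k + m)%N; rewrite div_exp2S; move: IH; lra.
have tel' k m : (k <= m)%N -> abs (u m - u k) <= 2%:R * (d / 2%:R ^+ k).
  by move=> /subnKC <-; have := tel k (m - k)%N; have := p0 (k + (m - k))%N; lra.
have [l hl] : exists l, null (fun N => u N - l).
  apply: complex_complete => e e0; have [k hk] := div_exp2_small (4%:R * d) e0.
  exists k => N M hN hM; have := ler_cabsB (u N - u k) (u M - u k).
  have -> : u N - u k - (u M - u k) = u N - u M by ring.
  have := tel' _ _ hN; have := tel' _ _ hM; move: hk; rewrite -mulrA; lra.
exists l => k; apply/ler_addgt0Pr => e /hl[N0 h].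
have := h _ (leq_maxl N0 k); have := tel' _ _ (leq_maxr N0 k).
have := ler_cabsB (u (maxn N0 k) - l) (u (maxn N0 k) - u k).
have -> : u (maxn N0 k) - l - (u (maxn N0 k) - u k) = u k - l by ring.
lra.
Qed.

Variables (f : C -> C) (D : set C).
Hypotheses (mD : midconvex D) (cD : limclosed D).

(** Only large levels count, since passing to a subtriangle lowers the level by one. *)
Definition eventually_small (eta : R) (t : C * C * C) := exists N0 : nat,
  forall N, (N0 <= N)%N -> abs (tri N f t.1.1 t.1.2 t.2) <= eta.
Definition vertices_in (t : C * C * C) := [/\ D t.1.1, D t.1.2 & D t.2].
Definition diam_le (d : R) (t : C * C * C) :=
  [/\ abs (t.1.2 - t.1.1) <= d, abs (t.2 - t.1.2) <= d & abs (t.1.1 - t.2) <= d].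

Lemma eventually_smallD (t t1 t2 t3 t4 : C * C * C) eta :
  (forall N, tri N.+1 f t.1.1 t.1.2 t.2 = tri N f t1.1.1 t1.1.2 t1.2 +
     tri N f t2.1.1 t2.1.2 t2.2 + tri N f t3.1.1 t3.1.2 t3.2 + tri N f t4.1.1 t4.1.2 t4.2) ->
  eventually_small (eta / 4%:R) t1 -> eventually_small (eta / 4%:R) t2 ->
  eventually_small (eta / 4%:R) t3 -> eventually_small (eta / 4%:R) t4 ->
  eventually_small eta t.
Proof.
move=> ht [N1 h1] [N2 h2] [N3 h3] [N4 h4].
exists (maxn (maxn N1 N2) (maxn N3 N4)).+1 => -[//|N]; rewrite ltnS !geq_max.
move=> /andP[/andP[/h1 k1 /h2 k2] /andP[/h3 k3 /h4 k4]]; rewrite ht.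
have := ler_cabsD (tri N f t1.1.1 t1.1.2 t1.2) (tri N f t2.1.1 t2.1.2 t2.2).
have := ler_cabsD (tri N f t1.1.1 t1.1.2 t1.2 + tri N f t2.1.1 t2.1.2 t2.2) (tri N f t3.1.1 t3.1.2 t3.2).
have := ler_cabsD (tri N f t1.1.1 t1.1.2 t1.2 + tri N f t2.1.1 t2.1.2 t2.2 + tri N f t3.1.1 t3.1.2 t3.2)
  (tri N f t4.1.1 t4.1.2 t4.2).
lra.
Qed.

(** If all four subtriangles were eventually below [eta / 4], the whole triangle would be eventually
    below [eta]. The last clause makes the first vertices of the successive triangles converge. *)
Lemma goursat_step t d eta : vertices_in t -> diam_le d t -> ~ eventually_small eta t ->
  exists t', [/\ vertices_in t', diam_le (d / 2%:R) t', ~ eventually_small (eta / 4%:R) t' &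
     abs (t'.1.1 - t.1.1) <= d].
Proof.
case: t => [[a b] c] [/= Da Db Dc] [/= dab dbc dca] ng.
have d0 : 0 <= d := le_trans (cabs_ge0 _) dab.
set ab := (a + b) / 2%:R; set bc := (b + c) / 2%:R; set ca := (c + a) / 2%:R.
have half x y z : x = y / 2%:R -> abs y <= z -> abs x <= z / 2%:R.
  by move=> -> h; rewrite cabs_half ler_pM2r // invr_gt0.
have dba : abs (a - b) <= d by rewrite cabsB.
have dcb : abs (b - c) <= d by rewrite cabsB.
have dac : abs (c - a) <= d by rewrite cabsB.
have Dab := mD Da Db; have Dbc := mD Db Dc; have Dca := mD Dc Da.
have near : abs (ab - a) <= d.
  by rewrite half_segl cabs_half ler_pdivrMr //; lra.
have near2 : abs (bc - a) <= d.
  have -> : bc - a = ((b - a) + (c - a)) / 2%:R by rewrite /bc; field.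
  rewrite cabs_half ler_pdivrMr //; have := ler_cabsD (b - a) (c - a); lra.
have [h1|h1] := pselect (eventually_small (eta / 4%:R) (a, ab, ca)); last first.
  exists (a, ab, ca); split => //=; last by rewrite subrr cabs0.
  by split => /=; [apply: (half _ (b - a)) | apply: (half _ (c - b)) |
    apply: (half _ (a - c))] => //; rewrite /ab /ca; field.
have [h2|h2] := pselect (eventually_small (eta / 4%:R) (ab, b, bc)); last first.
  exists (ab, b, bc); split => //=.
  by split => /=; [apply: (half _ (b - a)) | apply: (half _ (c - b)) |
    apply: (half _ (a - c))] => //; rewrite /ab /bc; field.
have [h3|h3] := pselect (eventually_small (eta / 4%:R) (bc, c, ca)); last first.
  exists (bc, c, ca); split => //=.
  by split => /=; [apply: (half _ (c - b)) | apply: (half _ (a - c)) |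
    apply: (half _ (b - a))] => //; rewrite /bc /ca; field.
have [h4|h4] := pselect (eventually_small (eta / 4%:R) (ab, bc, ca)); last first.
  exists (ab, bc, ca); split => //=.
  by split => /=; [apply: (half _ (c - a)) | apply: (half _ (a - b)) |
    apply: (half _ (b - c))] => //; rewrite /ab /bc /ca; field.
case: ng; apply: (eventually_smallD _ h1 h2 h3 h4) => N /=.
exact: tri_split.
Qed.

(** The bad triangles shrink to a point [l] of [D]. Near [l], [f] is affine up to a small multiple
    of the distance to [l], and affine functions have sum 0 at every level; so the sum over a late
    triangle is small relative to [4 ^ - k], at all levels at once. *)
Lemma goursat a b c : D a -> D b -> D c -> (forall z, D z -> cdiff_at f z) ->
  null (fun N => tri N f a b c).
Proof.
move=> Da Db Dc fD e e0.
pose d := abs (b - a) + abs (c - b) + abs (a - c) + 1.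
have := cabs_ge0 (b - a); have := cabs_ge0 (c - b); have := cabs_ge0 (a - c) => n1 n2 n3.
have d0 : 0 < d by rewrite /d; lra.
apply: contrapT => ng.
pose inv (k : nat) (t : C * C * C) := [/\ vertices_in t, diam_le (d / 2%:R ^+ k) t &
  ~ eventually_small (e / 4%:R ^+ k) t].
have [F hF] : {F : nat * (C * C * C) -> C * C * C & forall x, inv x.1 x.2 ->
    inv x.1.+1 (F x) /\ abs ((F x).1.1 - x.2.1.1) <= d / 2%:R ^+ x.1}.
  apply: (@choice _ _ (fun (x : nat * (C * C * C)) (y : C * C * C) => inv x.1 x.2 ->
    inv x.1.+1 y /\ abs (y.1.1 - x.2.1.1) <= d / 2%:R ^+ x.1)) => -[k t] /=.
  have [ht|nt] := pselect (inv k t); last by exists t.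
  case: ht => h1 h2 h3; have [t' [k1 k2 k3 k4]] := goursat_step h1 h2 h3.
  exists t' => _; split => //; split => //; first by rewrite div_exp2S.
  by rewrite exprSr invfM mulrA.
pose s := fix s k := if k is k'.+1 then F (k', s k') else (a, b, c).
have hs k : inv k (s k).
  elim: k => [|k IH] /=; last exact: (hF (k, s k) IH).1.
  split; [by split | split; rewrite expr0 divr1 /d /=; lra | ].
  by rewrite expr0 divr1 => -[N0 h]; apply: ng; exists N0.
have [l hl] := geometric_limit (ltW d0) (fun k => (hF (k, s k) (hs k)).2 : abs ((s k.+1).1.1 - (s k).1.1) <= _).
have Dl : D l.
  apply: cD => r r0; have [k hk] := div_exp2_small (2%:R * d) r0.
  exists (s k).1.1; first by have [[]] := hs k.
  by apply: (le_lt_trans (hl k)); rewrite mulrA.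
have [f' hf'] := (cdiff_atP _ _).1 (fD _ Dl).
(* With [dk = d / 2 ^ k], the final bound is 3 sides times length [dk] times distance [3 * dk] to
   [l], that is [9 * d ^ 2 / 4 ^ k]; this constant turns it into [e / 4 ^ k]. *)
have ed0 : 0 < e / (9%:R * d ^+ 2) by rewrite divr_gt0 // mulr_gt0 // exprn_gt0.
have [r r0 hr] := hf' _ ed0.
have [k hk] := div_exp2_small (3%:R * d) r0.
have [[D1 D2 D3] [d1 d2 d3] nk] := hs k.
apply: nk; exists 0%N => N _.
have {}hl := hl k.
set dk := d / _ ^+ k in d1 d2 d3 hl.
have dk0 : 0 < dk by rewrite divr_gt0 // exprn_gt0.
have hk' : 3%:R * dk < r by rewrite mulrA.
pose aff z := f' * z + (f l - f' * l).
have -> : tri N f (s k).1.1 (s k).1.2 (s k).2 =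
    tri N (fun z => f z - aff z) (s k).1.1 (s k).1.2 (s k).2.
  have -> : (fun z => f z - aff z) = (fun z => (- 1) * aff z + f z).
    by apply/funext => z; rewrite mulN1r addrC.
  by rewrite tri_lin tri_affine mulr0 add0r.
have in_ball z : abs (z - (s k).1.1) <= dk -> abs (z - l) <= 3%:R * dk.
  move=> h; have := ler_cabsD (z - (s k).1.1) ((s k).1.1 - l); rewrite addrA subrK; lra.
have B0 : 0 <= e / (9%:R * d ^+ 2) * (3%:R * dk).
  by rewrite mulr_ge0 ?(ltW ed0) // mulr_ge0 // ltW.
apply: (le_trans (tri_bound (D := [set z | abs (z - l) <= 3%:R * dk]) N
  (@midconvex_ball _ _ _) _ _ _ B0 d1 d2 d3 _)).
- by apply: in_ball; rewrite subrr cabs0 ltW.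
- exact: in_ball.
- by apply: in_ball; rewrite cabsB.
- move=> z /= hz; have := hr (z - l) (le_lt_trans hz hk').
  rewrite addrCA subrr addr0 => /le_trans h.
  have -> : f z - aff z = f z - f l - f' * (z - l) by rewrite /aff; ring.
  by apply: h; rewrite ler_wpM2l // ltW.
rewrite /dk le_eqVlt; apply/orP; left; apply/eqP.
have -> : (4%:R : R) ^+ k = 2%:R ^+ k * 2%:R ^+ k by rewrite -exprMn -natrM.
by field; rewrite expf_neq0 ?pnatr_eq0 // gt_eqF.
Qed.
End Goursat.

(** * Removable points and sums along a square *)

Section CauchyFormula.
Variable R : realType.
Local Notation C := (R[i]).
Local Notation abs := (@cabs R).

(* Near the vertex [w] the function need only be bounded: repeatedly cutting off the three
   subtriangles away from [w] leaves a triangle too small to matter. *)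
Lemma puncture (f : C -> C) (D : set C) (w u : C) (B r : R) :
  midconvex D -> limclosed D -> D w -> 0 < r ->
  (forall z, D z -> z != w -> cdiff_at f z) ->
  (forall z, D z -> abs (z - w) <= r -> abs (f z) <= B) ->
  forall a b, D a -> D b ->
  0 < complex.Re (u * (a - w)) -> 0 < complex.Re (u * (b - w)) ->
  null (fun N => tri N f a b w).
Proof.
move=> mD cD Dw r0 fD fB a b Da Db ua ub eta eta0.
have B0 : 0 <= B by apply: le_trans (cabs_ge0 (f w)) (fB w Dw _); rewrite subrr cabs0 ltW.
have B1 : 0 < 12%:R * (B + 1) by rewrite mulr_gt0 // ltr_wpDl.
(* A triangle inside the ball of radius [r'] has sides at most [2 * r'], and the factor 12 makes the
   bound of [tri_bound] at most [eta / 2]. *)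
pose r' := Num.min r (eta / (12%:R * (B + 1))).
have r'0 : 0 < r' by rewrite lt_min r0 divr_gt0.
have r'r : r' <= r by rewrite ge_min lexx.
have small : 3%:R * (B * (2%:R * r')) <= eta / 2%:R.
  have : r' <= eta / (12%:R * (B + 1)) by rewrite ge_min lexx orbT.
  rewrite ler_pdivlMr // => h.
  have : 0 <= r' by exact: ltW.
  nra.
(* Induction on the number of halvings that bring [a] and [b] into the ball of radius [r']. The
   slack above [eta / 2] is shared out: a sixth for each triangle cut off, one half for the
   remaining one. *)
have key k : forall a b, D a -> D b ->
    0 < complex.Re (u * (a - w)) -> 0 < complex.Re (u * (b - w)) ->
    abs (a - w) <= r' * 2%:R ^+ k -> abs (b - w) <= r' * 2%:R ^+ k ->
    forall eta', eta / 2%:R < eta' -> exists N0 : nat, forall N, (N0 <= N)%N ->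
      abs (tri N f a b w) <= eta'.
  elim: k {a b Da Db ua ub} => [|k IH] a b Da Db ua ub ha hb eta' he.
    rewrite expr0 mulr1 in ha hb; exists 0%N => N _.
    apply: (le_trans _ (ltW he)); apply: le_trans small.
    apply: (tri_bound (D := D `&` [set z | abs (z - w) <= r'])) => //.
    - exact: midconvexI (@midconvex_ball _ _ _).
    - by split => //=; rewrite subrr cabs0 ltW.
    - have := ler_cabsB (b - w) (a - w); have -> : b - w - (a - w) = b - a by ring.
      lra.
    - by rewrite cabsB; lra.
    - by lra.
    - by move=> z [Dz /= hz]; apply: fB => //; exact: le_trans hz r'r.
  set ab := (a + b) / 2%:R; set bw := (b + w) / 2%:R; set wa := (w + a) / 2%:R.
  have Ree (z z' : C) : complex.Re (u * ((z + z') / 2%:R - w)) =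
      (complex.Re (u * (z - w)) + complex.Re (u * (z' - w))) / 2%:R.
    have -> : u * ((z + z') / 2%:R - w) = ofr (1/2) * (u * (z - w) + u * (z' - w)).
      by rewrite ofr_half; field.
    case: (u * (z - w)) => p q; case: (u * (z' - w)) => p' q' /=; lra.
  have Rew : complex.Re (u * (w - w)) = 0 by rewrite subrr mulr0.
  pose m := Num.min (complex.Re (u * (a - w))) (complex.Re (u * (b - w))) / 2%:R.
  have m0 : 0 < m by rewrite divr_gt0 // lt_min ua ub.
  have [ma mb] : m *+ 2 <= complex.Re (u * (a - w)) /\ m *+ 2 <= complex.Re (u * (b - w)).
    by rewrite mulr2n -splitr !ge_min !lexx orbT.
  rewrite mulr2n in ma mb.
  (* A half plane holding the three subtriangles away from [w] but not [w] itself; the functional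
     given by [u] is there to separate them. *)
  pose E := D `&` [set z | m <= complex.Re (u * (z - w))].
  have mE : midconvex E by apply: midconvexI (@midconvex_half _ _ _ _).
  have cE : limclosed E by apply: limclosedI (@limclosed_half _ _ _ _).
  have fE z : E z -> cdiff_at f z.
    move=> [Dz /= hz]; apply: fD => //; apply/eqP => zw.
    by move: hz; rewrite zw Rew; lra.
  have Ea : E a by split => //=; lra.
  have Eb : E b by split => //=; lra.
  have Eab : E ab by exact: mE.
  have Ebw : E bw by split => /=; [exact: mD | rewrite Ree Rew; lra].
  have Ewa : E wa by split => /=; [exact: mD | rewrite Ree Rew; lra].
  have e3 : 0 < (eta' - eta / 2%:R) / 6%:R by rewrite divr_gt0 // subr_gt0.
  have [N1 h1] := goursat mE cE Ea Eab Ewa fE e3.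
  have [N2 h2] := goursat mE cE Eab Eb Ebw fE e3.
  have [N3 h3] := goursat mE cE Eab Ebw Ewa fE e3.
  have [|||||N4 h4] := IH wa bw Ewa.1 Ebw.1 _ _ _ _ (eta / 2%:R + (eta' - eta / 2%:R) / 2%:R).
  - by rewrite Ree Rew; lra.
  - by rewrite Ree Rew; lra.
  - have -> : wa - w = (a - w) / 2%:R by rewrite /wa; field.
    by rewrite cabs_half ler_pdivrMr // -mulrA -exprSr.
  - have -> : bw - w = (b - w) / 2%:R by rewrite /bw; field.
    by rewrite cabs_half ler_pdivrMr // -mulrA -exprSr.
  - by lra.
  exists (maxn (maxn N1 N2) (maxn N3 N4)).+1 => -[//|N]; rewrite ltnS !geq_max.
  move=> /andP[/andP[/h1 k1 /h2 k2] /andP[/h3 k3 /h4 k4]].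
  rewrite tri_split -/ab -/bw -/wa (tri_rot N f bw) (tri_rot N f w).
  have := ler_cabsD (tri N f a ab wa) (tri N f ab b bw).
  have := ler_cabsD (tri N f a ab wa + tri N f ab b bw) (tri N f wa bw w).
  have := ler_cabsD (tri N f a ab wa + tri N f ab b bw + tri N f wa bw w) (tri N f ab bw wa).
  lra.
have [k hk] := exp2_gt ((abs (a - w) + abs (b - w)) / r').
have := cabs_ge0 (a - w); have := cabs_ge0 (b - w) => n1 n2.
move: hk; rewrite ltr_pdivrMr // mulrC => hk.
by apply: (key k) => //; lra.
Qed.

Lemma cdiff_divided (f : C -> C) (c w z0 : C) : z0 != w -> cdiff_at f z0 ->
  cdiff_at (fun z => (f z - c) / (z - w)) z0.
Proof.
move=> zw /cdiff_atP[l hl]; apply/cdiff_atP.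
have v0 : z0 - w != 0 by rewrite subr_eq0.
pose g0 := (f z0 - c) / (z0 - w); pose L := (l - g0) / (z0 - w).
exists L => e e0.
set v := abs (z0 - w); have vp : 0 < v by rewrite cabs_gt0.
have e1 : 0 < e * v / 4%:R by rewrite divr_gt0 // mulr_gt0.
have [d d0 hd] := hl _ e1.
have L1 : 0 < 4%:R * (1 + abs L) by rewrite mulr_gt0 // ltr_pwDl // cabs_ge0.
(* Each of the two error terms receives [e * v / 4 * abs h], and the radius [v / 2] keeps the
   denominator at least [v / 2]. *)
exists (Num.min d (Num.min (v / 2%:R) (e * v / (4%:R * (1 + abs L))))).
  by rewrite !lt_min d0 !divr_gt0 // mulr_gt0.
move=> h; rewrite !lt_min => /and3P[hd1 hv]; rewrite ltr_pdivlMr // => hL.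
have lo : v / 2%:R <= abs (z0 + h - w).
  have := ler_cabsB (z0 + h - w) h; have -> : z0 + h - w - h = z0 - w by ring.
  by rewrite -/v; lra.
have hn : z0 + h - w != 0 by rewrite -cabs_gt0; lra.
have -> : (f (z0 + h) - c) / (z0 + h - w) - (f z0 - c) / (z0 - w) - L * h =
    ((f (z0 + h) - f z0 - l * h) - L * h * h) / (z0 + h - w).
  rewrite /L /g0; field.
  by rewrite ?v0 ?hn.
rewrite cabsM cabsV ler_pdivrMr ?cabs_gt0 //.
apply: le_trans (ler_cabsB _ _) _.
have := hd _ hd1; have := cabs_ge0 L; have hp := cabs_ge0 h.
rewrite (cabsM (L * h)) (cabsM L) => L0 hh.
have q1 : e * abs h * (v / 2%:R) <= e * abs h * abs (z0 + h - w).
  by rewrite ler_wpM2l // mulr_ge0 // ltW.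
have q2 : abs L * abs h * abs h <= e * v / 4%:R * abs h.
  by apply: ler_wpM2r => //; move: hL hp L0; generalize (abs h) (abs L) => x y; nra.
apply: le_trans q1; move: hh q2.
set X := abs (f _ - _ - _); nra.
Qed.

Lemma cdiff_cont (f : C -> C) z0 : cdiff_at f z0 -> exists2 K : R, 0 < K &
  exists2 r : R, 0 < r & forall z, abs (z - z0) < r -> abs (f z - f z0) <= K * abs (z - z0).
Proof.
move=> /cdiff_atP[l hl]; exists (abs l + 1); first by rewrite ltr_wpDl // cabs_ge0.
have [r r0 hr] := hl 1 ltr01; exists r => // z /hr; rewrite addrCA subrr addr0 mul1r.
move=> h; have := ler_cabsD (f z - f z0 - l * (z - z0)) (l * (z - z0)).
by rewrite subrK cabsM mulrDl mul1r; lra.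
Qed.

Definition ii : C := Complex 0 1.
Lemma ii2 : ii * ii = -1.
Proof. by apply/eqP; rewrite eq_complex /= !(mul0r, mulr0, mulr1, mul1r, addr0, add0r, sub0r, oppr0) !eqxx. Qed.
Lemma cabs_ii : abs ii = 1.
Proof. by rewrite cabsE /= expr0n /= add0r expr1n sqrtr1. Qed.
Lemma ii4 : ii ^+ 4 = 1.
Proof. by rewrite -[4%N]/(2 * 2)%N exprM [ii ^+ 2]ii2 sqrrN expr1n. Qed.
Lemma cabs_iiX k : abs (ii ^+ k) = 1.
Proof. by rewrite cabsX cabs_ii expr1n. Qed.
Lemma iiX_neq0 k : ii ^+ k != 0.
Proof. by rewrite -cabs_gt0 cabs_iiX. Qed.

Variable s : R.
Hypothesis s0 : 0 < s.

(* The contour is the square with vertices [(+-1 +- i) s], traversed counterclockwise. *)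
Definition corner k : C := ii ^+ k * Complex s (- s).
Definition side k : set C := [set z | exists2 y : R, `|y| <= s & z = ii ^+ k * Complex s y].

Lemma corner4 : corner 4 = corner 0.
Proof. by rewrite /corner ii4. Qed.

Lemma midconvex_side k : midconvex (side k).
Proof.
move=> _ _ [y hy ->] [y' hy' ->]; exists ((y + y') / 2%:R).
  rewrite normrM normfV (ger0_norm (ler0n R 2)) ler_pdivrMr // (le_trans (ler_normD _ _)) //.
  by lra.
rewrite -mulrDr -mulrA; congr (_ * _); rewrite -[2%:R^-1]ofr_half /ofr.
by apply/eqP; rewrite eq_complex /=; apply/andP; split; apply/eqP; field.
Qed.

Lemma side_corner k : side k (corner k).
Proof. by exists (- s) => //; rewrite normrN ger0_norm // ltW. Qed.
Lemma cornerS k : corner k.+1 = ii ^+ k * Complex s s.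
Proof.
rewrite /corner exprSr -mulrA; congr (_ * _).
by apply/eqP; rewrite eq_complex /=; apply/andP; split; apply/eqP; ring.
Qed.
Lemma side_cornerS k : side k (corner k.+1).
Proof. by rewrite cornerS; exists s => //; rewrite ger0_norm // ltW. Qed.
Lemma corner_diff k : corner k.+1 - corner k = ii ^+ k * Complex 0 (2%:R * s).
Proof.
rewrite cornerS /corner -mulrBr; congr (_ * _).
by apply/eqP; rewrite eq_complex /=; apply/andP; split; apply/eqP; ring.
Qed.
Lemma cabs_corner_diff k : abs (corner k.+1 - corner k) = 2%:R * s.
Proof.
rewrite corner_diff cabsM cabs_iiX mul1r cabsE /= expr0n /= add0r sqrtr_sqr ger0_norm //.
by rewrite mulr_ge0 // ltW.
Qed.
Lemma side_annulus k z : side k z -> s <= abs z <= 2%:R * s.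
Proof.
move=> [y hy ->]; rewrite cabsM cabs_iiX mul1r; apply/andP; split.
  by have := cabs_Re (Complex s y); rewrite /= ger0_norm // ltW.
have := cabs_ReIm (Complex s y); rewrite /= (ger0_norm (ltW s0)); lra.
Qed.

Definition sq N (g : C -> C) : C := \sum_(k < 4) trap N g (corner k) (corner k.+1).

(** It contains the four sides, [2 * s] being a convenient majorant of the half diagonal
    [sqrt 2 * s]. *)
Definition annulus : set C := [set z | s <= abs z <= 2%:R * s].

Lemma sq_bound N g B : (forall z, annulus z -> abs (g z) <= B) -> abs (sq N g) <= 8%:R * s * B.
Proof.
move=> gB; apply: (le_trans (ler_cabs_sum _ _ _)).
apply: (@le_trans _ _ (\sum_(k < 4) B * (2%:R * s))).
  apply: ler_sum => k _; rewrite -(cabs_corner_diff k).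
  apply: (trap_bound _ (midconvex_side (k := k)) (side_corner _) (side_cornerS _)) => z /side_annulus.
  exact: gB.
by rewrite sumr_const card_ord -mulr_natl; lra.
Qed.

Lemma sq_ext N g h : (forall z, annulus z -> g z = h z) -> sq N g = sq N h.
Proof.
move=> gh; apply: eq_bigr => k _.
apply: (trap_ext _ (midconvex_side (k := k)) (side_corner _) (side_cornerS _)) => z /side_annulus.
exact: gh.
Qed.

Lemma sq_lin N (u : C) g h : sq N (fun z => u * g z + h z) = u * sq N g + sq N h.
Proof.
rewrite /sq mulr_sumr -big_split; apply: eq_bigr => k _; exact: trap_lin.
Qed.

Lemma sqZ N (u : C) g : sq N (fun z => u * g z) = u * sq N g.
Proof.
have := sq_lin N u g (fun=> 0); rewrite (_ : sq N (fun=> 0) = 0) ?addr0.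
  by move=> <-; congr (sq N _); apply/funext => z; rewrite addr0.
apply/eqP; rewrite -cabs_eq0 eq_le cabs_ge0 andbT.
have := @sq_bound N (fun=> 0) 0; rewrite mulr0; apply => z _; by rewrite cabs0.
Qed.

Lemma sqD N g h : sq N (fun z => g z + h z) = sq N g + sq N h.
Proof.
by rewrite -[sq N g]mul1r -sq_lin; congr (sq N _); apply/funext => z; rewrite mul1r.
Qed.

Lemma sq_sum N m (g : nat -> C -> C) :
  sq N (fun z => \sum_(k < m) g k z) = \sum_(k < m) sq N (g k).
Proof.
elim: m => [|m IH].
  rewrite big_ord0 -[RHS](mul0r (sq N (fun=> 0))) -sqZ; congr (sq N _).
  by apply/funext => z; rewrite big_ord0 mul0r.
rewrite big_ord_recr /= -IH -sqD; congr (sq N _).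
by apply/funext => z; rewrite big_ord_recr.
Qed.

(* Each side contributes imaginary part at least 1. *)
Lemma sq_inv_ge N : 4%:R <= abs (sq N (fun z => z^-1)).
Proof.
apply: le_trans (cabs_Im _); apply: le_trans (ler_norm _).
rewrite raddf_sum /=.
have -> : (4%:R : R) = \sum_(k < 4) 1 by rewrite sumr_const card_ord.
apply: ler_sum => k _.
apply: (trap_Im _ (midconvex_side (k := k)) (side_corner _) (side_cornerS _)) => _ [y hy ->].
rewrite corner_diff invfM mulrACA mulVf ?iiX_neq0 // mul1r /=.
have y2 : y ^+ 2 <= s ^+ 2.
  by rewrite -(real_normK (num_real y)) ler_pXn2r // nnegrE // ltW.
have d0 : 0 < s ^+ 2 + y ^+ 2 by rewrite ltr_pwDl // ?exprn_gt0 // sqr_ge0.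
rewrite mulr0 addr0 mulrAC mulrCA ler_pdivlMr //; nra.
Qed.

Lemma sub_annulus w z : abs w <= s / 2%:R -> annulus z -> s / 2%:R <= abs (z - w).
Proof. by move=> hw /= /andP[hz _]; have := ler_cabsD (z - w) w; rewrite subrK; lra. Qed.

End CauchyFormula.

(** * Cauchy's formula and Taylor expansion on a disc *)

Section Taylor.
Variable R : realType.
Local Notation C := (R[i]).
Local Notation abs := (@cabs R).

(** The subtracted term is the increment of the primitive [- 1 / (z - w)]. The error of a single
    trapezoid is exactly [(b - a) ^ 3 / (2 (a - w) ^ 2 (b - w) ^ 2)]; being cubic in the length, its
    bound drops by a factor 8 on each half, hence by 4 in total per bisection. *)
Lemma trap_inv_sqr (D : set C) (w : C) (d : R) N a b :
  midconvex D -> D a -> D b -> 0 < d -> (forall z, D z -> d <= abs (z - w)) ->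
  abs (trap N (fun z => ((z - w) ^+ 2)^-1) a b - ((a - w)^-1 - (b - w)^-1)) <=
  abs (b - a) ^+ 3 / (2%:R * d ^+ 4) / 4%:R ^+ N.
Proof.
move=> mD + + d0 hD; elim: N a b => [|N IH] a b Da Db.
  have n z : D z -> z - w != 0.
    by move=> /hD; rewrite -cabs_gt0; exact: lt_le_trans.
  have na := n _ Da; have nb := n _ Db.
  have -> : trap 0 (fun z => ((z - w) ^+ 2)^-1) a b - ((a - w)^-1 - (b - w)^-1) =
      (b - a) ^+ 3 / (2%:R * (a - w) ^+ 2 * (b - w) ^+ 2).
    by rewrite trap0; field; rewrite na nb.
  rewrite expr0 divr1 cabsM cabsV cabsX ler_wpM2l // ?exprn_ge0 ?cabs_ge0 //.
  have p : 0 < 2%:R * d ^+ 4 by rewrite mulr_gt0 // exprn_gt0.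
  have le1 : 2%:R * d ^+ 4 <= 2%:R * abs (a - w) ^+ 2 * abs (b - w) ^+ 2.
    rewrite -mulrA ler_pM2l // -[4%N]/(2 + 2)%N exprD.
    by rewrite ler_pM ?exprn_ge0 ?(ltW d0) // ler_pXn2r ?nnegrE ?cabs_ge0 ?(ltW d0) ?hD.
  by rewrite (cabsM _ ((b - w) ^+ 2)) (cabsM _ ((a - w) ^+ 2)) !cabsX cabs_nat lef_pV2 // posrE // (lt_le_trans p).
have Dm := mD _ _ Da Db; set m := (a + b) / 2%:R.
have := IH _ _ Da Dm; have := IH _ _ Dm Db.
rewrite half_segl half_segr cabs_half trapS -/m => h1 h2.
have -> : trap N (fun z => ((z - w) ^+ 2)^-1) a m + trap N (fun z => ((z - w) ^+ 2)^-1) m b -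
    ((a - w)^-1 - (b - w)^-1) =
  (trap N (fun z => ((z - w) ^+ 2)^-1) a m - ((a - w)^-1 - (m - w)^-1)) +
  (trap N (fun z => ((z - w) ^+ 2)^-1) m b - ((m - w)^-1 - (b - w)^-1)) by ring.
apply: le_trans (ler_cabsD _ _) _; apply: le_trans (lerD h2 h1) _.
rewrite (exprS _ N) le_eqVlt; apply/orP; left; apply/eqP.
by field; rewrite ?expf_neq0 ?pnatr_eq0 ?gt_eqF.
Qed.

Variable s : R.
Hypothesis s0 : 0 < s.
Let half_disc (w : C) := abs w <= s / 2%:R.

(** The increments of the primitive telescope around the closed contour. A side has length [2 * s]
    and stays at distance at least [s / 2] from [w], which gives an error of [64 / s] per side. *)
Lemma sq_inv_sqr N w : half_disc w ->
  abs (sq s N (fun z => ((z - w) ^+ 2)^-1)) <= 256%:R / s / 4%:R ^+ N.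
Proof.
move=> hw.
have -> : sq s N (fun z => ((z - w) ^+ 2)^-1) =
  \sum_(k < 4) (trap N (fun z => ((z - w) ^+ 2)^-1) (corner s k) (corner s k.+1) -
    ((corner s k - w)^-1 - (corner s k.+1 - w)^-1)).
  by rewrite /sq !big_ord_recr !big_ord0 /= (corner4 s); ring.
apply: (le_trans (ler_cabs_sum _ _ _)).
apply: (@le_trans _ _ (\sum_(k < 4) (64%:R / s / 4%:R ^+ N))); last first.
  rewrite sumr_const card_ord -mulr_natl; lra.
apply: ler_sum => k _.
have s20 : 0 < s / 2%:R by rewrite divr_gt0.
apply: (le_trans (trap_inv_sqr N (midconvex_side (s := s) (k := k)) (side_corner s0 _)
  (side_cornerS s0 _) s20 _)).
  by move=> z /(side_annulus s0) hz; apply: sub_annulus.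
rewrite ler_wpM2r ?invr_ge0 ?exprn_ge0 // cabs_corner_diff // le_eqVlt; apply/orP; left.
by apply/eqP; field; rewrite gt_eqF.
Qed.

Lemma sub_neq0 w z : half_disc w -> annulus s z -> z - w != 0.
Proof.
by move=> hw hz; rewrite -cabs_gt0 (lt_le_trans _ (sub_annulus hw hz)) // divr_gt0.
Qed.

(** The integrands differ by [(w - w') / ((z - w) (z - w'))]. Replacing [w'] by [w] in the
    denominator leaves the sum of [sq_inv_sqr] plus an error proportional to [abs (w - w')]. *)
Lemma sq_inv_diff N w w' : half_disc w -> half_disc w' ->
  abs (sq s N (fun z => (z - w)^-1) - sq s N (fun z => (z - w')^-1)) <=
  abs (w - w') * (256%:R / s / 4%:R ^+ N + 64%:R / s ^+ 2 * abs (w - w')).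
Proof.
move=> hw hw'.
have -> : sq s N (fun z => (z - w)^-1) - sq s N (fun z => (z - w')^-1) =
   (w - w') * sq s N (fun z => ((z - w) * (z - w'))^-1).
  rewrite -sqZ // -[X in _ - X]mul1r -mulNr addrC -sq_lin; apply: sq_ext => // z hz.
  by field; rewrite !sub_neq0.
rewrite cabsM ler_wpM2l ?cabs_ge0 //.
have -> : sq s N (fun z => ((z - w) * (z - w'))^-1) = sq s N (fun z => ((z - w) ^+ 2)^-1) +
    sq s N (fun z => (w' - w) / ((z - w) ^+ 2 * (z - w'))).
  rewrite -sqD //; apply: sq_ext => // z hz.
  by field; rewrite !sub_neq0.
apply: (le_trans (ler_cabsD _ _)); apply: lerD; first exact: sq_inv_sqr.
have -> : 64%:R / s ^+ 2 * abs (w - w') = 8%:R * s * (abs (w - w') * (8%:R / s ^+ 3)).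
  by field; rewrite gt_eqF.
apply: sq_bound => // z hz; rewrite cabsM cabsV cabsM cabsX cabsB.
rewrite ler_wpM2l ?cabs_ge0 //.
have -> : 8%:R / s ^+ 3 = ((s / 2%:R) ^+ 2 * (s / 2%:R))^-1 by field; rewrite gt_eqF.
have h1 := sub_annulus hw hz; have h2 := sub_annulus hw' hz.
have p : 0 < s / 2%:R by rewrite divr_gt0.
have q : (s / 2%:R) ^+ 2 * (s / 2%:R) <= abs (z - w) ^+ 2 * abs (z - w').
  by rewrite ler_pM ?exprn_ge0 ?(ltW p) // ler_pXn2r ?nnegrE ?cabs_ge0 ?(ltW p).
have pp : 0 < (s / 2%:R) ^+ 2 * (s / 2%:R) by rewrite mulr_gt0 // exprn_gt0.
by rewrite lef_pV2 // posrE (lt_le_trans pp).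
Qed.

(* The error term of [sq_inv_diff] that is quadratic in [w - w'] halves each time the
   segment from [w] to [w'] is bisected. *)
Lemma sq_inv_const w : half_disc w ->
  null (fun N => sq s N (fun z => (z - w)^-1) - sq s N (fun z => z^-1)).
Proof.
move=> hw.
have h0 : half_disc 0 by rewrite /half_disc cabs0 divr_ge0 // ltW.
have p4 (N : nat) : (0 : R) < 4%:R ^+ N by rewrite exprn_gt0.
have key k : forall N w w', half_disc w -> half_disc w' ->
  abs (sq s N (fun z => (z - w)^-1) - sq s N (fun z => (z - w')^-1)) <=
  abs (w - w') * (256%:R / s / 4%:R ^+ N + 64%:R / s ^+ 2 * abs (w - w') / 2%:R ^+ k).
  elim: k {w hw} => [|k IH] N w w' hw hw'; first by rewrite expr0 divr1; exact: sq_inv_diff.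
  have hm : half_disc ((w + w') / 2%:R).
    have := @midconvex_ball _ 0 (s / 2%:R) w w'; rewrite /= !subr0; exact.
  have := IH N _ _ hw hm; have := IH N _ _ hm hw'; rewrite (exprS _ k).
  have -> : (w + w') / 2%:R - w' = (w - w') / 2%:R by field.
  have -> : w - (w + w') / 2%:R = (w - w') / 2%:R by field.
  rewrite cabs_half.
  set a := sq s N _; set b := sq s N _; set c := sq s N _ => h1 h2.
  have -> : c - b = (c - a) + (a - b) by ring.
  apply: (le_trans (ler_cabsD _ _)); apply: (le_trans (lerD h2 h1)).
  rewrite le_eqVlt; apply/orP; left; apply/eqP.
  by field; rewrite ?expf_neq0 ?pnatr_eq0 ?gt_eqF.
(* At fixed [N] the number [k] of bisections is free, so the quadratic term disappears; 128 is
   [s / 2] times [256 / s]. *)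
have bound N : abs (sq s N (fun z => (z - w)^-1) - sq s N (fun z => z^-1)) <= 128%:R / 4%:R ^+ N.
  have -> : (fun z : C => z^-1) = (fun z => (z - 0)^-1) by apply/funext => z; rewrite subr0.
  apply/ler_addgt0Pr => e e0.
  have [k hk] := div_exp2_small (abs w * (64%:R / s ^+ 2 * abs w)) e0.
  have := key k N w 0 hw h0; rewrite [X in abs X * _]subr0.
  have -> : abs (w - 0) = abs w by rewrite subr0.
  rewrite mulrDr => h; apply: le_trans h _; apply: lerD; last first.
    by rewrite mulrA ltW.
  rewrite !mulrA ler_wpM2r ?invr_ge0 ?(ltW (p4 _)) // ler_pdivrMr // mulrC.
  by move: hw; rewrite /half_disc; lra.
move=> e e0; have [k hk] := div_exp2_small 128%:R e0.
exists k => N hN; apply: le_trans (bound N) _; apply: (le_trans _ (ltW hk)).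
rewrite ler_wpM2l // lef_pV2 ?posrE ?exprn_gt0 //.
apply: (@le_trans _ _ (2%:R ^+ N)); first by rewrite ler_weXn2l // ler1n.
by rewrite lerXn2r ?nnegrE // ler_nat.
Qed.

Section Fun.
Variables (f : C -> C) (B : R).
Hypothesis fD : forall z, abs z <= 2%:R * s -> cdiff_at f z.
Hypothesis fB : forall z, abs z <= 2%:R * s -> abs (f z) <= B.

Lemma half_disc_disc w : half_disc w -> abs w <= 2%:R * s.
Proof. by rewrite /half_disc; move: s0; lra. Qed.

(** The square is cut into four triangles with common vertex [w]. The difference quotient of [f] at
    [w] is differentiable off [w] and bounded near it, so [puncture] applies to each; [sq_inv_const]
    then replaces [1 / (z - w)] by [1 / z]. *)
Lemma cauchy_formula w : half_disc w ->
  null (fun N => f w * sq s N (fun z => z^-1) - sq s N (fun z => f z / (z - w))).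
Proof.
move=> hw; pose g z := (f z - f w) / (z - w).
(* [g] takes the junk value 0 at [w]; only its boundedness near [w] matters. *)
have g0 : null (fun N => sq s N g).
  apply: (@null_ext _ (fun N => \sum_(k < 4) tri N g (corner s k) (corner s k.+1) w)).
    move=> N; rewrite /sq !big_ord_recr !big_ord0 /= /tri (corner4 s).
    rewrite (trap_sym _ _ w (corner s 0)) (trap_sym _ _ w (corner s 1)).
    by rewrite (trap_sym _ _ w (corner s 2)) (trap_sym _ _ w (corner s 3)); ring.
  apply: (@null_sum _ _ _ (fun k : 'I_4 => fun N => tri N g (corner s k) (corner s k.+1) w)) => k.
  have [K K0 [r r0 hr]] := cdiff_cont (fD (half_disc_disc hw)).
  (* Rotated back by [ii ^ k'], the side lies on the vertical line of abscissa [s], whereas [w] has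
     abscissa at most [s / 2]. *)
  have in_half k' (z : C) : complex.Re ((ii R ^+ k')^-1 * z) = s ->
      0 < complex.Re ((ii R ^+ k')^-1 * (z - w)).
    move=> hz; rewrite mulrBr raddfB /= hz.
    have := le_trans (ler_norm _) (cabs_Re ((ii R ^+ k')^-1 * w)).
    by rewrite cabsM cabsV cabs_iiX invr1 mul1r; move: hw s0; rewrite /half_disc; lra.
  apply: (@puncture _ g [set z | abs (z - 0) <= 2%:R * s] w ((ii R) ^+ k)^-1 K (r / 2%:R)).
  - exact: midconvex_ball.
  - exact: limclosed_ball.
  - by rewrite /= subr0 half_disc_disc.
  - by rewrite divr_gt0.
  - by move=> z /=; rewrite subr0 => hz zw; apply: cdiff_divided => //; exact: fD.
  - move=> z _ hz; rewrite /g cabsM cabsV.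
    have [->|zw] := eqVneq z w; first by rewrite subrr cabs0 mul0r ltW.
    by rewrite ler_pdivrMr ?cabs_gt0 ?subr_eq0 //; apply: hr; lra.
  - by rewrite /= subr0; case/andP: (side_annulus s0 (side_corner s0 k)).
  - by rewrite /= subr0; case/andP: (side_annulus s0 (side_cornerS s0 k)).
  - by apply: in_half; rewrite /corner mulKf ?iiX_neq0.
  - by apply: in_half; rewrite cornerS mulKf ?iiX_neq0.
have h := nullD (nullM (-1) g0) (nullM (- f w) (sq_inv_const hw)).
apply: null_ext h => N.
have -> : sq s N g = - f w * sq s N (fun z => (z - w)^-1) + sq s N (fun z => f z / (z - w)).
  rewrite -sq_lin; congr (sq s N _); apply/funext => z; rewrite /g mulrBl; ring.
ring.
Qed.

Let A N := sq s N (fun z : C => z^-1).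
Let A_neq0 N : A N != 0.
Proof. by rewrite -cabs_gt0 (lt_le_trans _ (sq_inv_ge s0 N)). Qed.
(** Cauchy's formula for the [k]-th Taylor coefficient at level [N], with [A N] in the role of
    [2 pi i]. *)
Let c k N := sq s N (fun z => f z / z ^+ k.+1) / A N.

Lemma B_ge0 : 0 <= B.
Proof. by apply: le_trans (cabs_ge0 (f 0)) (fB _); rewrite cabs0 mulr_ge0 // ltW. Qed.

(** The finite geometric expansion of [1 / (z - w)], with its exact remainder, is summed against [f]
    at a fixed level. The factor 4 is the perimeter [8 * s], times [2 / s] for the bound on
    [1 / (z - w)], divided by the lower bound 4 of [abs (A N)]. *)
Lemma approx_taylor m w : half_disc w -> forall e, 0 < e -> exists N0 : nat, forall N, (N0 <= N)%N ->
  abs (f w - \sum_(k < m) c k N * w ^+ k) <= 4%:R * B * (abs w / s) ^+ m + e.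
Proof.
move=> hw e e0; have [N0 h] := cauchy_formula hw e0; exists N0 => N /h{}h.
have exact_eq : f w - \sum_(k < m) c k N * w ^+ k =
   (f w * A N - sq s N (fun z => f z / (z - w))) / A N +
   w ^+ m * sq s N (fun z => f z / (z ^+ m * (z - w))) / A N.
  have -> : sq s N (fun z => f z / (z - w)) = A N * (\sum_(k < m) c k N * w ^+ k) +
      w ^+ m * sq s N (fun z => f z / (z ^+ m * (z - w))).
    rewrite mulr_sumr (eq_bigr (fun k : 'I_m => sq s N (fun z => w ^+ k * (f z / z ^+ k.+1)))).
      rewrite -(sq_sum s0 N m (fun k z => w ^+ k * (f z / z ^+ k.+1))) -sqZ // -sqD //.
      apply: sq_ext => // z hz; have zw := sub_neq0 hw hz.
      have z0 : z != 0.
        by rewrite -cabs_gt0; case/andP: hz => + _; exact: lt_le_trans.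
      elim: m => [|m IH]; first by rewrite big_ord0 !expr0 mul1r mul1r add0r.
      rewrite IH big_ord_recr /= -addrA; congr (_ + _).
      by rewrite !exprS; field; rewrite zw z0 expf_neq0.
    by move=> k _; rewrite sqZ // /c; field.
  by field.
rewrite exact_eq addrC; apply: le_trans (ler_cabsD _ _) _; apply: lerD; last first.
  rewrite cabsM cabsV ler_pdivrMr ?cabs_gt0 //; apply: le_trans h _.
  by rewrite ler_peMr ?ltW // ?(lt_le_trans _ (sq_inv_ge s0 N)) ?ltr1n.
rewrite !cabsM cabsV cabsX.
have sb : abs (sq s N (fun z => f z / (z ^+ m * (z - w)))) <= 8%:R * s * (B * (2%:R / s ^+ m.+1)).
  apply: sq_bound => // z hz; rewrite cabsM cabsV cabsM cabsX.
  have [h1 h2] := andP hz.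
  rewrite ler_pM ?cabs_ge0 ?invr_ge0 ?mulr_ge0 ?exprn_ge0 ?cabs_ge0 ?fB //.
  have -> : 2%:R / s ^+ m.+1 = (s ^+ m * (s / 2%:R))^-1.
    by rewrite exprS; field; rewrite ?expf_neq0 ?gt_eqF.
  have q : s ^+ m * (s / 2%:R) <= abs z ^+ m * abs (z - w).
    rewrite ler_pM ?exprn_ge0 ?divr_ge0 ?(ltW s0) ?sub_annulus //.
    by rewrite lerXn2r ?nnegrE ?cabs_ge0 ?(ltW s0).
  have pp : 0 < s ^+ m * (s / 2%:R) by rewrite mulr_gt0 ?exprn_gt0 ?divr_gt0.
  by rewrite lef_pV2 // posrE (lt_le_trans pp).
rewrite ler_pdivrMr ?cabs_gt0 //.
apply: (@le_trans _ _ (4%:R * B * (abs w / s) ^+ m * 4%:R)); last first.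
  by rewrite ler_wpM2l ?sq_inv_ge // !mulr_ge0 ?B_ge0 // exprn_ge0 // divr_ge0 ?cabs_ge0 // ltW.
have -> : 4%:R * B * (abs w / s) ^+ m * 4%:R = abs w ^+ m * (8%:R * s * (B * (2%:R / s ^+ m.+1))).
  by rewrite expr_div_n exprS; field; rewrite ?expf_neq0 ?gt_eqF.
by rewrite ler_wpM2l // exprn_ge0 // cabs_ge0.
Qed.

(* Once the lower coefficients converge, [approx_taylor] at a small fixed [w] controls the
   oscillation of [c k N * w ^+ k] up to [O(w ^+ k.+1)]. *)
Lemma taylor_coef_cauchy k : ccauchy (c k).
Proof.
elim/ltn_ind: k => k IH e e0.
have B0 := B_ge0.
pose K := 4%:R * B / s ^+ k.+1.
have K0 : 0 <= K by rewrite divr_ge0 ?mulr_ge0 ?exprn_ge0 // ltW.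
(* Small enough for the remainder [K * x ^ (k + 1)] to be at most a quarter of [e * x ^ k]. *)
pose x := Num.min (s / 2%:R) (e / (4%:R * (K + 1))).
have K1 : 0 < 4%:R * (K + 1) by rewrite mulr_gt0 // ltr_wpDl.
have x0 : 0 < x by rewrite lt_min !divr_gt0.
have xs : x <= s / 2%:R by rewrite ge_min lexx.
have xK : x * (4%:R * (K + 1)) <= e by rewrite -ler_pdivlMr // ge_min lexx orbT.
have hw : half_disc (ofr x) by rewrite /half_disc cabs_ofr ger0_norm // ltW.
have xk0 : 0 < x ^+ k by rewrite exprn_gt0.
have eta0 : 0 < e * x ^+ k / 8%:R by rewrite divr_gt0 // mulr_gt0.
have [N1 h1] := approx_taylor k.+1 hw eta0.
have [N2 h2] : exists N0 : nat, forall N M, (N0 <= N)%N -> (N0 <= M)%N ->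
    abs (\sum_(j < k) c j N * ofr x ^+ j - \sum_(j < k) c j M * ofr x ^+ j) <= e * x ^+ k / 8%:R.
  have : forall m, (m <= k)%N -> ccauchy (fun N => \sum_(j < m) c j N * ofr x ^+ j).
    elim=> [|m IHm] hm r r0.
      by exists 0%N => N M _ _; rewrite !big_ord0 subrr cabs0 ltW.
    have [Na ha] := IHm (ltnW hm) _ (divr_gt0 r0 (ltr0Sn R 1)).
    have xm0 : 0 < x ^+ m by rewrite exprn_gt0.
    have [Nb hb] := IH m hm _ (divr_gt0 (divr_gt0 r0 (ltr0Sn R 1)) xm0).
    exists (maxn Na Nb) => N M; rewrite !geq_max => /andP[na nb] /andP[ma mb].
    rewrite !big_ord_recr /=.
    set S1 := \sum_(_ < _) _; set S2 := \sum_(_ < _) _.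
    have -> : S1 + c m N * ofr x ^+ m - (S2 + c m M * ofr x ^+ m) =
      (S1 - S2) + (c m N - c m M) * ofr x ^+ m by ring.
    apply: (le_trans (ler_cabsD _ _)); rewrite (splitr r); apply: lerD; first exact: ha.
    rewrite cabsM cabsX cabs_ofr (ger0_norm (ltW x0)) -ler_pdivlMr //; exact: hb.
  by move/(_ k (leqnn k)); apply.
exists (maxn N1 N2) => N M; rewrite !geq_max => /andP[n1 n2] /andP[m1 m2].
have := h1 _ n1; have := h1 _ m1; have := h2 _ _ n2 m2.
rewrite !big_ord_recr /=.
set S1 := \sum_(_ < _) _; set S2 := \sum_(_ < _) _; set cN := c k N; set cM := c k M.
have -> : 4%:R * B * (abs (ofr x) / s) ^+ k.+1 = K * x * x ^+ k.
  rewrite cabs_ofr (ger0_norm (ltW x0)) /K expr_div_n !exprS; field.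
  by rewrite ?expf_neq0 ?gt_eqF.
move=> d1 d2 d3.
rewrite -(ler_pM2r xk0) -{1}[x](ger0_norm (ltW x0)) -cabs_ofr -cabsX -cabsM.
have -> : (cN - cM) * ofr x ^+ k = - ((f (ofr x) - (S1 + cN * ofr x ^+ k)) -
   (f (ofr x) - (S2 + cM * ofr x ^+ k)) + (S1 - S2)) by ring.
rewrite cabsN; apply: (le_trans (ler_cabsD _ _)).
have := ler_cabsB (f (ofr x) - (S1 + cN * ofr x ^+ k)) (f (ofr x) - (S2 + cM * ofr x ^+ k)).
have : K * x * x ^+ k <= e / 4%:R * x ^+ k by rewrite ler_wpM2r ?(ltW xk0) //; lra.
move: d1 d2 d3; lra.
Qed.

Lemma taylor : exists a : nat -> C, forall m w, abs w <= s / 2%:R ->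
  abs (f w - \sum_(k < m) a k * w ^+ k) <= 4%:R * B * (abs w / s) ^+ m.
Proof.
have [a ha] : {a : nat -> C & forall k, null (fun N => c k N - a k)}.
  apply: (@choice _ _ (fun k l => null (fun N => c k N - l))) => k.
  exact: complex_complete (taylor_coef_cauchy k).
exists a => m w hw; apply/ler_addgt0Pr => e e0.
have e2 := divr_gt0 e0 (ltr0Sn R 1).
have [N1 h1] := approx_taylor m hw e2.
have hsum : null (fun N => \sum_(k < m) w ^+ k * (c k N - a k)).
  apply: (@null_sum _ _ _ (fun (k : 'I_m) N => w ^+ k * (c k N - a k))) => k.
  exact: nullM.
have [N2 h2] := hsum _ e2.
have := h1 _ (leq_maxl N1 N2); have := h2 _ (leq_maxr N1 N2).
set N := maxn N1 N2 => k2 k1.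
have -> : f w - \sum_(k < m) a k * w ^+ k = (f w - \sum_(k < m) c k N * w ^+ k) +
   \sum_(k < m) w ^+ k * (c k N - a k).
  rewrite -addrA; congr (_ + _); rewrite -!sumrN -big_split; apply: eq_bigr => k _ /=; ring.
apply: (le_trans (ler_cabsD _ _)); move: k1 k2; lra.
Qed.

End Fun.
End Taylor.

(** * Leading terms of holomorphic functions of one variable *)

Section OneVariable.
Variable R : realType.
Local Notation C := (R[i]).
Local Notation abs := (@cabs R).

Lemma cdiff_lin (f g : C -> C) (u z0 : C) : cdiff_at f z0 -> cdiff_at g z0 ->
  cdiff_at (fun z => u * f z + g z) z0.
Proof.
move=> /cdiff_atP[l hl] /cdiff_atP[m hm]; apply/cdiff_atP; exists (u * l + m) => e e0.
have c0 : 0 < 2%:R * (1 + abs u) by rewrite mulr_gt0 // ltr_pwDl // cabs_ge0.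
have [d1 d10 h1] := hl _ (divr_gt0 e0 c0).
have [d2 d20 h2] := hm _ (divr_gt0 e0 (ltr0Sn R 1)).
exists (Num.min d1 d2) => [|h]; first by rewrite lt_min d10.
rewrite lt_min => /andP[/h1 k1 /h2 k2].
have -> : u * f (z0 + h) + g (z0 + h) - (u * f z0 + g z0) - (u * l + m) * h =
   u * (f (z0 + h) - f z0 - l * h) + (g (z0 + h) - g z0 - m * h) by ring.
apply: (le_trans (ler_cabsD _ _)); rewrite (splitr e) mulrDl; apply: lerD => //.
rewrite cabsM; apply: (le_trans (ler_wpM2l (cabs_ge0 u) k1)).
rewrite mulrA ler_wpM2r ?cabs_ge0 // mulrA ler_pdivrMr //.
have := cabs_ge0 u; nra.
Qed.

Lemma cdiff_cst (c z0 : C) : cdiff_at (fun=> c) z0.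
Proof.
apply/cdiff_atP; exists 0 => e e0; exists 1 => // h _.
by rewrite subrr mul0r subrr cabs0 mulr_ge0 ?cabs_ge0 // ltW.
Qed.

Lemma cdiffB (f g : C -> C) (z0 : C) : cdiff_at f z0 -> cdiff_at g z0 ->
  cdiff_at (fun z => f z - g z) z0.
Proof.
move=> hf hg; rewrite (_ : (fun z => _) = (fun z => -1 * g z + f z)); first exact: cdiff_lin.
by apply/funext => z; rewrite mulN1r addrC.
Qed.

Lemma cdiff_translate (f : C -> C) (a t : C) : cdiff_at f (a + t) ->
  cdiff_at (fun s => f (a + s)) t.
Proof.
move=> [l hl]; exists l => e e0; have [d d0 hd] := hl e e0; exists d => // h hh.
by rewrite addrA; exact: hd.
Qed.

Lemma cdiff_sum I (r : seq I) (F : I -> C -> C) (u : I -> C) (z0 : C) :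
  (forall i, cdiff_at (F i) z0) -> cdiff_at (fun z => \sum_(i <- r) u i * F i z) z0.
Proof.
move=> h; elim: r => [|i r IH].
  rewrite (_ : (fun z => _) = fun=> 0); first exact: cdiff_cst.
  by apply/funext => z; rewrite big_nil.
rewrite (_ : (fun z => _) = fun z => u i * F i z + \sum_(i <- r) u i * F i z).
  exact: cdiff_lin.
by apply/funext => z; rewrite big_cons.
Qed.

Section Disc.
Variables (f : C -> C) (s B : R).
Hypothesis s0 : 0 < s.
Hypothesis fD : forall z, abs z <= 2%:R * s -> cdiff_at f z.
Hypothesis fB : forall z, abs z <= 2%:R * s -> abs (f z) <= B.

(** Orders 1 and 2 of the Taylor estimate. The constants involve only the radius and the bound on
    [f], which makes them uniform over the slices of a function of several variables. *)
Lemma taylor2 : exists l : C, (forall w, abs w <= s / 2%:R -> abs (f w - f 0) <= 4%:R * B / s * abs w) /\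
  forall w, abs w <= s / 2%:R -> abs (f w - f 0 - l * w) <= 4%:R * B / s ^+ 2 * abs w ^+ 2.
Proof.
have [a ha] := taylor s0 fD fB.
have a0 : a 0%N = f 0.
  have := ha 1%N 0; rewrite cabs0 divr_ge0 ?(ltW s0) // => /(_ isT).
  rewrite big_ord_recr big_ord0 /= expr0 mulr1 add0r mul0r expr1 mulr0 => h.
  by apply/esym/eqP; rewrite -subr_eq0 -cabs_eq0 eq_le h cabs_ge0.
exists (a 1%N); split=> w hw.
  have := ha 1%N w hw; rewrite big_ord_recr big_ord0 /= expr0 mulr1 add0r a0 expr1.
  by rewrite mulrA mulrAC.
have := ha 2%N w hw; rewrite !big_ord_recr big_ord0 /= expr0 mulr1 add0r a0 expr1.
by rewrite opprD addrA expr_div_n mulrA mulrAC.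
Qed.
End Disc.

Lemma leading_term (f : C -> C) (e : R) : 0 < e -> (forall t, abs t < e -> cdiff_at f t) ->
  (exists2 d : R, 0 < d & forall t, abs t < d -> f t = 0) \/
  exists (a : nat) (c : C) (K d : R), [/\ c != 0, 0 <= K, 0 < d &
    forall t, abs t < d -> abs (f t - c * t ^+ a) <= K * abs t ^+ a.+1].
Proof.
move=> e0 hf.
have [K K0 [r r0 hr]] : exists2 K : R, 0 < K &
    exists2 r : R, 0 < r & forall z, abs (z - 0) < r -> abs (f z - f 0) <= K * abs (z - 0).
  by apply: cdiff_cont; apply: hf; rewrite cabs0.
pose s := Num.min e r / 4%:R.
have s0 : 0 < s by rewrite divr_gt0 // lt_min e0.
have [se sr] : 2%:R * s < e /\ 2%:R * s < r.
  have : 4%:R * s <= e /\ 4%:R * s <= r by rewrite mulrC divfK // !ge_min !lexx orbT.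
  by move: s0 => ? [? ?]; split; lra.
pose B := abs (f 0) + K * r.
have fD z : abs z <= 2%:R * s -> cdiff_at f z by move=> h; apply: hf; lra.
have fB z : abs z <= 2%:R * s -> abs (f z) <= B.
  move=> h; have := hr z; rewrite !subr0 => /(_ (le_lt_trans h sr)) k.
  have := lerB_cabs (f z) (f 0); rewrite /B.
  have : K * abs z <= K * r by rewrite ler_wpM2l ?(ltW K0) //; lra.
  by move: k; lra.
have B0 : 0 <= B by apply: le_trans (fB 0 _); rewrite ?cabs_ge0 // cabs0 mulr_ge0 // ltW.
have [a ha] := taylor s0 fD fB.
have s2 : 0 < s / 2%:R by rewrite divr_gt0.
have [h|] := pselect (exists k, a k != 0).
  right; case: (ex_minnP h) => k ak hk.
  exists k, (a k), (4%:R * B / s ^+ k.+1), (s / 2%:R); split => //.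
    by rewrite divr_ge0 ?mulr_ge0 ?exprn_ge0 // ltW.
  move=> t /ltW ht; have := ha k.+1 t ht; rewrite big_ord_recr /= big1 ?add0r.
    by rewrite expr_div_n mulrA mulrAC.
  move=> i _; have [->|ai] := eqVneq (a i) 0; first by rewrite mul0r.
  by have := hk i ai; rewrite leqNgt ltn_ord.
move=> /forallNP h; left; exists (s / 2%:R) => // t /ltW ht.
apply/eqP; rewrite -cabs_eq0 eq_le cabs_ge0 andbT.
apply/ler_addgt0Pr => eps eps0; rewrite add0r.
have [m hm] := div_exp2_small (4%:R * B) eps0.
apply: (le_trans _ (ltW hm)); have := ha m t ht; rewrite big1 ?subr0 => [k|i _]; last first.
  by move/negP: (h i); rewrite negbK => /eqP ->; rewrite mul0r.
apply: (le_trans k); rewrite ler_wpM2l ?mulr_ge0 // -exprVn.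
have ts : 0 <= abs t / s by rewrite mulr_ge0 ?cabs_ge0 // invr_ge0 ltW.
by rewrite lerXn2r ?nnegrE ?invr_ge0 // ler_pdivrMr // mulrC.
Qed.

End OneVariable.

(** * Holomorphic functions of several variables *)

Section SeveralVariables.
Variables (R : realType) (n : nat).
Local Notation C := (R[i]).
Local Notation abs := (@cabs R).
Local Notation pt := (pt R n).

Lemma uniform_radius (I : finType) (P : I -> R -> Prop) :
  (forall i d d', P i d -> 0 < d' -> d' <= d -> P i d') ->
  (forall i, exists2 d : R, 0 < d & P i d) ->
  exists2 d : R, 0 < d & forall i, P i d.
Proof.
move=> mono h.
suff [d d0 hd] : exists2 d : R, 0 < d & forall i, i \in index_enum I -> P i d.
  by exists d => // i; apply: hd; rewrite mem_index_enum.
elim: (index_enum I) => [|i r [d d0 hd]]; first by exists 1.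
have [d' d'0 hd'] := h i; exists (Num.min d d'); first by rewrite lt_min d0.
move=> j; rewrite inE => /orP[/eqP ->|/hd hj].
  by apply: (mono _ d') => //; rewrite ?lt_min ?d0 // ge_min lexx orbT.
by apply: (mono _ d) => //; rewrite ?lt_min ?d0 // ge_min lexx.
Qed.

Lemma uniform_bound (I : finType) (P : I -> R -> Prop) :
  (forall i K K', P i K -> K <= K' -> P i K') ->
  (forall i, exists K, P i K) -> exists2 K : R, 0 <= K & forall i, P i K.
Proof.
move=> mono h.
suff [d d0 hd] : exists2 d : R, 0 <= d & forall i, i \in index_enum I -> P i d.
  by exists d => // i; apply: hd; rewrite mem_index_enum.
elim: (index_enum I) => [|i r [d d0 hd]]; first by exists 0.
have [d' hd'] := h i; exists (Num.max d d'); first by rewrite le_max d0.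
move=> j; rewrite inE => /orP[/eqP ->|/hd hj].
  by apply: mono hd' _; rewrite le_max lexx orbT.
by apply: mono hj _; rewrite le_max lexx.
Qed.

Definition l1 (h : 'I_n -> C) : R := \sum_j abs (h j).
Lemma l1_ge0 h : 0 <= l1 h. Proof. by apply: sumr_ge0 => j _; exact: cabs_ge0. Qed.
Lemma l1_ge h j : abs (h j) <= l1 h.
Proof.
by rewrite /l1 (bigD1 j) //= lerDl sumr_ge0 // => i _; exact: cabs_ge0.
Qed.

(* Intermediate points for changing [z] into [z + h] one coordinate at a time. *)
Definition hyb (S : seq 'I_n) (z : pt) (h : 'I_n -> C) : pt :=
  fun k => z k + (if k \in S then h k else 0).

Lemma hyb_nil z h : hyb [::] z h = z.
Proof. by apply/funext => k; rewrite /hyb addr0. Qed.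
Lemma hyb_all z h : hyb (index_enum 'I_n) z h = (fun k => z k + h k).
Proof. by apply/funext => k; rewrite /hyb mem_index_enum. Qed.
Lemma hyb_notin S z h j : j \notin S -> hyb S z h j = z j.
Proof. by rewrite /hyb => /negbTE ->; rewrite addr0. Qed.
Lemma hyb_cons S z h j : j \notin S -> hyb (j :: S) z h = upd (hyb S z h) j (hyb S z h j + h j).
Proof.
move=> jS; apply/funext => k; rewrite /upd (hyb_notin _ _ jS) /hyb inE.
by case: eqVneq => // ->.
Qed.
Lemma upd_id (z : pt) j : upd z j (z j) = z.
Proof. by apply/funext => k; rewrite /upd; case: eqVneq => // ->. Qed.
Lemma upd_upd (z : pt) j a b : upd (upd z j a) j b = upd z j b.
Proof. by apply/funext => k; rewrite /upd; case: eqVneq. Qed.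

Section Local.
Variables (f : pt -> C) (q : pt) (e B : R).
Hypothesis e0 : 0 < e.
Hypothesis fD : forall z, polydisc q e z -> forall j, cdiff_at (fun s => f (upd z j s)) (z j).
Hypothesis fB : forall z, polydisc q e z -> abs (f z) <= B.

Lemma polydisc_upd (y : pt) j (t : C) (a b : R) : 0 <= b -> polydisc q a y -> abs t <= b ->
  polydisc q (a + b) (upd y j (y j + t)).
Proof.
move=> b0 hy ht k; rewrite /upd; case: eqVneq => [->|_]; last by have := hy k; lra.
rewrite addrAC; apply: le_lt_trans (ler_cabsD _ _) _; have := hy j; lra.
Qed.

Lemma cdiff_upd (y : pt) j (t : C) : polydisc q e (upd y j (y j + t)) ->
  cdiff_at (fun s => f (upd y j (y j + s))) t.
Proof.
have e1 : upd y j (y j + t) j = y j + t by rewrite /upd eqxx.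
move=> /fD/(_ j); rewrite e1 => h.
apply: (@cdiff_translate _ (fun s => f (upd y j s))).
by move: h; congr cdiff_at; apply/funext => s; rewrite upd_upd.
Qed.

Let s := e / 8%:R.
Let s0 : 0 < s. Proof. by rewrite divr_gt0. Qed.
Let es : e = 8%:R * s. Proof. by rewrite mulrC divfK. Qed.

Lemma step_lip (y : pt) j (t : C) : polydisc q s y -> abs t <= s / 2%:R ->
  abs (f (upd y j (y j + t)) - f y) <= 4%:R * B / s * abs t.
Proof.
move=> hy ht.
have inp u : abs u <= 2%:R * s -> polydisc q e (upd y j (y j + u)).
  move=> hu k; have := polydisc_upd j (_ : 0 <= 2%:R * s) hy hu.
  move/(_ _ k); move: s0; rewrite es; lra.
have [l [h _]] := taylor2 s0 (fun u hu => cdiff_upd (inp u hu)) (fun u hu => fB (inp u hu)).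
by have := h t ht; rewrite addr0 upd_id.
Qed.

Lemma step_quad (y : pt) j : polydisc q s y -> exists l : C, forall t, abs t <= s / 2%:R ->
  abs (f (upd y j (y j + t)) - f y - l * t) <= 4%:R * B / s ^+ 2 * abs t ^+ 2.
Proof.
move=> hy.
have inp u : abs u <= 2%:R * s -> polydisc q e (upd y j (y j + u)).
  move=> hu k; have := polydisc_upd j (_ : 0 <= 2%:R * s) hy hu.
  move/(_ _ k); move: s0; rewrite es; lra.
have [l [_ h]] := taylor2 s0 (fun u hu => cdiff_upd (inp u hu)) (fun u hu => fB (inp u hu)).
by exists l => t ht; have := h t ht; rewrite addr0 upd_id.
Qed.

Lemma polydisc_hyb S z h : polydisc q (s / 4%:R) z -> (forall j, abs (h j) <= s / 2%:R) ->
  polydisc q s (hyb S z h).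
Proof.
move=> hz hh k; rewrite /hyb; case: ifP => _; last first.
  by rewrite addr0; have := hz k; move: s0; lra.
rewrite addrAC; apply: le_lt_trans (ler_cabsD _ _) _; have := hz k; have := hh k; move: s0; lra.
Qed.

Lemma poly_lip z h : polydisc q (s / 4%:R) z -> (forall j, abs (h j) <= s / 2%:R) ->
  abs (f (fun k => z k + h k) - f z) <= 4%:R * B / s * l1 h.
Proof.
move=> hz hh; rewrite -hyb_all /l1.
elim: (index_enum 'I_n) (index_enum_uniq 'I_n) => [|j S IH] /=.
  by rewrite hyb_nil subrr cabs0 big_nil mulr0.
move=> /andP[jS /IH{}IH]; rewrite big_cons mulrDr hyb_cons //.
have h1 := step_lip j (polydisc_hyb S hz hh) (hh j).
set y := f (upd _ _ _) in h1 *.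
have -> : y - f z = (y - f (hyb S z h)) + (f (hyb S z h) - f z) by ring.
exact: le_trans (ler_cabsD _ _) (lerD h1 IH).
Qed.
End Local.

Definition local_lip (f : pt -> C) (q : pt) (d K : R) := forall y z, polydisc q d y -> polydisc q d z ->
  abs (f y - f z) <= K * l1 (fun j => y j - z j).

Definition local_frechet (f : pt -> C) (q : pt) (d K : R) := forall z, polydisc q d z ->
  exists l : 'I_n -> C, forall h, (forall j, abs (h j) <= d) ->
    abs (f (fun k => z k + h k) - f z - \sum_j l j * h j) <= K * l1 h ^+ 2.

Lemma polydisc_le (q z : pt) (a b : R) : a <= b -> polydisc q a z -> polydisc q b z.
Proof. by move=> ab h k; exact: lt_le_trans (h k) ab. Qed.

Lemma holo_near_bounded (f : pt -> C) (q : pt) : holo_near f q -> exists e B : R, [/\ 0 < e, 0 <= B,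
  (forall z, polydisc q e z -> forall j, cdiff_at (fun s => f (upd z j s)) (z j)) &
  (forall z, polydisc q e z -> abs (f z) <= B)].
Proof.
move=> [e e0 h].
have hq : polydisc q e q by move=> j; rewrite subrr cabs0.
have [d d0 hd] := (h q hq).1 1 ltr01.
exists (Num.min e d), (abs (f q) + 1); split; first by rewrite lt_min e0.
- by rewrite addr_ge0 ?cabs_ge0.
- by move=> z hz; apply: (h z _).2; apply: polydisc_le hz; rewrite ge_min lexx.
- move=> z hz; have /hd : polydisc q d z by apply: polydisc_le hz; rewrite ge_min lexx orbT.
  have := lerB_cabs (f z) (f q); lra.
Qed.

Lemma holo_lip (f : pt -> C) (q : pt) : holo_near f q -> exists d K : R, [/\ 0 < d, 0 <= K & local_lip f q d K].
Proof.
move=> /holo_near_bounded[e [B [e0 B0 fD fB]]].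
have s0 : 0 < e / 8%:R by rewrite divr_gt0.
exists (e / 8%:R / 4%:R), (4%:R * B / (e / 8%:R)); split; first by rewrite divr_gt0.
  by rewrite !mulr_ge0 // invr_ge0 ltW.
move=> y z hy hz.
have hh j : abs (y j - z j) <= e / 8%:R / 2%:R.
  have := ler_cabsB (y j - q j) (z j - q j); have -> : y j - q j - (z j - q j) = y j - z j by ring.
  by have := hy j; have := hz j; lra.
have := poly_lip e0 fD fB hz hh.
by rewrite (_ : (fun k => z k + (y k - z k)) = y) //; apply/funext => k; rewrite addrC subrK.
Qed.

Lemma holo_frechet (f : pt -> C) (q : pt) : holo_near f q ->
  exists d K : R, [/\ 0 < d, 0 <= K & local_frechet f q d K].
Proof.
move=> hf; have [e1 [B [e10 B0 fD fB]]] := holo_near_bounded hf.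
have [d1 [L [d10 L0 hL]]] := holo_lip hf.
pose e := Num.min e1 d1; have e0 : 0 < e by rewrite lt_min e10.
have ee1 : e <= e1 by rewrite ge_min lexx.
have ed1 : e <= d1 by rewrite ge_min lexx orbT.
pose s := e / 8%:R; have s0 : 0 < s by rewrite divr_gt0.
have es : e = 8%:R * s by rewrite mulrC divfK.
have fD' z : polydisc q e z -> forall j, cdiff_at (fun s => f (upd z j s)) (z j).
  by move=> hz; apply: fD; exact: polydisc_le hz.
have fB' z : polydisc q e z -> abs (f z) <= B.
  by move=> hz; apply: fB; exact: polydisc_le hz.
pose K := 4%:R * L / s + 4%:R * B / s ^+ 2.
exists (s / 4%:R), K; split; first by rewrite divr_gt0.
  by rewrite addr_ge0 ?mulr_ge0 ?invr_ge0 ?exprn_ge0 ?(ltW s0).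
move=> z hz.
have hzs : polydisc q s z by apply: polydisc_le hz; move: s0; lra.
have [l hl] : {l : 'I_n -> C & forall j t, abs t <= s / 2%:R ->
   abs (f (upd z j (z j + t)) - f z - l j * t) <= 4%:R * B / s ^+ 2 * abs t ^+ 2}.
  apply: (@choice _ _ (fun j u => forall t, abs t <= s / 2%:R ->
   abs (f (upd z j (z j + t)) - f z - u * t) <= 4%:R * B / s ^+ 2 * abs t ^+ 2)) => j.
  exact: (step_quad e0 fD' fB').
exists l => h hh.
have hh' j : abs (h j) <= s / 2%:R by have := hh j; move: s0; lra.
suff : abs (f (hyb (index_enum 'I_n) z h) - f z - \sum_(j <- index_enum 'I_n) l j * h j) <=
    K * l1 h * \sum_(j <- index_enum 'I_n) abs (h j).
  by rewrite hyb_all -mulrA -expr2.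
elim: (index_enum 'I_n) (index_enum_uniq 'I_n) => [|j S IH] /=.
  by rewrite hyb_nil !big_nil subrr subr0 cabs0 mulr0.
move=> /andP[jS /IH{}IH]; rewrite !big_cons mulrDr hyb_cons //.
set y := hyb S z h in IH *.
have yj : y j = z j by rewrite /y hyb_notin.
have hy : polydisc q s y by apply: (polydisc_hyb e0).
(* The linear coefficient [l j] was found at [z] but is needed at the intermediate point [y]. The
   difference [F] of the two slices is bounded by [L * l1 h], so by [taylor2] it varies by at most a
   multiple of [l1 h * abs (h j)], which is quadratic in [h]. *)
pose F t := f (upd y j (y j + t)) - f (upd z j (z j + t)).
have iny v u : polydisc q s v -> abs u <= 2%:R * s -> polydisc q e (upd v j (v j + u)).
  move=> hv hu k; have := polydisc_upd j (_ : 0 <= 2%:R * s) hv hu.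
  move/(_ _ k); move: s0; rewrite es; lra.
have FD u : abs u <= 2%:R * s -> cdiff_at F u.
  by move=> hu; apply: cdiffB; apply: (cdiff_upd fD'); apply: iny.
have FB u : abs u <= 2%:R * s -> abs (F u) <= L * l1 h.
  move=> hu; apply: (le_trans (hL _ _ (polydisc_le ed1 (iny y u hy hu)) (polydisc_le ed1 (iny z u hzs hu)))).
  rewrite ler_wpM2l //; apply: ler_sum => k _; rewrite /upd; case: eqVneq => [_|_].
    by rewrite yj subrr cabs0 cabs_ge0.
  rewrite /y /hyb; case: ifP => _; first by rewrite addrAC subrr add0r.
  by rewrite addr0 subrr cabs0 cabs_ge0.
have [m [h1 _]] := taylor2 s0 FD FB.
have {h1} := h1 _ (hh' j); have := hl j _ (hh' j).
rewrite /F !addr0 !upd_id.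
set fy' := f (upd y _ _); set fz' := f (upd z _ _) => h2 h1.
have -> : fy' - f z - (l j * h j + \sum_(j <- S) l j * h j) =
   ((fy' - fz' - (f y - f z)) + (fz' - f z - l j * h j)) + (f y - f z - \sum_(j <- S) l j * h j) by ring.
apply: (le_trans (ler_cabsD _ _)); apply: lerD IH.
have -> : K * l1 h * abs (h j) = 4%:R * L / s * (l1 h * abs (h j)) +
  4%:R * B / s ^+ 2 * (l1 h * abs (h j)) by rewrite /K; ring.
apply: (le_trans (ler_cabsD _ _)); apply: lerD.
  by apply: le_trans h1 _; rewrite !mulrA le_eqVlt; apply/orP; left; apply/eqP; ring.
have Bs : 0 <= 4%:R * B / s ^+ 2.
  by apply: divr_ge0; [exact: mulr_ge0 | exact: exprn_ge0 (ltW s0)].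
apply: (le_trans h2); apply: (ler_wpM2l Bs).
by rewrite expr2 ler_wpM2r ?cabs_ge0 // l1_ge.
Qed.

(** The radius is chosen before the curve and the parameter, so that it serves at all parameters of
    a curve at once. *)
Lemma cdiff_comp (f : pt -> C) (q : pt) : holo_near f q -> exists2 d : R, 0 < d & forall (g : C -> pt) t0,
  polydisc q d (g t0) -> (forall j, cdiff_at (fun t => g t j) t0) -> cdiff_at (fun t => f (g t)) t0.
Proof.
move=> /holo_frechet[d [K [d0 K0 hK]]]; exists d => // g t0 hg hj.
have [l hl] := hK _ hg.
(* The linear part is differentiable along the curve; what remains is quadratically small in the
   increment of [g], hence has derivative 0. *)
rewrite (_ : (fun t => _) = (fun t => 1 * (\sum_j l j * g t j) +
  (f (g t) - \sum_j l j * g t j))); last by apply/funext => t; rewrite mul1r addrC subrK.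
apply: cdiff_lin.
  exact: (@cdiff_sum _ _ _ (fun j t => g t j)).
have [M M0 hM] : exists2 M : R, 0 <= M & forall j : 'I_n, exists2 r : R, 0 < r &
    forall t, abs t < r -> abs (g (t0 + t) j - g t0 j) <= M * abs t.
  apply: uniform_bound => [i K1 K2 [r r0 hr] hK12|j].
    by exists r => // t /hr h; apply: (le_trans h); rewrite ler_wpM2r ?cabs_ge0.
  have [M M0 [r r0 hr]] := cdiff_cont (hj j); exists M, r => // t ht.
  by have := hr (t0 + t); rewrite addrAC subrr add0r; apply.
have [r r0 hr] : exists2 r : R, 0 < r & forall (j : 'I_n) t, abs t < r ->
    abs (g (t0 + t) j - g t0 j) <= M * abs t.
  apply: (@uniform_radius _ (fun j r => forall t, abs t < r ->
    abs (g (t0 + t) j - g t0 j) <= M * abs t)) => // i a b h _ ba t ht.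
  by apply: h; exact: lt_le_trans ht ba.
apply/cdiff_atP; exists 0 => eps eps0.
pose Q := K * (n%:R * M) ^+ 2.
have Q0 : 0 <= Q by rewrite mulr_ge0 // exprn_ge0 // mulr_ge0.
have M1 : 0 < M + 1 by rewrite ltr_wpDl.
have Q1 : 0 < Q + 1 by rewrite ltr_wpDl.
exists (Num.min r (Num.min (d / (M + 1)) (eps / (Q + 1)))).
  by rewrite !lt_min r0 !divr_gt0.
move=> t; rewrite !lt_min !ltr_pdivlMr // => /and3P[tr td te].
have hh j : abs (g (t0 + t) j - g t0 j) <= d.
  apply: (le_trans (hr j t tr)); have := cabs_ge0 t; lra.
have := hl (fun j => g (t0 + t) j - g t0 j) hh.
rewrite (_ : (fun k => g t0 k + (g (t0 + t) k - g t0 k)) = g (t0 + t)); last first.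
  by apply/funext => k; rewrite addrC subrK.
have -> : \sum_j l j * (g (t0 + t) j - g t0 j) = \sum_j l j * g (t0 + t) j - \sum_j l j * g t0 j.
  by rewrite -sumrB; apply: eq_bigr => j _; rewrite mulrBr.
set S1 := \sum_j _; set S2 := \sum_j _; set h := (fun j => _) => k1.
have -> : f (g (t0 + t)) - S1 - (f (g t0) - S2) - 0 * t = f (g (t0 + t)) - f (g t0) - (S1 - S2).
  by ring.
apply: (le_trans k1).
have hl1 : l1 h <= n%:R * M * abs t.
  apply: (@le_trans _ _ (\sum_(j < n) M * abs t)); first by apply: ler_sum => j _; exact: hr.
  by rewrite sumr_const card_ord -[X in X <= _]mulr_natl mulrA.
apply: (@le_trans _ _ (Q * abs t ^+ 2)).
  rewrite /Q -mulrA ler_wpM2l // -exprMn lerXn2r ?nnegrE ?l1_ge0 //.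
  exact: le_trans (l1_ge0 _) hl1.
rewrite expr2 mulrA ler_wpM2r ?cabs_ge0 // mulrC; have := cabs_ge0 t; nra.
Qed.

End SeveralVariables.

(** * Smooth functions *)

Section RealCalculus.
Variables (R : realType) (n : nat).
Local Notation C := (R[i]).
Local Notation abs := (@cabs R).
Local Notation pt := (pt R n).
Local Notation dir := (dir n).
Local Notation shf := (@Defs.shift R n).
Implicit Types (f : pt -> R) (z q : pt) (d : dir).

Lemma translate_quotient (phi : R -> R) (x : R) :
  (fun h : R => h^-1 *: (((fun t => phi (x + t)) \o shift 0) (h *: (1 : R)) - phi (x + 0))) =
  (fun h : R => h^-1 *: ((phi \o shift x) (h *: (1 : R)) - phi x)).
Proof.
by apply/funext => h; rewrite /= !addr0 [x + _]addrC.
Qed.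

Lemma derivable_translate (phi : R -> R) (x : R) :
  derivable (fun t => phi (x + t)) 0 1 -> derivable phi x 1.
Proof. by rewrite /derivable translate_quotient. Qed.

Lemma derive1_translate (phi : R -> R) (x : R) :
  derive1 (fun t => phi (x + t)) 0 = derive1 phi x.
Proof.
rewrite /derive1.
rewrite (_ : (fun h : R => h^-1 *: (phi (x + (h + 0)) - phi (x + 0))) =
             (fun h : R => h^-1 *: (phi (h + x) - phi x))) //.
by apply/funext => h; rewrite !addr0 [x + _]addrC.
Qed.

Lemma mvt_sym (phi dphi : R -> R) (h : R) :
  (forall t : R, `|t| <= `|h| -> is_derive t (1 : R) phi (dphi t)) ->
  exists2 t : R, `|t| <= `|h| & phi h - phi 0 = dphi t * h.
Proof.
move=> H.
have cont (a b : R) : `|a| <= `|h| -> `|b| <= `|h| -> {within `[a, b], continuous phi}.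
  move=> ha hb; apply: derivable_within_continuous => x; rewrite in_itv /= => /andP[x1 x2].
  have xh : `|x| <= `|h|.
    move: ha hb; rewrite !ler_norml; case: (leP 0 h) => ? /andP[? ?] /andP[? ?]; apply/andP; split; lra.
  by case: (H x xh).
have der (a b x : R) : `|a| <= `|h| -> `|b| <= `|h| -> x \in `]a, b[ -> is_derive x (1 : R) phi (dphi x).
  move=> ha hb; rewrite in_itv /= => /andP[x1 x2]; apply: H.
  move: ha hb; rewrite !ler_norml => /andP[? ?] /andP[? ?]; apply/andP; split; lra.
have z0 : `|0 : R| <= `|h| by rewrite normr0.
have [h0|h0] := leP 0 h.
  have [c] := MVT_segment h0 (fun x => der 0 h x z0 (lexx _)) (cont _ _ z0 (lexx _)).
  rewrite in_itv /= => /andP[c1 c2] ->; exists c; last by rewrite subr0.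
  by rewrite !ger0_norm.
have [c] := MVT_segment (ltW h0) (fun x => der h 0 x (lexx _) z0) (cont _ _ (lexx _) z0).
rewrite in_itv /= => /andP[c1 c2]; rewrite sub0r => e; exists c.
  by rewrite !ler0_norm ?lerN2 // ltW.
by rewrite -opprB e mulrN opprK.
Qed.

Definition vec d (t : R) : C := if d.2 then Complex 0 t else Complex t 0.

Lemma cabs_vec d t : abs (vec d t) = `|t|.
Proof.
by rewrite /vec; case: d.2; rewrite cabsE /= expr0n /= ?add0r ?addr0 sqrtr_sqr.
Qed.
Lemma vecD d s t : vec d (s + t) = vec d s + vec d t.
Proof.
by rewrite /vec; case: d.2; apply/eqP; rewrite eq_complex /= ?add0r ?addr0 !eqxx.
Qed.
Lemma shfE z d t k : shf z d t k = z k + (if k == d.1 then vec d t else 0).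
Proof. by rewrite /Defs.shift /vec; case: ifP => _ //; rewrite addr0. Qed.
Lemma shf_shf z d s t : shf (shf z d s) d t = shf z d (s + t).
Proof.
apply/funext => k; rewrite !shfE; case: ifP => _; last by rewrite !addr0.
by rewrite vecD addrA.
Qed.
Lemma shf0 z d : shf z d 0 = z.
Proof.
by apply/funext => k; rewrite shfE /vec; case: ifP => _; rewrite ?addr0 //; case: d.2; rewrite addr0.
Qed.
Lemma shfC z d d' s t : shf (shf z d s) d' t = shf (shf z d' t) d s.
Proof. by apply/funext => k; rewrite !shfE addrAC. Qed.

Lemma polydisc_shf q a b z d t : polydisc q a z -> `|t| <= b -> polydisc q (a + b) (shf z d t).
Proof.
move=> hz ht k; have b0 := le_trans (normr_ge0 t) ht.
rewrite shfE addrAC; apply: le_lt_trans (ler_cabsD _ _) _; apply: ltr_leD; first exact: hz.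
by case: ifP => _; rewrite ?cabs_vec // cabs0.
Qed.

Lemma polydisc_id q (e : R) : 0 < e -> polydisc q e q.
Proof. by move=> e0 k; rewrite subrr cabs0. Qed.

Lemma smooth_sub (U V : set pt) f : V `<=` U -> smooth_on U f -> smooth_on V f.
Proof. by move=> VU h w; have [h1 h2] := h w; split=> z /VU; [exact: h1 | exact: h2]. Qed.

Lemma smooth_pd (U : set pt) f d : smooth_on U f -> smooth_on U (pd d f).
Proof. by move=> h w; have := h (rcons w d); rewrite /iter_pd foldr_rcons. Qed.

Lemma smooth_cont (U : set pt) f z : smooth_on U f -> U z -> cont_at f z.
Proof. by move=> h Uz; have [_ h2] := h [::]; exact: h2. Qed.

Lemma smooth_is_derive (U : set pt) f z d (t : R) : smooth_on U f -> U (shf z d t) ->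
  is_derive t (1 : R) (fun s : R => f (shf z d s)) (pd d f (shf z d t)).
Proof.
move=> h Uz; have [/(_ _ Uz d) /= h1 _] := h [::].
have e : (fun s : R => f (shf (shf z d t) d s)) = (fun s : R => (fun u : R => f (shf z d u)) (t + s)).
  by apply/funext => s; rewrite shf_shf.
apply: DeriveDef; first by apply: derivable_translate; rewrite -e.
by rewrite -derive1E -derive1_translate -e.
Qed.

Lemma mvt_pd f z d h : (forall t, `|t| <= `|h| -> exists2 U, smooth_on U f & U (shf z d t)) ->
  exists2 t, `|t| <= `|h| & f (shf z d h) - f z = pd d f (shf z d t) * h.
Proof.
move=> H; have [|t ht e] := @mvt_sym (fun t => f (shf z d t)) (fun t => pd d f (shf z d t)) h.
  by move=> t /H[U sU Ut]; exact: smooth_is_derive Ut.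
by exists t => //; rewrite -e shf0.
Qed.

(** Real counterpart of [hyb]: real and imaginary parts are moved one at a time. *)
Definition rhyb (S : seq dir) z (x : dir -> R) : pt := fun k =>
  z k + Complex (if (k, false) \in S then x (k, false) else 0) (if (k, true) \in S then x (k, true) else 0).

Lemma rhyb_nil z x : rhyb [::] z x = z.
Proof. by apply/funext => k; rewrite /rhyb /= addr0. Qed.

Lemma rhyb_cons S z x d : d \notin S -> rhyb (d :: S) z x = shf (rhyb S z x) d (x d).
Proof.
move=> dS; apply/funext => k; rewrite shfE /rhyb -addrA; congr (_ + _).
case: d dS => j b jS; rewrite !inE !xpair_eqE /vec /=.
case: eqVneq => [->|kj] /=; last by rewrite addr0.
by case: b jS => /negbTE /= ->; apply/eqP; rewrite eq_complex /= ?add0r ?addr0 !eqxx.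
Qed.

Lemma rhyb_all z (h : 'I_n -> C) :
  rhyb (index_enum _) z (fun d => if d.2 then complex.Im (h d.1) else complex.Re (h d.1)) =
  fun k => z k + h k.
Proof.
apply/funext => k; rewrite /rhyb !mem_index_enum /=; congr (_ + _); by case: (h k).
Qed.

Lemma polydisc_rhyb S q e z x : polydisc q (e / 2%:R) z -> (forall d, `|x d| <= e / 8%:R) ->
  polydisc q (e / 2%:R + e / 4%:R) (rhyb S z x).
Proof.
move=> hz hx k; rewrite /rhyb addrAC; apply: le_lt_trans (ler_cabsD _ _) _.
apply: ltr_leD; first exact: hz.
have e0 d : 0 <= e / 8%:R := le_trans (normr_ge0 (x d)) (hx d).
apply: (le_trans (cabs_ReIm _)) => /=.
have a1 : `|if (k, false) \in S then x (k, false) else 0| <= e / 8%:R.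
  by case: ifP => _ //; rewrite normr0 (e0 (k, false)).
have a2 : `|if (k, true) \in S then x (k, true) else 0| <= e / 8%:R.
  by case: ifP => _ //; rewrite normr0 (e0 (k, true)).
apply: (le_trans (lerD a1 a2)); clear; lra.
Qed.

(** The mean value theorem is applied to one real coordinate at a time. [L] may be the gradient at
    any point, provided it approximates the partial derivatives on the whole polydisc; this gives
    Lipschitz bounds as well as derivatives along lines. *)
Lemma increment_approx f q e (L : dir -> R) eps z (x : dir -> R) :
  0 < e -> smooth_on (polydisc q e) f ->
  (forall y d, polydisc q e y -> `|pd d f y - L d| <= eps) ->
  polydisc q (e / 2%:R) z -> (forall d, `|x d| <= e / 8%:R) ->
  `|f (rhyb (index_enum _) z x) - f z - \sum_d L d * x d| <= eps * \sum_d `|x d|.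
Proof.
move=> e0 sf hL hz hx.
elim: (index_enum _) (index_enum_uniq dir) => [|d S IH] /=.
  by rewrite rhyb_nil !big_nil subrr subr0 normr0 mulr0.
move=> /andP[dS /IH{}IH]; rewrite !big_cons mulrDr rhyb_cons //.
have hy := polydisc_rhyb S hz hx.
have inp t : `|t| <= `|x d| -> polydisc q e (shf (rhyb S z x) d t).
  move=> ht k; have := polydisc_shf d hy (le_trans ht (hx d)) k; move: e0; lra.
have [|t ht et] := @mvt_pd f (rhyb S z x) d (x d).
  by move=> t /inp ht; exists (polydisc q e).
set y := f (shf _ _ _) in et *.
have -> : y - f z - (L d * x d + \sum_(j <- S) L j * x j) =
   (y - f (rhyb S z x) - L d * x d) + (f (rhyb S z x) - f z - \sum_(j <- S) L j * x j) by ring.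
apply: (le_trans (ler_normD _ _)); apply: lerD IH.
rewrite et -mulrBl normrM ler_wpM2r // hL //; exact: inp.
Qed.

Lemma pd_near f q e eps : 0 < e -> 0 < eps -> smooth_on (polydisc q e) f ->
  exists r : R, [/\ 0 < r, r <= e &
    forall d y, polydisc q r y -> `|pd d f y - pd d f q| <= eps].
Proof.
move=> e0 eps0 sf.
have [r r0 hr] : exists2 r : R, 0 < r & forall d y, polydisc q r y -> `|pd d f y - pd d f q| <= eps.
  apply: uniform_radius => [d r r' h r'0 r'r y hy|d].
    by apply: h; exact: polydisc_le hy.
  have [r r0 hr] := smooth_cont (smooth_pd d sf) (polydisc_id q e0) eps0.
  by exists r => // y /hr /ltW.
exists (Num.min r e); split; first by rewrite lt_min r0.
  by rewrite ge_min lexx orbT.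
by move=> d y hy; apply: hr; apply: polydisc_le hy; rewrite ge_min lexx.
Qed.

Definition rlocal_lip f q (d K : R) := forall y z, polydisc q d y -> polydisc q d z ->
  `|f y - f z| <= K * l1 (fun j => y j - z j).

Lemma sum_dir_l1 (h : 'I_n -> C) :
  \sum_(d : dir) `|if d.2 then complex.Im (h d.1) else complex.Re (h d.1)| <= 2%:R * l1 h.
Proof.
rewrite -(pair_bigA _ (fun j b => `|if b then complex.Im (h j) else complex.Re (h j)|)) /=.
rewrite /l1 mulr_sumr; apply: ler_sum => j _; rewrite big_bool /=.
have := cabs_Re (h j); have := cabs_Im (h j); lra.
Qed.

Lemma smooth_lip f q e : 0 < e -> smooth_on (polydisc q e) f ->
  exists d K : R, [/\ 0 < d, 0 <= K & rlocal_lip f q d K].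
Proof.
move=> e0 sf; have [r [r0 re hr]] := pd_near e0 ltr01 sf.
have sr : smooth_on (polydisc q r) f by apply: smooth_sub sf => z; exact: polydisc_le.
have [M M0 hM] : exists2 M : R, 0 <= M & forall d, `|pd d f q| <= M.
  apply: uniform_bound => [d K K' h /(le_trans h)//|d]; by exists `|pd d f q|.
exists (r / 16%:R), ((M + 1) * 2%:R); split; first by rewrite divr_gt0.
  by rewrite mulr_ge0 // addr_ge0.
move=> y z hy hz.
pose h j := y j - z j.
pose x (d : dir) := if d.2 then complex.Im (h d.1) else complex.Re (h d.1).
have hh j : abs (h j) <= r / 8%:R.
  have := ler_cabsB (y j - q j) (z j - q j); have -> : y j - q j - (z j - q j) = h j by rewrite /h; ring.
  by have := hy j; have := hz j; lra.
have hx d : `|x d| <= r / 8%:R.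
  apply: le_trans (hh d.1); rewrite /x; case: d.2; [exact: cabs_Im | exact: cabs_Re].
have hz2 : polydisc q (r / 2%:R) z by apply: polydisc_le hz; move: r0; lra.
have := increment_approx r0 sr (fun y d hy => hr d y hy) hz2 hx.
rewrite rhyb_all (_ : (fun k => z k + h k) = y); last by apply/funext => k; rewrite addrC subrK.
rewrite mul1r; set S := \sum_d _ * _; set S' := \sum_d _.
have hS' : S' <= 2%:R * l1 h by exact: sum_dir_l1.
have hS : `|S| <= M * S'.
  rewrite mulr_sumr; apply: (le_trans (ler_norm_sum _ _ _)); apply: ler_sum => d _.
  by rewrite normrM ler_wpM2r.
have S'0 : 0 <= S' by apply: sumr_ge0.
move=> k; have := ler_normD (f y - f z - S) S; rewrite subrK.
have : (M + 1) * S' <= (M + 1) * (2%:R * l1 h) by rewrite ler_wpM2l // addr_ge0.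
move: k hS; lra.
Qed.

(* Moving along a coordinate direction in which the derivative does not vanish reaches the
   zero set within a distance comparable to the value of [f]. *)
Lemma nearby_zero f q e d e' : 0 < e -> 0 < e' -> smooth_on (polydisc q e) f -> f q = 0 ->
  pd d f q != 0 -> exists r K : R, [/\ 0 < r, 0 <= K & forall z, polydisc q r z ->
    exists t, [/\ `|t| <= K * `|f z|, polydisc q e' (shf z d t) & f (shf z d t) = 0]].
Proof.
move=> e0 e'0 sf fq0 D0.
have D1 : 0 < `|pd d f q| by rewrite normr_gt0.
set D := pd d f q in D0 D1 *.
pose e1 := Num.min e e'; have e10 : 0 < e1 by rewrite lt_min e0.
have sf1 : smooth_on (polydisc q e1) f.
  by apply: smooth_sub sf => z; apply: polydisc_le; rewrite ge_min lexx.
have [r [r0 re hr]] := pd_near e10 (divr_gt0 D1 (ltr0Sn R 1)) sf1.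
have sr : smooth_on (polydisc q r) f by apply: smooth_sub sf1 => z; exact: polydisc_le.
have rD : 0 < r * `|D| / 8%:R by rewrite divr_gt0 // mulr_gt0.
have [r' r'0 hr'] := smooth_cont sr (polydisc_id q r0) rD.
(* The slope along [d] stays within [|D| / 2] of [D], so a parameter of size [2 * |f z| / |D|]
   suffices to reach a zero. *)
pose K := 2%:R / `|D|; have K0 : 0 < K by rewrite divr_gt0.
exists (Num.min r' (r / 2%:R)), K; split; first by rewrite lt_min r'0 divr_gt0.
  exact: ltW.
move=> z hz.
have hzr : polydisc q (r / 2%:R) z by apply: polydisc_le hz; rewrite ge_min lexx orbT.
have fz : `|f z| < r * `|D| / 8%:R.
  by have := hr' z; rewrite fq0 subr0; apply; apply: polydisc_le hz; rewrite ge_min lexx.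
pose T := K * `|f z|; have T0 : 0 <= T by rewrite mulr_ge0 // ltW.
have TD : T * `|D| = 2%:R * `|f z| by rewrite /T /K; field; rewrite gt_eqF.
have Tr : T <= r / 4%:R by rewrite -(ler_pM2r D1) TD; lra.
have inp t : `|t| <= T -> polydisc q r (shf z d t).
  move=> ht k; have := polydisc_shf d hzr (le_trans ht Tr) k; move: r0; lra.
pose phi t := f (shf z d t).
have key t : `|t| <= T -> exists c, `|c - D| <= `|D| / 2%:R /\ phi t - f z = c * t.
  move=> ht; have [|u hu e2] := @mvt_pd f z d t.
    by move=> u hu; exists (polydisc q r) => //; apply: inp; exact: le_trans hu ht.
  exists (pd d f (shf z d u)); split=> //; apply: hr; apply: inp; exact: le_trans hu ht.
have cont : {within `[(- T), T], continuous phi}.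
  apply: derivable_within_continuous => x; rewrite in_itv /= => hx.
  have hx' : `|x| <= T by rewrite ler_norml.
  by case: (smooth_is_derive sr (inp x hx')).
have NT : `|- T| <= T by rewrite normrN ger0_norm.
have PT : `|T| <= T by rewrite ger0_norm.
have TT : - T <= T by lra.
have [c1 [hc1 ec1]] := key _ NT; have [c2 [hc2 ec2]] := key _ PT.
(* The secant slopes [c1] and [c2] have the sign of [D] and absolute value at least [|D| / 2], so
   [phi] takes values of opposite weak sign at [- T] and [T]. *)
have [|t] := IVT (v := 0) TT cont.
  rewrite ge_min le_max; move: hc1 hc2 ec1 ec2; rewrite !ler_norml.
  have := ler_norm (f z); have := lerNnormlW (lexx `|f z|).
  move: TD; have [Dp|Dn] := ltP 0 D.
    rewrite (ger0_norm (ltW Dp)) => TD a1 a2 /andP[b1 b2] /andP[b3 b4] h1 h2.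
    have : phi (- T) <= 0 by nra.
    have : 0 <= phi T by nra.
    by move=> -> ->; rewrite orbT.
  rewrite (ler0_norm Dn) => TD a1 a2 /andP[b1 b2] /andP[b3 b4] h1 h2.
  have : 0 <= phi (- T) by nra.
  have : phi T <= 0 by nra.
  by move=> -> ->; rewrite orbT.
rewrite in_itv /= => ht ft; have ht' : `|t| <= T by rewrite ler_norml.
exists t; split => //; apply: polydisc_le (inp t ht').
by apply: (le_trans re); rewrite ge_min lexx orbT.
Qed.

Lemma l1_shf z d t : l1 (fun j => z j - shf z d t j) = `|t|.
Proof.
rewrite /l1 (bigD1 d.1) //= big1 ?addr0 => [|j jd].
  by rewrite shfE eqxx opprD addrA subrr sub0r cabsN cabs_vec.
by rewrite shfE (negbTE jd) addr0 subrr cabs0.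
Qed.

(** [nearby_zero] gives a zero of [f], hence of [g], at distance at most [K * |f z|] from [z]; the
    Lipschitz bound of [g] between the two points concludes. *)
Lemma vanishing_comparison f (g : pt -> R) q e d : 0 < e -> smooth_on (polydisc q e) f -> f q = 0 ->
  pd d f q != 0 -> (exists r K : R, [/\ 0 < r, 0 <= K & rlocal_lip g q r K]) ->
  (exists2 r, 0 < r & forall z, polydisc q r z -> f z = 0 -> g z = 0) ->
  exists r K : R, [/\ 0 < r, 0 <= K & forall z, polydisc q r z -> `|g z| <= K * `|f z|].
Proof.
move=> e0 sf fq0 D0 [r1 [K1 [r10 K10 hK1]]] [r2 r20 hr2].
have m0 : 0 < Num.min r1 r2 by rewrite lt_min r10.
have [r [K [r0 K0 h]]] := nearby_zero e0 m0 sf fq0 D0.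
exists (Num.min r r1), (K1 * K); split; [by rewrite lt_min r0 | exact: mulr_ge0 |].
move=> z hz; have hzr : polydisc q r z by apply: polydisc_le hz; rewrite ge_min lexx.
have hz1 : polydisc q r1 z by apply: polydisc_le hz; rewrite ge_min lexx orbT.
have [t [ht hp f0]] := h z hzr.
have hp1 : polydisc q r1 (shf z d t) by apply: polydisc_le hp; rewrite ge_min lexx.
have hp2 : polydisc q r2 (shf z d t) by apply: polydisc_le hp; rewrite ge_min lexx orbT.
have := hK1 _ _ hz1 hp1; rewrite (hr2 _ hp2 f0) subr0 l1_shf => /le_trans; apply.
by rewrite -mulrA ler_wpM2l.
Qed.

End RealCalculus.

(** * Holomorphic maps between polydiscs and symmetry of mixed derivatives *)

Section Clairaut.
Variables (R : realType) (n : nat).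
Local Notation C := (R[i]).
Local Notation abs := (@cabs R).
Local Notation pt := (pt R n).
Local Notation dir := (dir n).
Local Notation shf := (@Defs.shift R n).
Implicit Types (f : pt -> R) (z q : pt) (d : dir).

Lemma l1_polydisc q a z : polydisc q a z -> l1 (fun j => z j - q j) <= n%:R * a.
Proof.
move=> h; apply: (@le_trans _ _ (\sum_(j < n) a)); first by apply: ler_sum => j _; exact: ltW.
by rewrite sumr_const card_ord -[X in X <= _]mulr_natl.
Qed.

Lemma holo_map_lip (F : pt -> pt) q : (forall j, holo_near (fun z => F z j) q) ->
  exists d M : R, [/\ 0 < d, 0 <= M & forall y z, polydisc q d y -> polydisc q d z ->
    l1 (fun j => F y j - F z j) <= M * l1 (fun j => y j - z j)].
Proof.
move=> hF.
have [M M0 hM] : exists2 M : R, 0 <= M & forall j : 'I_n, exists2 r : R, 0 < r &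
    local_lip (fun z => F z j) q r M.
  apply: uniform_bound => [j K K' [r r0 hr] KK'|j].
    exists r => // y z hy hz; apply: (le_trans (hr y z hy hz)).
    by rewrite ler_wpM2r // l1_ge0.
  by have [r [K [r0 _ hr]]] := holo_lip (hF j); exists K, r.
have [r r0 hr] : exists2 r : R, 0 < r & forall j : 'I_n, local_lip (fun z => F z j) q r M.
  apply: (@uniform_radius _ _ (fun (j : 'I_n) r => local_lip (fun z => F z j) q r M)) => //.
  by move=> j a b h _ ba y z hy hz; apply: h; exact: polydisc_le ba _.
exists r, (n%:R * M); split => //; first exact: mulr_ge0.
move=> y z hy hz; apply: (@le_trans _ _ (\sum_(j < n) M * l1 (fun j => y j - z j))).
  by apply: ler_sum => j _; exact: hr.
by rewrite sumr_const card_ord -[X in X <= _]mulr_natl mulrA.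
Qed.

Lemma holo_map_near (F : pt -> pt) q e : 0 < e -> (forall j, holo_near (fun z => F z j) q) ->
  exists2 d : R, 0 < d & forall z, polydisc q d z -> polydisc (F q) e (F z).
Proof.
move=> e0 /holo_map_lip[d [M [d0 M0 h]]].
have c0 : 0 < M * n%:R + 1 by rewrite ltr_wpDl // mulr_ge0.
exists (Num.min d (e / (M * n%:R + 1))); first by rewrite lt_min d0 divr_gt0.
move=> z hz j.
have hzd : polydisc q d z by apply: polydisc_le hz; rewrite ge_min lexx.
have r0 : 0 < e / (M * n%:R + 1) by rewrite divr_gt0.
have hz2 : polydisc q (e / (M * n%:R + 1)) z by apply: polydisc_le hz; rewrite ge_min lexx orbT.
apply: le_lt_trans (l1_ge (fun j => F z j - F q j) j) _.
apply: le_lt_trans (h z q hzd (polydisc_id q d0)) _.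
apply: le_lt_trans (ler_wpM2l M0 (l1_polydisc hz2)) _.
by rewrite mulrA mulrA ltr_pdivrMr // [X in _ < X]mulrDr mulr1 [X in _ < X + _]mulrC ltrDl.
Qed.

Lemma rlip_comp f (F : pt -> pt) p q :
  (exists d K : R, [/\ 0 < d, 0 <= K & rlocal_lip f p d K]) ->
  F q = p -> (forall j, holo_near (fun z => F z j) q) ->
  exists d K : R, [/\ 0 < d, 0 <= K & rlocal_lip (fun z => f (F z)) q d K].
Proof.
move=> [d [K [d0 K0 hK]]] Fq hF; have [r r0 hr] := holo_map_near d0 hF.
have [d' [M [d'0 M0 hM]]] := holo_map_lip hF.
exists (Num.min r d'), (K * M); split; [by rewrite lt_min r0 | exact: mulr_ge0 |].
move=> y z hy hz.
have [hy1 hz1] : polydisc q r y /\ polydisc q r z.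
  by split; [apply: polydisc_le hy | apply: polydisc_le hz]; rewrite ge_min lexx.
have [hy2 hz2] : polydisc q d' y /\ polydisc q d' z.
  by split; [apply: polydisc_le hy | apply: polydisc_le hz]; rewrite ge_min lexx orbT.
have := hr _ hy1; have := hr _ hz1; rewrite Fq => k1 k2.
by apply: (le_trans (hK _ _ k2 k1)); rewrite -mulrA ler_wpM2l // hM.
Qed.

Lemma polydisc_open q e z : polydisc q e z -> exists2 r : R, 0 < r &
  forall y, polydisc z r y -> polydisc q e y.
Proof.
move=> hz; have [r r0 hr] : exists2 r : R, 0 < r & forall j : 'I_n, r <= e - abs (z j - q j).
  apply: (@uniform_radius _ _ (fun (j : 'I_n) r => r <= e - abs (z j - q j))).
    by move=> j a b h _ ba; exact: le_trans ba h.
  by move=> j; exists (e - abs (z j - q j)) => //; rewrite subr_gt0.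
exists r => // y hy j; have := ler_cabsD (y j - z j) (z j - q j); rewrite addrA subrK.
by have := hy j; have := hr j; lra.
Qed.

(** The mean value theorem is used first in direction [d], for the difference of [f] across the step
    in direction [d'], then in direction [d'] for [pd d f]. *)
Lemma second_difference f q r d d' h : smooth_on (polydisc q r) f -> `|h| < r / 4%:R ->
  exists2 y, polydisc q r y &
    f (shf (shf q d h) d' h) - f (shf q d h) - (f (shf q d' h) - f q) = pd d' (pd d f) y * h ^+ 2.
Proof.
move=> sf hr; have r0 : 0 < r by have := normr_ge0 h; lra.
have inp s t : `|s| <= `|h| -> `|t| <= `|h| -> polydisc q r (shf (shf q d s) d' t).
  move=> hs ht; have hq : polydisc q (r / 4%:R) q by apply: polydisc_id; lra.
  move=> k; have := polydisc_shf d' (polydisc_shf d hq hs) ht k; lra.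
have n0 : `|0 : R| <= `|h| by rewrite normr0.
have [|t ht e1] := @mvt_sym R (fun t => f (shf (shf q d' h) d t) - f (shf q d t))
    (fun t => pd d f (shf (shf q d' h) d t) - pd d f (shf q d t)) h.
  move=> t ht; apply: is_deriveB; apply: (smooth_is_derive sf).
    by rewrite shfC; exact: inp.
  by have := inp t 0 ht n0; rewrite shf0.
have [|u hu e2] := @mvt_pd R n (pd d f) (shf q d t) d' h.
  by move=> u hu; exists (polydisc q r); [exact: smooth_pd | exact: inp].
exists (shf (shf q d t) d' u); first exact: inp.
rewrite expr2 mulrA -e2 [shf (shf q d t) d' h]shfC -e1 !shf0.
by rewrite (shfC q d d').
Qed.

#[local] Opaque pd.

(** The second difference is symmetric in the two directions, so the two mixed derivatives agree
    when taken at two suitable points near [q]; continuity brings both points to [q]. *)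
Lemma clairaut_center f q e d d' : 0 < e -> smooth_on (polydisc q e) f ->
  pd d (pd d' f) q = pd d' (pd d f) q.
Proof.
move=> e0 sf; apply/eqP; rewrite -subr_eq0 -normr_eq0 eq_le normr_ge0 andbT.
apply/ler_addgt0Pr => eps eps0; rewrite add0r.
have e2 := divr_gt0 eps0 (ltr0Sn R 1).
have [r1 [r10 r1e h1]] := pd_near e0 e2 (smooth_pd d' sf).
have [r2 [r20 r2e h2]] := pd_near e0 e2 (smooth_pd d sf).
pose r := Num.min r1 r2; have r0 : 0 < r by rewrite lt_min r10.
have sr : smooth_on (polydisc q r) f.
  apply: smooth_sub sf => z; apply: polydisc_le; apply: le_trans r1e; by rewrite ge_min lexx.
have hh : `|r / 8%:R| < r / 4%:R by rewrite ger0_norm; lra.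
have [y hy ey] := second_difference d d' sr hh.
have [y' hy' ey'] := second_difference d' d sr hh.
have h20 : 0 < (r / 8%:R) ^+ 2 by rewrite exprn_gt0 // divr_gt0.
have yy : pd d' (pd d f) y = pd d (pd d' f) y'.
  have hn : (r / 8%:R) ^+ 2 != 0 by rewrite gt_eqF.
  move: ey ey'; rewrite (shfC q d d').
  move: (f (shf (shf q d' _) d _)) (f (shf q d _)) (f (shf q d' _)) (f q) => A1 A2 A3 A4.
  move: (pd d' (pd d f) y) (pd d (pd d' f) y') (_ ^+ 2) hn => P P' H hn E1 E2.
  by apply: (mulIf hn); rewrite -E1 -E2; ring.
have rr1 : r <= r1 by rewrite ge_min lexx.
have rr2 : r <= r2 by rewrite ge_min lexx orbT.
have k1 := h1 d y' (polydisc_le rr1 hy').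
have k2 := h2 d' y (polydisc_le rr2 hy).
rewrite yy in k2; move: k1 k2.
move: (pd d (pd d' f) y') (pd d (pd d' f) q) (pd d' (pd d f) q) => P a b k1 k2.
have -> : a - b = (P - b) - (P - a) by ring.
by apply: (le_trans (ler_normB _ _)); rewrite (splitr eps) lerD.
Qed.

Lemma clairaut f q e d d' z : smooth_on (polydisc q e) f -> polydisc q e z ->
  pd d (pd d' f) z = pd d' (pd d f) z.
Proof.
move=> sf /polydisc_open[r r0 hr]; apply: (clairaut_center _ _ r0).
exact: smooth_sub sf.
Qed.

#[local] Transparent pd.

Lemma pd_local f g q e d : (forall z, polydisc q e z -> f z = g z) ->
  forall z, polydisc q e z -> pd d f z = pd d g z.
Proof.
move=> fg z /polydisc_open[r r0 hr]; rewrite /pd !derive1E.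
apply: near_eq_derive.
near=> t; apply: fg; apply: hr => k.
have := polydisc_shf d (polydisc_id z (divr_gt0 r0 (ltr0Sn R 1))) (_ : `|t| <= r / 2%:R) k.
have -> : r / 2%:R + r / 2%:R = r by rewrite -splitr.
apply; near: t; apply/nbhs_normP; exists (r / 2%:R) => /=; first by rewrite divr_gt0.
by move=> t /=; rewrite sub0r normrN => /ltW.
Unshelve. all: by end_near.
Qed.

#[local] Opaque pd.

Lemma wirt_local os f g q e : (forall z, polydisc q e z -> f z = g z) ->
  forall z, polydisc q e z -> wirt os f z = wirt os g z.
Proof.
elim: os f g => [|o os IH] f g fg z hz /=; first by rewrite fg.
rewrite (IH _ (pd (o.1, false) g) (pd_local _ fg) _ hz).
by rewrite (IH _ (pd (o.1, true) g) (pd_local _ fg) _ hz).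
Qed.

(** Algebraic core of the commutation of two Wirtinger operators, which are combinations of real
    partial derivatives with coefficients [s] and [t]. *)
Lemma symmetric_mix (P : dir -> dir -> C) (s t : C) a a' b b' : (forall d d', P d d' = P d' d) ->
  ((P a b + s * P a' b) / 2%:R + t * ((P a b' + s * P a' b') / 2%:R)) / 2%:R =
  ((P b a + t * P b' a) / 2%:R + s * ((P b a' + t * P b' a') / 2%:R)) / 2%:R.
Proof. by move=> h; rewrite (h b a) (h b' a) (h b a') (h b' a'); ring. Qed.

Lemma wirt_swap o o' os f q e z : smooth_on (polydisc q e) f -> polydisc q e z ->
  wirt (o :: o' :: os) f z = wirt (o' :: o :: os) f z.
Proof.
move=> sf hz; apply: (@symmetric_mix (fun d d' => wirt os (pd d (pd d' f)) z)) => d d'.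
by apply: wirt_local hz => y hy; exact: clairaut hy.
Qed.

Lemma wirt_cons_congr o os os' f q e z : smooth_on (polydisc q e) f ->
  (forall g, smooth_on (polydisc q e) g -> wirt os g z = wirt os' g z) ->
  wirt (o :: os) f z = wirt (o :: os') f z.
Proof.
by move=> sf h /=; rewrite !h //; exact: smooth_pd.
Qed.

Lemma wirt_move o os os' f q e z : smooth_on (polydisc q e) f -> polydisc q e z ->
  wirt (os ++ o :: os') f z = wirt (o :: os ++ os') f z.
Proof.
move=> sf hz; elim: os f sf => [//|x os IH] f sf.
transitivity (wirt (x :: o :: os ++ os') f z); first exact: wirt_cons_congr sf IH.
exact: wirt_swap sf hz.
Qed.

(** [coef] applies the derivatives in the fixed order of [wword], whereas Taylor expansion along
    rays produces words in any order. *)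
Lemma wirt_perm os os' f q e z : smooth_on (polydisc q e) f -> polydisc q e z ->
  perm_eq os os' -> wirt os f z = wirt os' f z.
Proof.
move=> + hz; elim: os os' f => [|x s IH] os' f sf.
  by rewrite perm_sym => /perm_nilP ->.
move=> h; have xs : x \in os' by rewrite -(perm_mem h) mem_head.
move: h; case/splitPr: xs => s1 s2 h.
rewrite [RHS](wirt_move _ _ _ sf hz); apply: (wirt_cons_congr _ sf) => g sg; apply: IH => //.
by move: h; rewrite perm_sym -(cat1s x s2) perm_catCA cat1s perm_cons perm_sym.
Qed.

End Clairaut.

(** * Taylor expansion in real coordinates *)

Section RealTaylor.
Variables (R : realType) (n : nat).
Local Notation C := (R[i]).
Local Notation abs := (@cabs R).
Local Notation pt := (pt R n).
Local Notation dir := (dir n).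
Implicit Types (f : pt -> R) (z q : pt) (d : dir).

#[local] Opaque pd.

Lemma uniform_radius_bound (I : finType) (P : I -> R -> R -> Prop) :
  (forall i r r' K K', P i r K -> r' <= r -> K <= K' -> P i r' K') ->
  (forall i, exists r K : R, 0 < r /\ P i r K) ->
  exists r K : R, [/\ 0 < r, 0 <= K & forall i, P i r K].
Proof.
move=> mono h.
have [K K0 hK] : exists2 K : R, 0 <= K & forall i, exists2 r : R, 0 < r & P i r K.
  apply: uniform_bound => [i K K' [r r0 hr] KK'|i]; first by exists r => //; exact: mono hr (lexx _) KK'.
  by have [r [K [r0 hr]]] := h i; exists K, r.
have [r r0 hr] : exists2 r : R, 0 < r & forall i, P i r K.
  by apply: (@uniform_radius R _ (fun i r => P i r K)) => // i a b hp _ ba; exact: mono hp ba (lexx _).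
by exists r, K.
Qed.

Lemma is_derive_eps (phi : R -> R) (x l : R) :
  (forall e : R, 0 < e -> exists2 d : R, 0 < d &
     forall h, `|h| < d -> `|phi (x + h) - phi x - l * h| <= e * `|h|) ->
  is_derive x (1 : R) phi l.
Proof.
move=> H.
have cv : (fun h : R => h^-1 *: ((phi \o shift x) (h *: (1 : R)) - phi x)) h @[h --> 0^'] --> l.
  apply/cvgrPdist_le => e e0; have [d d0 hd] := H e e0.
  near=> h.
  have h0 : h != 0 by near: h; exact: nbhs_dnbhs_neq.
  have hh : `|h| < d by near: h; exact: dnbhs0_lt.
  have hp : 0 < `|h| by rewrite normr_gt0.
  rewrite /= /shift /GRing.scale /= mulr1 (addrC h x) distrC.
  have -> : h^-1 * (phi (x + h) - phi x) - l = (phi (x + h) - phi x - l * h) / h.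
    by rewrite [RHS]mulrBl mulfK // mulrC.
  by rewrite normrM normfV ler_pdivrMr // hd.
apply: DeriveDef; first by apply/cvg_ex; exists l.
exact: cvg_lim cv.
Unshelve. all: by end_near.
Qed.

Definition dirc z d : R := if d.2 then complex.Im (z d.1) else complex.Re (z d.1).
Definition smul (s : R) z : pt := fun k => ofr s * z k.

Lemma dirc_smul s z d : dirc (smul s z) d = s * dirc z d.
Proof.
rewrite /dirc /smul; case: (z d.1) => a b; case: d.2 => /=; ring.
Qed.

Lemma polydisc_smul e s z : `|s| <= 1 -> polydisc (@origin R n) e z ->
  polydisc (@origin R n) e (smul s z).
Proof.
move=> hs hz k; have := hz k; rewrite /smul !subr0 cabsM cabs_ofr.
by apply: le_lt_trans; rewrite ler_piMl // cabs_ge0.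
Qed.

Lemma line_derive f q e z (s : R) : smooth_on (polydisc q e) f -> polydisc q e (smul s z) ->
  is_derive s (1 : R) (fun t : R => f (smul t z)) (\sum_d dirc z d * pd d f (smul s z)).
Proof.
move=> sf /polydisc_open[e1 e10 he1]; apply: is_derive_eps => eps eps0.
set y := smul s z in he1 *.
have sf1 : smooth_on (polydisc y e1) f by exact: smooth_sub sf.
pose M := \sum_d `|dirc z d| + 1.
have M0 : 0 < M by rewrite ltr_wpDl // sumr_ge0.
have [r [r0 re hr]] := pd_near e10 (divr_gt0 eps0 M0) sf1.
have sr : smooth_on (polydisc y r) f by apply: smooth_sub sf1 => w; exact: polydisc_le.
exists (r / 8%:R / M); first by rewrite !divr_gt0.
move=> h; rewrite ltr_pdivlMr // => hh.
pose x d := dirc (smul h z) d.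
have hx d : `|x d| <= r / 8%:R.
  rewrite /x dirc_smul normrM; apply: le_trans (ltW hh); rewrite ler_wpM2l //.
  by rewrite /M (bigD1 d) //= -addrA lerDl addr_ge0 // sumr_ge0.
have := increment_approx r0 sr (fun w d hw => hr d w hw) (polydisc_id y (divr_gt0 r0 (ltr0Sn R 1))) hx.
rewrite (rhyb_all y (smul h z)) (_ : (fun k => _) = smul (s + h) z); last first.
  by apply/funext => k; rewrite /y /smul ofrD mulrDl.
move=> k; have e3 : (\sum_d dirc z d * pd d f y) * h = \sum_d pd d f y * x d.
  by rewrite mulr_suml; apply: eq_bigr => d _; rewrite /x dirc_smul; ring.
rewrite e3; apply: (le_trans k).
have -> : \sum_d `|x d| = `|h| * \sum_d `|dirc z d|.
  by rewrite mulr_sumr; apply: eq_bigr => d _; rewrite /x dirc_smul normrM.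
move: (\sum_d `|dirc z d|) @M M0 {hr hh hx k e3} => S M M0.
have -> : eps / M * (`|h| * S) = eps * (S / M) * `|h| by ring.
rewrite ler_wpM2r // ler_piMr ?(ltW eps0) // ler_pdivrMr // mul1r.
by rewrite /M lerDl.
Qed.

(* The [k]-th derivative at 0 of [t |-> f (t x)], when [x] lists real coordinates. *)
Fixpoint dsum k f (x : dir -> R) : R :=
  if k is k'.+1 then \sum_d x d * dsum k' (pd d f) x else f (@origin R n).

Lemma dsum_hom k f (c : R) x : dsum k f (fun d => c * x d) = c ^+ k * dsum k f x.
Proof.
elim: k f => [|k IH] f /=; first by rewrite expr0 mul1r.
by rewrite mulr_sumr; apply: eq_bigr => d _; rewrite IH exprS; ring.
Qed.

Lemma poly_derive N (c : nat -> R) (s : R) :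
  is_derive s (1 : R) (fun t : R => \sum_(k < N.+1) t ^+ k * c k)
    (\sum_(k < N) k.+1%:R * s ^+ k * c k.+1).
Proof.
apply: is_derive_eps => e e0.
suff [d [K [d0 K0 h]]] : exists d K : R, [/\ 0 < d, 0 <= K & forall h : R, `|h| < d ->
   `|\sum_(k < N.+1) (s + h) ^+ k * c k - \sum_(k < N.+1) s ^+ k * c k -
     (\sum_(k < N) k.+1%:R * s ^+ k * c k.+1) * h| <= K * `|h| ^+ 2].
  have K1 : 0 < K + 1 by rewrite ltr_wpDl.
  exists (Num.min d (e / (K + 1))); first by rewrite lt_min d0 divr_gt0.
  move=> t; rewrite lt_min ltr_pdivlMr // => /andP[td te]; apply: (le_trans (h t td)).
  by rewrite expr2 mulrA ler_wpM2r //; have := normr_ge0 t; nra.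
have mono k : exists d K : R, [/\ 0 < d, 0 <= K & forall h : R, `|h| < d ->
   `|(s + h) ^+ k.+1 - s ^+ k.+1 - k.+1%:R * s ^+ k * h| <= K * `|h| ^+ 2].
  elim: k => [|k [d [K [d0 K0 h]]]].
    exists 1, 0; split=> // h _; rewrite !expr1 expr0.
    by rewrite (_ : s + h - s - 1%:R * 1 * h = 0) ?normr0 ?mul0r //; ring.
  exists (Num.min d 1), (K * (`|s| + 1) + k.+1%:R * `|s| ^+ k); split; first by rewrite lt_min d0 ?ltr01.
    by apply: addr_ge0; apply: mulr_ge0.
  move=> t; rewrite lt_min => /andP[td t1].
  have -> : (s + t) ^+ k.+2 - s ^+ k.+2 - k.+2%:R * s ^+ k.+1 * t =
    ((s + t) ^+ k.+1 - s ^+ k.+1 - k.+1%:R * s ^+ k * t) * (s + t) + k.+1%:R * s ^+ k * t ^+ 2.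
    rewrite -[k.+2%:R]natr1 !(exprS _ k.+1) (exprS s k); ring.
  apply: (le_trans (ler_normD _ _)); rewrite [X in _ <= X]mulrDl; apply: lerD; last first.
    by rewrite !normrM !normrX ger0_norm.
  rewrite normrM [X in _ <= X]mulrAC; apply: ler_pM => //; first exact: h.
  by apply: (le_trans (ler_normD _ _)); rewrite lerD2l ltW.
elim: N => [|N [d [K [d0 K0 h]]]].
  exists 1, 0; split => // h _; rewrite !big_ord_recr !big_ord0 /= !expr0 subrr mul0r subrr normr0.
  by rewrite mul0r.
have [d' [K' [d'0 K'0 h']]] := mono N.
exists (Num.min d d'), (K + K' * `|c N.+1|); split; first by rewrite lt_min d0 ?ltr01.
  by rewrite addr_ge0 // mulr_ge0.
move=> t; rewrite lt_min => /andP[/h{}h /h'{}h'].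
rewrite [X in `|X - _ - _|]big_ord_recr [X in `|_ - X - _|]big_ord_recr.
rewrite [X in `|_ - _ - X * _|]big_ord_recr /=.
move: h; set S1 := \sum_(_ < _) _; set S2 := \sum_(_ < _) _; set S3 := \sum_(_ < _) _ => h.
have -> : S1 + (s + t) ^+ N.+1 * c N.+1 - (S2 + s ^+ N.+1 * c N.+1) -
    (S3 + N.+1%:R * s ^+ N * c N.+1) * t = (S1 - S2 - S3 * t) +
    ((s + t) ^+ N.+1 - s ^+ N.+1 - N.+1%:R * s ^+ N * t) * c N.+1 by ring.
apply: (le_trans (ler_normD _ _)); rewrite [X in _ <= X]mulrDl; apply: lerD => //.
by rewrite normrM [X in _ <= X]mulrAC ler_wpM2r.
Qed.

Lemma l1_smul (s : R) z : `|s| <= 1 -> l1 (smul s z) <= l1 z.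
Proof.
move=> hs; apply: ler_sum => j _; rewrite /smul cabsM cabs_ofr.
by rewrite ler_piMl // cabs_ge0.
Qed.

Lemma sum_dirc z : \sum_d `|dirc z d| <= 2%:R * l1 z.
Proof. exact: sum_dir_l1. Qed.

(** Along the ray [t z], the derivative of the remainder of order [N + 1] is the sum of [dirc z d]
    times the remainder of order [N] of [pd d f]. Induction bounds the latter, and the mean value
    theorem between 0 and 1 yields the extra factor [l1 z]. *)
Lemma taylor_real N f e : 0 < e -> smooth_on (polydisc (@origin R n) e) f ->
  exists r K : R, [/\ 0 < r, 0 <= K & forall z, polydisc (@origin R n) r z ->
    `|f z - \sum_(k < N) dsum k f (dirc z) / k`!%:R| <= K * l1 z ^+ N].
Proof.
move=> e0; elim: N f => [|N IH] f sf.
  have [r r0 hr] := smooth_cont sf (polydisc_id _ e0) ltr01.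
  exists r, (`|f (@origin R n)| + 1); split; [exact: r0 | exact: addr_ge0 | move=> z /hr hz].
  rewrite big_ord0 subr0 expr0 mulr1; have := ler_normD (f z - f (@origin R n)) (f (@origin R n)).
  by rewrite subrK; lra.
have [r [K [r0 K0 h]]] : exists r K : R, [/\ 0 < r, 0 <= K & forall d z, polydisc (@origin R n) r z ->
    `|pd d f z - \sum_(k < N) dsum k (pd d f) (dirc z) / k`!%:R| <= K * l1 z ^+ N].
  apply: uniform_radius_bound => [d r r' K K' h r'r KK' z hz|d].
    apply: (le_trans (h z (polydisc_le r'r hz))).
    by rewrite ler_wpM2r // exprn_ge0 // l1_ge0.
  by have [r [K [r0 _ h]]] := IH (pd d f) (smooth_pd d sf); exists r, K.
exists (Num.min r e), (2%:R * K); split; [by rewrite lt_min r0 | exact: mulr_ge0 |] => z hz.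
have hzr : polydisc (@origin R n) r z by apply: polydisc_le hz; rewrite ge_min lexx.
have hze : polydisc (@origin R n) e z by apply: polydisc_le hz; rewrite ge_min lexx orbT.
pose c k := dsum k f (dirc z) / k`!%:R.
pose phi (t : R) := f (smul t z) - \sum_(k < N.+1) t ^+ k * c k.
pose dphi (t : R) := \sum_d dirc z d * pd d f (smul t z) - \sum_(k < N) k.+1%:R * t ^+ k * c k.+1.
have [|t ht e1] := @mvt_sym R phi dphi 1.
  move=> t; rewrite normr1 => ht; apply: is_deriveB; last exact: poly_derive.
  exact: line_derive sf (polydisc_smul ht hze).
rewrite normr1 in ht; rewrite mulr1 in e1.
have s1 : smul 1 z = z by apply/funext => k; rewrite /smul ofr1 mul1r.
have s00 : smul 0 z = @origin R n by apply/funext => k; rewrite /smul ofr0 mul0r.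
have phi0 : phi 0 = 0.
  rewrite /phi s00 big_ord_recl /= expr0 mul1r big1 ?addr0.
    by rewrite /c /= fact0 divr1 subrr.
  by move=> i _; rewrite expr0n /= mul0r.
have -> : f z - \sum_(k < N.+1) dsum k f (dirc z) / k`!%:R = dphi t.
  rewrite -e1 phi0 subr0 /phi s1; congr (_ - _).
  by apply: eq_bigr => k _; rewrite expr1n mul1r.
have -> : dphi t = \sum_d dirc z d * (pd d f (smul t z) -
    \sum_(k < N) dsum k (pd d f) (dirc (smul t z)) / k`!%:R).
  rewrite /dphi.
  have -> : \sum_(k < N) k.+1%:R * t ^+ k * c k.+1 =
     \sum_d \sum_(k < N) dirc z d * (dsum k (pd d f) (dirc (smul t z)) / k`!%:R).
    rewrite exchange_big /=; apply: eq_bigr => k _; rewrite /c /= factS natrM invfM.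
    have k0 : (k`!%:R : R) != 0 by rewrite pnatr_eq0 -lt0n fact_gt0.
    have k1 : (k.+1%:R : R) != 0 by rewrite pnatr_eq0.
    have -> : k.+1%:R * t ^+ k * ((\sum_d dirc z d * dsum k (pd d f) (dirc z)) * (k.+1%:R^-1 / k`!%:R)) =
      t ^+ k / k`!%:R * \sum_d dirc z d * dsum k (pd d f) (dirc z).
      by move: (k.+1%:R : R) k1 => u u0; field; rewrite k0 u0.
    rewrite mulr_sumr; apply: eq_bigr => d _.
    rewrite (_ : dirc (smul t z) = fun d => t * dirc z d) ?dsum_hom; first by ring.
    by apply/funext => d'; rewrite dirc_smul.
  rewrite -sumrB; apply: eq_bigr => d _; rewrite mulrBr; congr (_ - _).
  by rewrite mulr_sumr.
apply: (le_trans (ler_norm_sum _ _ _)).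
apply: (@le_trans _ _ (\sum_d `|dirc z d| * (K * l1 z ^+ N))).
  apply: ler_sum => d _; rewrite normrM ler_wpM2l //.
  apply: (le_trans (h d _ (polydisc_smul ht hzr))); rewrite ler_wpM2l //.
  by rewrite lerXn2r ?nnegrE ?l1_ge0 // l1_smul.
rewrite -mulr_suml exprS.
have -> : 2%:R * K * (l1 z * l1 z ^+ N) = 2%:R * l1 z * (K * l1 z ^+ N) by ring.
by rewrite ler_wpM2r ?sum_dirc // mulr_ge0 // exprn_ge0 // l1_ge0.
Qed.

End RealTaylor.

(** * Taylor expansion in the coordinates and their conjugates *)

Section TaylorCoefficients.
Variables (R : realType) (n : nat).
Local Notation C := (R[i]).
Local Notation abs := (@cabs R).
Local Notation pt := (pt R n).
Local Notation dir := (dir n).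
Local Notation O := (@origin R n).
Implicit Types (f : pt -> R) (z q : pt) (d : dir).

#[local] Opaque pd.

Definition wcoord z (o : dir) : C := if o.2 then (z o.1)^*%C else z o.1.

Lemma complex_split (w : C) : w = ofr (complex.Re w) + ii R * ofr (complex.Im w).
Proof.
by case: w => a b; apply/eqP; rewrite eq_complex /= !(mul0r, mul1r, subr0, addr0, add0r) !eqxx.
Qed.

Lemma conj_split (w : C) : (w^*)%C = ofr (complex.Re w) - ii R * ofr (complex.Im w).
Proof.
by case: w => a b; apply/eqP; rewrite eq_complex /= !(mul0r, mul1r, subr0, addr0, add0r, oppr0) !eqxx.
Qed.

(** This is [x d/dx + y d/dy = conj z d/d(conj z) + z d/dz], with [F] and [T] the derivatives in [x]
    and [y]. *)
Lemma wirtinger_pair (F T x y : C) : y * T + x * F =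
  (x - ii R * y) * ((F + ii R * T) / 2%:R) + (x + ii R * y) * ((F + - ii R * T) / 2%:R).
Proof.
have -> : (x - ii R * y) * ((F + ii R * T) / 2%:R) + (x + ii R * y) * ((F + - ii R * T) / 2%:R) =
  x * F - ii R * ii R * (y * T) by field.
by rewrite ii2; ring.
Qed.

Lemma wirt_chain z os f p :
  \sum_d ofr (dirc z d) * wirt os (pd d f) p = \sum_o wcoord z o * wirt (o :: os) f p.
Proof.
rewrite -(pair_bigA _ (fun j b => ofr (dirc z (j, b)) * wirt os (pd (j, b) f) p)).
rewrite -(pair_bigA _ (fun j b => wcoord z (j, b) * wirt ((j, b) :: os) f p)) /=.
apply: eq_bigr => j _; rewrite !big_bool /wcoord /dirc /=.
have := wirtinger_pair (wirt os (pd (j, false) f) p) (wirt os (pd (j, true) f) p)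
  (ofr (complex.Re (z j))) (ofr (complex.Im (z j))).
by rewrite -conj_split -complex_split.
Qed.

Section Box.
Variable K : nat.
(** A pair of multi-indices with entries at most [K] becomes a single function on [dir], with
    [(j, true)] for the exponent of the conjugate, so that sums over such pairs range over a finite
    type. *)
Local Notation mindex := {ffun dir -> 'I_K.+1}.
Implicit Types (m : mindex) (o : dir).

Definition index_part m (b : bool) : multi_index n := [ffun j => nat_of_ord (m (j, b))].
Definition mwirt f m : C := wirt (wword (index_part m false) (index_part m true)) f O.
Definition msize m : nat := \sum_(d : dir) m d.
Definition mfact m : nat := \prod_(d : dir) (m d)`!.
Definition mpow z m : C := \prod_(o : dir) wcoord z o ^+ m o.
(** At the edge of the box [inord] falls back to 0, hence the condition [m o < K] in the lemmas on
    [minc]; it holds for every index of size below [K]. *)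
Definition minc o m : mindex := [ffun d => if d == o then inord (m d).+1 else m d].
Definition mdec o m : mindex := [ffun d => if d == o then inord (m d).-1 else m d].

Lemma count_wword (a b : multi_index n) d : count_mem d (wword a b) = if d.2 then b d.1 else a d.1.
Proof.
case: d => j c; rewrite /wword count_flatten -map_comp sumnE big_map big_enum /=.
rewrite (bigD1 j) //= big1 ?addn0 => [|i ij].
  rewrite count_cat !count_nseq /= !xpair_eqE eqxx /=.
  by case: c; rewrite ?mul0n ?mul1n ?addn0 ?add0n.
by rewrite count_cat !count_nseq /= !xpair_eqE (negbTE ij).
Qed.

Lemma count_component m d : count_mem d (wword (index_part m false) (index_part m true)) = m d.
Proof. by rewrite count_wword; case: d => j [] /=; rewrite ffunE. Qed.

Lemma minc_val o m d : (m o < K)%N -> minc o m d = ((d == o) + m d)%N :> nat.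
Proof.
move=> h; rewrite ffunE; case: eqVneq => [->|_] //.
by rewrite inordK.
Qed.

Lemma mwirt_cons f e o m : 0 < e -> smooth_on (polydisc O e) f -> (m o < K)%N ->
  wirt (o :: wword (index_part m false) (index_part m true)) f O = mwirt f (minc o m).
Proof.
move=> e0 sf mo; apply: (wirt_perm sf (polydisc_id O e0)).
apply/allP => d _ /=; rewrite -!/(count_mem d _) !count_component minc_val //.
by rewrite (eq_sym o d).
Qed.

Lemma minc_size o m : (m o < K)%N -> msize (minc o m) = (msize m).+1.
Proof.
move=> mo; rewrite /msize (eq_bigr (fun d => (d == o) + m d)%N) => [|d _]; last exact: minc_val.
rewrite big_split /= (bigD1 o) //= eqxx big1 ?addn0 ?add1n // => i /negbTE -> //.
Qed.

Lemma minc_pow z o m : (m o < K)%N -> mpow z (minc o m) = wcoord z o * mpow z m.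
Proof.
move=> mo; rewrite /mpow (bigD1 o) //= [in RHS](bigD1 o) //= minc_val // eqxx add1n exprS mulrA.
by congr (_ * _); apply: eq_bigr => d /negbTE h; rewrite minc_val // h.
Qed.

Lemma minc_fact o m : (m o < K)%N -> mfact (minc o m) = ((m o).+1 * mfact m)%N.
Proof.
move=> mo; rewrite /mfact (bigD1 o) //= [in RHS](bigD1 o) //= minc_val // eqxx add1n factS mulnA.
by congr (_ * _)%N; apply: eq_bigr => d /negbTE h; rewrite minc_val // h.
Qed.

Lemma msize_ge m o : (m o <= msize m)%N.
Proof. by rewrite /msize (bigD1 o) //= leq_addr. Qed.

Lemma mdecK o m : (0 < m o)%N -> minc o (mdec o m) = m.
Proof.
move=> mo; apply/ffunP => d; rewrite !ffunE; case: eqVneq => [->|//].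
have h : ((m o).-1 < K.+1)%N by rewrite (leq_ltn_trans (leq_pred _)).
by apply/val_inj; rewrite /= (inordK h) prednK // inordK.
Qed.

Lemma mincK o m : (m o < K)%N -> mdec o (minc o m) = m.
Proof.
move=> mo; apply/ffunP => d; rewrite ffunE; case: eqVneq => [->|ne].
  apply/val_inj; rewrite /= inordK minc_val // eqxx add1n //=.
by rewrite ffunE (negbTE ne).
Qed.

Lemma mfact_gt0 m : (0 < mfact m)%N.
Proof. by rewrite prodn_gt0 // => d; exact: fact_gt0. Qed.

Lemma sum_minc (F : mindex -> C) k o : (k < K)%N ->
  \sum_(m | msize m == k) F (minc o m) = \sum_(m | (msize m == k.+1) && (0 < m o)%N) F m.
Proof.
move=> kK; rewrite [RHS](reindex_onto (minc o) (mdec o)) /=; last by move=> m /andP[_ /mdecK].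
apply: eq_bigl => m; apply/idP/idP => [/eqP mk|/andP[/andP[h1 h2] _]].
  have mo : (m o < K)%N by rewrite -mk in kK; exact: leq_ltn_trans (msize_ge m o) kK.
  by rewrite minc_size // mk eqxx minc_val // eqxx mincK // eqxx.
(* If [m o = K], the increment overflows to 0, against the positivity of the entry at [o]. *)
have mo : (m o < K)%N.
  rewrite ltn_neqAle -ltnS ltn_ord andbT; apply/eqP => mK.
  move: h2; rewrite ffunE eqxx mK /inord /insubd insubN //.
  by rewrite -leqNgt.
by move: h1; rewrite minc_size // eqSS.
Qed.

Lemma natrC_neq0 k : (0 < k)%N -> (k%:R : C) != 0.
Proof. by rewrite -cabs_gt0 cabs_nat ltr0n. Qed.

(** The multinomial theorem for differential operators. In the inductive step an index [m] of size
    [k + 1] is reached from each letter [o] with multiplicity [m o]; these add up to [k + 1] and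
    turn [k!] into [(k + 1)!]. *)
Lemma dsum_coef k f e z : (k <= K)%N -> 0 < e -> smooth_on (polydisc O e) f ->
  ofr (dsum k f (dirc z)) =
  k`!%:R * \sum_(m | msize m == k) mwirt f m / (mfact m)%:R * mpow z m.
Proof.
move=> + e0; elim: k f => [|k IH] f kK sf /=.
  rewrite (big_pred1 [ffun _ => ord0]) => [|m]; last first.
    apply/idP/eqP => [|->]; last by rewrite /msize big1 // => d _; rewrite ffunE.
    rewrite sum_nat_eq0 => /forallP h; apply/ffunP => d; apply/val_inj; rewrite ffunE /=.
    exact/eqP/(implyP (h d)).
  rewrite /mwirt (_ : wword _ _ = [::]); last first.
    apply/nilP; rewrite /nilp size_flatten /shape -map_comp sumnE big_map big1 // => j _.
    by rewrite /= size_cat !size_nseq !ffunE.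
  rewrite /mpow /mfact !big1 => [|d _|d _]; rewrite ?ffunE ?expr0 ?fact0 //.
  by rewrite divr1 mulr1 mul1r.
have -> : ofr (\sum_d dirc z d * dsum k (pd d f) (dirc z)) =
    \sum_d ofr (dirc z d) * ofr (dsum k (pd d f) (dirc z)).
  by elim/big_rec2: _ => [//|d x y _ <-]; rewrite ofrD ofrM.
have -> : \sum_d ofr (dirc z d) * ofr (dsum k (pd d f) (dirc z)) = k`!%:R *
   \sum_(m | msize m == k) mpow z m / (mfact m)%:R * \sum_d ofr (dirc z d) * mwirt (pd d f) m.
  rewrite (eq_bigr (fun m => \sum_d mpow z m / (mfact m)%:R * (ofr (dirc z d) * mwirt (pd d f) m)));
    last by move=> m _; rewrite mulr_sumr.
  rewrite exchange_big mulr_sumr; apply: eq_bigr => d _ /=.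
  rewrite IH ?(ltnW kK) //; last exact: smooth_pd.
  by rewrite mulrCA !mulr_sumr; apply: eq_bigr => m _; ring.
rewrite factS mulnC natrM -mulrA; congr (_ * _).
rewrite (eq_bigr (fun m => \sum_o mpow z (minc o m) / (mfact (minc o m))%:R *
   ((minc o m o)%:R * mwirt f (minc o m)))) => [|m /eqP mk]; last first.
  rewrite wirt_chain mulr_sumr; apply: eq_bigr => o _.
  have mo : (m o < K)%N by rewrite -mk in kK; exact: leq_ltn_trans (msize_ge m o) kK.
  rewrite (mwirt_cons e0 sf mo) minc_pow // minc_fact // minc_val // eqxx add1n natrM.
  have a0 := natrC_neq0 (ltn0Sn (m o)); have b0 := natrC_neq0 (mfact_gt0 m).
  move: (_.+1%:R : C) (mfact m)%:R a0 b0 => u v u0 v0.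
  by field; rewrite u0 v0.
rewrite exchange_big /= (eq_bigr (fun o => \sum_(m | msize m == k.+1) mpow z m / (mfact m)%:R *
   ((m o)%:R * mwirt f m))) => [|o _]; last first.
  rewrite (sum_minc (fun m => mpow z m / (mfact m)%:R * ((m o)%:R * mwirt f m))) //.
  rewrite [RHS](bigID (fun m : mindex => 0 < m o)%N) /= [X in _ + X]big1 ?addr0 // => m /andP[_].
  by rewrite lt0n negbK => /eqP ->; rewrite mul0r mulr0.
rewrite exchange_big mulr_sumr; apply: eq_bigr => m /eqP mk.
rewrite -mk /msize natr_sum mulr_suml; apply: eq_bigr => o _; ring.
Qed.

Lemma coef_component f m : coef f (index_part m false) (index_part m true) = mwirt f m / (mfact m)%:R.
Proof.
rewrite /coef /mwirt; congr (_ / _%:R).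
rewrite /mfact (eq_bigr (fun d : dir => (m (d.1, d.2))`!)) => [|[] //].
rewrite -(pair_bigA _ (fun j b => (m (j, b))`!)) /=; apply: eq_bigr => j _.
by rewrite big_bool mulnC !ffunE.
Qed.

Lemma monom_component z m : monom (index_part m false) (index_part m true) z = mpow z m.
Proof.
rewrite /monom /mpow [RHS](eq_bigr (fun d : dir => wcoord z (d.1, d.2) ^+ m (d.1, d.2))) => [|[] //].
rewrite -(pair_bigA _ (fun j b => wcoord z (j, b) ^+ m (j, b))) /=.
by apply: eq_bigr => j _; rewrite big_bool mulrC !ffunE.
Qed.
End Box.

Lemma taylor_coef N f e : 0 < e -> smooth_on (polydisc O e) f ->
  exists r K : R, [/\ 0 < r, 0 <= K & forall z, polydisc O r z ->
    abs (ofr (f z) - \sum_(m : {ffun dir -> 'I_N.+1} | (msize m < N)%N)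
      coef f (index_part m false) (index_part m true) *
      monom (index_part m false) (index_part m true) z) <= K * l1 z ^+ N].
Proof.
move=> e0 sf; have [r [K [r0 K0 h]]] := taylor_real N e0 sf; exists r, K; split => // z /h.
rewrite -cabs_ofr ofrB; congr (abs (_ - _) <= _).
have -> : ofr (\sum_(k < N) dsum k f (dirc z) / k`!%:R) =
    \sum_(k < N) ofr (dsum k f (dirc z) / k`!%:R).
  by elim/big_rec2: _ => [//|d x y _ <-]; rewrite ofrD.
rewrite (eq_bigr (fun k : 'I_N => \sum_(m : {ffun dir -> 'I_N.+1})
  if msize m == k then mwirt f m / (mfact m)%:R * mpow z m else 0)) => [|k _]; last first.
  rewrite ofrM ofrV ofr_nat (@dsum_coef N k _ e) ?(ltnW (ltn_ord k)) //.
  by rewrite mulrAC mulfV ?natrC_neq0 ?fact_gt0 // mul1r big_mkcond.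
rewrite exchange_big [RHS]big_mkcond /=; apply: eq_bigr => m _.
rewrite coef_component monom_component; case: ltnP => mN.
  by rewrite (bigD1 (Ordinal mN)) //= eqxx big1 ?addr0 // => k /negbTE; rewrite -val_eqE /= eq_sym => ->.
by rewrite big1 // => k _; case: eqP => // mk; move: mN; rewrite mk leqNgt ltn_ord.
Qed.



End TaylorCoefficients.

(** * Newton polyhedra and leading asymptotics *)

Section NewtonFaces.
Variables (R : realType) (n : nat).
Local Notation C := (R[i]).
Local Notation pt := (pt R n).
Local Notation mi := (multi_index n).

Definition weight (a : 'I_n -> nat) (g : mi) : nat := \sum_j a j * g j.
Definition weight_row (a : 'I_n -> nat) : 'rV[R]_n := \row_j (a j)%:R.

Lemma wdot_embed a g : wdot (weight_row a) (@embed R n g) = (weight a g)%:R.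
Proof.
by rewrite /wdot /weight natr_sum; apply: eq_bigr => j _; rewrite !mxE natrM.
Qed.

Lemma wdot_sum a I (r : seq I) (lam : I -> R) (x : I -> 'rV[R]_n) :
  wdot a (\sum_(i <- r) lam i *: x i) = \sum_(i <- r) lam i * wdot a (x i).
Proof.
rewrite /wdot (eq_bigr (fun j => \sum_(i <- r) lam i * (a 0 j * x i 0 j))) => [|j _]; last first.
  by rewrite summxE mulr_sumr; apply: eq_bigr => i _; rewrite mxE; ring.
by rewrite exchange_big; apply: eq_bigr => i _; rewrite mulr_sumr.
Qed.

Lemma newton_embed (f : pt -> R) g : Ssupp f g -> Newton_plus f (embed R g).
Proof.
move=> Sg; exists 1%N, (fun=> 1), (fun=> embed R g); split => //.
- by rewrite big_ord_recr big_ord0 /= add0r.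
- by move=> _; exists g.
- by rewrite big_ord_recr big_ord0 /= add0r scale1r.
Qed.

Lemma sum_coord_continuous (m : nat) (v : 'I_m -> R) :
  continuous (fun x : 'rV[R]_m => \sum_i x ord0 i * v i).
Proof.
elim: (index_enum _) => [|i r IH].
  rewrite (_ : (fun x : 'rV[R]_m => _) = fun=> 0); last by apply/funext => y; rewrite big_nil.
  exact: cst_continuous.
rewrite (_ : (fun x : 'rV[R]_m => _) = fun x : 'rV[R]_m => x ord0 i * v i + \sum_(i <- r) x ord0 i * v i);
  last by apply/funext => y; rewrite big_cons.
move=> x; apply: cvgD (IH x); apply: cvgM; last exact: cvg_cst.
exact: coord_continuous.
Qed.

Lemma sum_vec_continuous (m : nat) (v : 'I_m -> 'rV[R]_n) :
  continuous (fun x : 'rV[R]_m => \sum_i x ord0 i *: v i).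
Proof.
elim: (index_enum _) => [|i r IH].
  rewrite (_ : (fun x : 'rV[R]_m => _) = fun=> 0); last by apply/funext => y; rewrite big_nil.
  exact: cst_continuous.
rewrite (_ : (fun x : 'rV[R]_m => _) = fun x : 'rV[R]_m => x ord0 i *: v i + \sum_(i <- r) x ord0 i *: v i);
  last by apply/funext => y; rewrite big_cons.
move=> x; apply: cvgD (IH x); apply: cvgZ; last exact: cvg_cst.
exact: coord_continuous.
Qed.

Definition simplex (m : nat) (P : 'I_m -> bool) : set 'rV[R]_m :=
  [set x | [/\ forall i, 0 <= x ord0 i, \sum_i x ord0 i = 1 & forall i, ~~ P i -> x ord0 i = 0]].

Lemma compact_simplex m P : compact (@simplex m P).
Proof.
pose A (i : 'I_m) : set R := if P i then `[0, 1]%classic else [set 0].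
have cA : compact [set v : 'rV[R]_m | forall i, A i (v ord0 i)].
  apply: rV_compact => i; rewrite /A; case: (P i); [exact: segment_compact | exact: compact_set1].
pose S (x : 'rV[R]_m) := \sum_i x ord0 i * 1.
have cS : continuous S by exact: sum_coord_continuous.
have SE x : S x = \sum_i x ord0 i by apply: eq_bigr => i _; rewrite mulr1.
have -> : simplex P = [set v : 'rV[R]_m | forall i, A i (v ord0 i)] `&`
    (S @^-1` [set y | y <= 1] `&` S @^-1` [set y | 1 <= y]).
  apply/seteqP; split => [x [x0 x1 xP]|x [xA [/= x1 x2]]].
    split; last by split; rewrite /= SE x1.
    move=> i; rewrite /A; case: ifP => [_|/negbT/xP //].
    rewrite /= in_itv /= x0 -x1 (bigD1 i) //= lerDl sumr_ge0 // => j _; exact: x0.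
  have xi i : 0 <= x ord0 i /\ (~~ P i -> x ord0 i = 0).
    move: (xA i); rewrite /A; case: (P i) => /=; last by move=> ->.
    by rewrite in_itv /= => /andP[].
  split => [i||i]; [exact: (xi i).1 | | exact: (xi i).2].
  by rewrite -SE; apply/eqP; rewrite eq_le x1 x2.
have cl : closed (S @^-1` [set y | y <= 1] `&` S @^-1` [set y | 1 <= y]).
  by apply: closedI; apply: preimage_closed => [x _|]; [exact: cS | exact: closed_le |
    exact: cS | exact: closed_ge].
have clA := compact_closed (@norm_hausdorff _ _) cA.
apply: (subclosed_compact _ cA) => [|x []//]; exact: closedI.
Qed.

Variables (f : pt -> R) (a : 'I_n -> nat) (l : nat).
Hypothesis a0 : forall j, (0 < a j)%N.
Hypothesis lmin : forall g, Ssupp f g -> (l <= weight a g)%N.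
Hypothesis lex : exists2 g, Ssupp f g & weight a g = l.

Lemma wdot_ge (x : 'rV[R]_n) g : (forall j, embed R g 0 j <= x 0 j) ->
  (weight a g)%:R <= wdot (weight_row a) x.
Proof. by move=> h; rewrite -wdot_embed; apply: ler_sum => j _; rewrite ler_wpM2l // mxE. Qed.

Lemma newton_ge xi : Newton_plus f xi -> l%:R <= wdot (weight_row a) xi.
Proof.
move=> [m [lam [x [lam0 lam1 hx ->]]]]; have -> : (l%:R : R) = \sum_i lam i * l%:R by rewrite -mulr_suml lam1 mul1r.
rewrite wdot_sum; apply: ler_sum => i _; rewrite ler_wpM2l //; have [g Sg /wdot_ge h] := hx i.
by apply: le_trans h; rewrite ler_nat lmin.
Qed.

Definition weight_face : set 'rV[R]_n :=
  [set xi | Newton_plus f xi /\ wdot (weight_row a) xi = l%:R].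

Lemma weight_entry (g : mi) j : (g j <= weight a g)%N.
Proof.
rewrite /weight (bigD1 j) //=; apply: leq_trans (leq_addr _ _).
by rewrite leq_pmull.
Qed.

Local Notation T := {ffun 'I_n -> 'I_l.+1}.
Definition lift_index (t : T) : mi := [ffun j => nat_of_ord (t j)].
Let P (i : 'I_#|T|) := `[< Ssupp f (lift_index (enum_val i)) /\ weight a (lift_index (enum_val i)) = l >].

Lemma index_of (g : mi) : weight a g = l -> exists i : 'I_#|T|, lift_index (enum_val i) = g.
Proof.
move=> gl; exists (enum_rank ([ffun j => inord (g j)] : T)); rewrite enum_rankK.
by apply/ffunP => j; rewrite !ffunE inordK // ltnS -gl weight_entry.
Qed.

(* As the weights are positive, only finitely many lattice points have weight [l]. *)
Lemma weight_face_image : weight_face =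
  (fun x : 'rV[R]_#|T| => \sum_i x ord0 i *: embed R (lift_index (enum_val i))) @` simplex P.
Proof.
apply/seteqP; split => [_ [[m [lam [x [lam0 lam1 hx ->]]]] hl]|_ [x [x0 x1 xP] <-]].
  (* As the average of the weights of the [x i] equals their lower bound [l], each [x i] with
     [lam i != 0] has weight exactly [l]; then no coordinate of it can exceed that of the support
     point below it, and [x i] is that point. *)
  have [G hG] : {G : 'I_m -> 'I_#|T| & forall i, lam i != 0 ->
      P (G i) /\ x i = embed R (lift_index (enum_val (G i)))}.
    apply: (@choice _ _ (fun i k => lam i != 0 ->
      P k /\ x i = embed R (lift_index (enum_val k)))) => i.
    have [g Sg hg] := hx i.
    have [li|li] := eqVneq (lam i) 0.
      by have [g0 _ /index_of[k _]] := lex; exists k.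
    have hi : wdot (weight_row a) (x i) = l%:R.
      apply/eqP; rewrite eq_le andbC; apply/andP; split.
        by apply: le_trans (wdot_ge hg); rewrite ler_nat lmin.
      rewrite leNgt; apply/negP => hlt.
      have : l%:R < wdot (weight_row a) (\sum_i lam i *: x i).
        have -> : (l%:R : R) = \sum_i lam i * l%:R by rewrite -mulr_suml lam1 mul1r.
        rewrite wdot_sum.
        rewrite (bigD1 i) //= [X in _ < X](bigD1 i) //=; apply: ltr_leD.
          by rewrite ltr_pM2l // lt_def li lam0.
        apply: ler_sum => k _; rewrite ler_wpM2l //; have [g' Sg' /wdot_ge h] := hx k.
        by apply: le_trans h; rewrite ler_nat lmin.
      by rewrite hl ltxx.
    have gl : weight a g = l.
      apply/eqP; rewrite eqn_leq (lmin Sg) andbT -(ler_nat R) -hi; exact: wdot_ge.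
    have [k hk] := index_of gl; exists k => _; split.
      by apply/asboolP; rewrite hk.
    rewrite hk; apply/rowP => j; apply/eqP; rewrite eq_le hg andbT leNgt; apply/negP => hlt.
    have : wdot (weight_row a) (embed R g) < wdot (weight_row a) (x i).
      rewrite /wdot (bigD1 j) //= [X in _ < X](bigD1 j) //=; apply: ltr_leD.
        by rewrite ltr_pM2l // mxE ltr0n.
      by apply: ler_sum => k' _; rewrite ler_wpM2l // mxE.
    by rewrite wdot_embed gl hi ltxx.
  (* Several [x i] may be the same lattice point; their coefficients are added. *)
  pose L : 'rV[R]_#|T| := \row_k \sum_(i | G i == k) lam i.
  exists L; first split.
  - by move=> k; rewrite mxE sumr_ge0.
  - rewrite -lam1 [RHS](partition_big G predT) //=; apply: eq_bigr => k _; by rewrite mxE.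
  - move=> k Pk; rewrite mxE big1 // => i /eqP Gi.
    have [//|/hG[+ _]] := eqVneq (lam i) 0; by rewrite Gi (negbTE Pk).
  rewrite [RHS](partition_big G predT) //=; apply: eq_bigr => k _.
  rewrite mxE scaler_suml; apply: eq_bigr => i /eqP Gi.
  have [->|/hG[_ ->]] := eqVneq (lam i) 0; by rewrite ?scale0r // Gi.
have [g0 Sg0 g0l] := lex.
(* [Newton_plus] wants a support point under every vector, even one with coefficient 0; [g0] fills
   these places. *)
pose y (i : 'I_#|T|) := if P i then embed R (lift_index (enum_val i)) else embed R g0.
have -> : \sum_i x ord0 i *: embed R (lift_index (enum_val i)) = \sum_i x ord0 i *: y i.
  by apply: eq_bigr => i _; rewrite /y; case: ifP => // /negbT/xP ->; rewrite !scale0r.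
split.
  exists #|T|, (fun i => x ord0 i), y; split => // i; rewrite /y; case: ifP => [/asboolP[Sg _]|_].
    by exists (lift_index (enum_val i)).
  by exists g0.
have -> : (l%:R : R) = \sum_i x ord0 i * l%:R by rewrite -mulr_suml x1 mul1r.
rewrite wdot_sum; apply: eq_bigr => i _; congr (_ * _).
by rewrite /y; case: ifP => [/asboolP[_ h]|_]; rewrite wdot_embed ?h ?g0l.
Qed.

Lemma weight_face_compact : compact_face f weight_face.
Proof.
split.
  exists (weight_row a), l%:R; split => //; first exact: newton_ge.
  have [g Sg gl] := lex; exists (embed R g); split; first exact: newton_embed.
  by rewrite wdot_embed gl.
rewrite weight_face_image; apply: continuous_compact; last exact: compact_simplex.
apply: continuous_subspaceT; exact: sum_vec_continuous.
Qed.

Section FaceSum.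
Variable N : nat.
Hypothesis lN : (l <= N)%N.
Local Notation mindex := {ffun dir n -> 'I_N.+1}.

Definition mweight (m : mindex) : nat := weight a (madd (index_part m false) (index_part m true)).

(** Positive weights confine the pairs of weight [l] to the box. A pair of weight [l] that is not on
    the face lies outside the polyhedron, so its coefficient is 0 and including it is harmless. *)
Lemma Fpart_box z : Fpart f weight_face z = \sum_(m : mindex | mweight m == l)
  coef f (index_part m false) (index_part m true) * monom (index_part m false) (index_part m true) z.
Proof.
pose h (m : mindex) : mi * mi := (index_part m false, index_part m true).
have hinj : injective h.
  move=> m m' [e1 e2]; apply/ffunP => -[j b]; apply/val_inj => /=.
  by case: b; [have := congr1 (fun g : mi => g j) e2 | have := congr1 (fun g : mi => g j) e1];
    rewrite !ffunE.
have SuppE ab : coef f ab.1 ab.2 != 0 -> Ssupp f (madd ab.1 ab.2) by move=> c0; exists ab.1, ab.2.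
rewrite /Fpart (fsbig_widen _ (h @` [set m | mweight m == l])); first last.
- move=> _ [[m /= /eqP ml <-] /= nk]; apply/eqP; rewrite mulf_eq0; apply/orP; left.
  apply/negPn/negP => c0; apply: nk; split.
    exact: newton_embed (SuppE (index_part m false, index_part m true) c0).
  by rewrite wdot_embed -ml.
- move=> [u v] /= [_]; rewrite wdot_embed => /eqP; rewrite eqr_nat => /eqP ul.
  have bnd j : (u j + v j <= N)%N.
    by apply: leq_trans lN; have := weight_entry (madd u v) j; rewrite ul ffunE.
  pose m : mindex := [ffun d => inord (if d.2 then v d.1 else u d.1)].
  have hm : h m = (u, v).
    congr (_, _); apply/ffunP => j; rewrite !ffunE /= inordK // ltnS (leq_trans _ (bnd j)) //.
      exact: leq_addr.
    exact: leq_addl.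
  exists m => //=; rewrite /mweight; case: hm => -> ->; exact/eqP.
rewrite fsbig_image; last by move=> m m' _ _; exact: hinj.
rewrite -(bigfs _ _ (r := index_enum _)) ?index_enum_uniq // => m _.
by rewrite mem_index_enum.
Qed.
End FaceSum.

End NewtonFaces.

(** * Leading asymptotics along a ray *)

Section Asymptotics.
Variables (R : realType) (n : nat).
Local Notation C := (R[i]).
Local Notation abs := (@cabs R).
Local Notation pt := (pt R n).
Local Notation dir := (dir n).
Local Notation O := (@origin R n).

Definition bigO k (u : R -> C) := exists K d : R, [/\ 0 <= K, 0 < d &
  forall s, 0 < s < d -> abs (u s) <= K * s ^+ k].

Lemma bigOD k u v : bigO k u -> bigO k v -> bigO k (fun s => u s + v s).
Proof.
move=> [K [d [K0 d0 h]]] [K' [d' [K'0 d'0 h']]].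
exists (K + K'), (Num.min d d'); split; [exact: addr_ge0 | by rewrite lt_min d0 |].
move=> s /andP[s0]; rewrite lt_min => /andP[sd sd'].
apply: (le_trans (ler_cabsD _ _)); rewrite mulrDl; apply: lerD.
  by apply: h; rewrite s0.
by apply: h'; rewrite s0.
Qed.

Lemma bigOM k k' u v : bigO k u -> bigO k' v -> bigO (k + k') (fun s => u s * v s).
Proof.
move=> [K [d [K0 d0 h]]] [K' [d' [K'0 d'0 h']]].
exists (K * K'), (Num.min d d'); split; [exact: mulr_ge0 | by rewrite lt_min d0 |].
move=> s /andP[s0]; rewrite lt_min => /andP[sd sd'].
rewrite cabsM exprD mulrACA; apply: ler_pM; rewrite ?cabs_ge0 //.
  by apply: h; rewrite s0.
by apply: h'; rewrite s0.
Qed.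

Lemma bigO_le k k' u : (k' <= k)%N -> bigO k u -> bigO k' u.
Proof.
move=> kk [K [d [K0 d0 h]]]; exists K, (Num.min d 1); split; [by [] | by rewrite lt_min d0 ltr01 |].
move=> s /andP[s0]; rewrite lt_min => /andP[sd s1].
apply: (le_trans (h s _)); first by rewrite s0.
by rewrite ler_wpM2l // ler_wiXn2l // ltW.
Qed.

Lemma bigO_cst c : bigO 0 (fun=> c).
Proof.
by exists (abs c), 1; split; rewrite ?cabs_ge0 // => s _; rewrite expr0 mulr1.
Qed.

Lemma bigO_scale k c u : bigO k u -> bigO k (fun s => c * u s).
Proof. exact: bigOM (bigO_cst c). Qed.

Lemma bigO_conj k u : bigO k u -> bigO k (fun s => (u s)^*%C).
Proof. by move=> [K [d [K0 d0 h]]]; exists K, d; split => // s; rewrite cabs_conj; exact: h. Qed.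

Lemma bigO_ext k u v : u =1 v -> bigO k u -> bigO k v.
Proof. by move=> /funext ->. Qed.

Lemma bigO_zero k : bigO k (fun=> 0).
Proof. by exists 0, 1; split => // s _; rewrite cabs0 mul0r. Qed.

Lemma bigO_sum k I (r : seq I) (P : pred I) (u : I -> R -> C) :
  (forall i, P i -> bigO k (u i)) -> bigO k (fun s => \sum_(i <- r | P i) u i s).
Proof.
move=> h; elim: r => [|i r IH].
  by apply: (bigO_ext _ (bigO_zero k)) => s; rewrite big_nil.
have [Pi|nPi] := boolP (P i); last first.
  by apply: (bigO_ext _ IH) => s; rewrite big_cons (negbTE nPi).
by apply: (bigO_ext _ (bigOD (h i Pi) IH)) => s; rewrite big_cons Pi.
Qed.

Lemma bigO_X k m u : bigO k u -> bigO (k * m) (fun s => u s ^+ m).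
Proof.
move=> h; elim: m => [|m IH]; first by rewrite muln0; exact: bigO_cst.
by rewrite mulnS; apply: (bigO_ext _ (bigOM h IH)) => s; rewrite exprS.
Qed.

Lemma bigO_prod I (r : seq I) (k : I -> nat) (u : I -> R -> C) :
  (forall i, bigO (k i) (u i)) -> bigO (\sum_(i <- r) k i) (fun s => \prod_(i <- r) u i s).
Proof.
move=> h; elim: r => [|i r IH].
  by rewrite big_nil; apply: (bigO_ext _ (bigO_cst 1)) => s; rewrite big_nil.
by rewrite big_cons; apply: (bigO_ext _ (bigOM (h i) IH)) => s; rewrite big_cons.
Qed.

(** Agreement of the leading terms of order [k]; carrying the two size bounds along makes the
    relation stable under products. *)
Definition approx k (u v : R -> C) := [/\ bigO k u, bigO k v & bigO k.+1 (fun s => u s - v s)].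

Lemma approxM k k' u v u' v' : approx k u v -> approx k' u' v' ->
  approx (k + k') (fun s => u s * u' s) (fun s => v s * v' s).
Proof.
move=> [h1 h2 h3] [h1' h2' h3']; split; [exact: bigOM | exact: bigOM |].
have hA := bigOM h3 h1'; have hB := bigOM h2 h3'.
rewrite addSn in hA; rewrite addnS in hB.
by apply: (bigO_ext _ (bigOD hA hB)) => s /=; ring.
Qed.

Lemma approx1 : approx 0 (fun=> 1) (fun=> 1).
Proof.
split; [exact: bigO_cst | exact: bigO_cst |].
by apply: (bigO_ext _ (bigO_zero 1)) => s; rewrite subrr.
Qed.

Lemma approx_ext k u v u' v' : u =1 u' -> v =1 v' -> approx k u v -> approx k u' v'.
Proof. by move=> /funext -> /funext ->. Qed.

Lemma approxX k m u v : approx k u v -> approx (k * m) (fun s => u s ^+ m) (fun s => v s ^+ m).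
Proof.
move=> h; elim: m => [|m IH]; first by rewrite muln0; exact: approx1.
by rewrite mulnS; apply: (approx_ext _ _ (approxM h IH)) => s; rewrite exprS.
Qed.

Lemma approx_prod I (r : seq I) (k : I -> nat) (u v : I -> R -> C) :
  (forall i, approx (k i) (u i) (v i)) ->
  approx (\sum_(i <- r) k i) (fun s => \prod_(i <- r) u i s) (fun s => \prod_(i <- r) v i s).
Proof.
move=> h; elim: r => [|i r IH].
  by rewrite big_nil; apply: (approx_ext _ _ approx1) => s; rewrite big_nil.
by rewrite big_cons; apply: (approx_ext _ _ (approxM (h i) IH)) => s; rewrite big_cons.
Qed.

Lemma mweightE (a : 'I_n -> nat) N (m : {ffun dir -> 'I_N.+1}) :
  mweight a m = (\sum_(o : dir) a o.1 * m o)%N.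
Proof.
rewrite /mweight /weight [RHS](eq_bigr (fun o : dir => a o.1 * m (o.1, o.2))%N) => [|[] //].
rewrite -(pair_bigA _ (fun j b => a j * m (j, b))%N) /=; apply: eq_bigr => j _.
by rewrite big_bool !ffunE mulnDr addnC.
Qed.

Variables (f : pt -> R) (e : R) (a : 'I_n -> nat) (l : nat).
Hypothesis e0 : 0 < e.
Hypothesis sf : smooth_on (polydisc O e) f.
Hypothesis a0 : forall j, (0 < a j)%N.
Hypothesis lmin : forall g, Ssupp f g -> (l <= weight a g)%N.

Variables (u : R -> pt) (y : pt).
Hypothesis uO : forall j, bigO (a j) (fun s => u s j).
(** The first alternative is meant for components without a leading term: if [a j] exceeds [l], the
    variable [j] occurs in no monomial of weight [l]. *)
Hypothesis uA : forall j, (l < a j)%N \/ bigO (a j).+1 (fun s => u s j - ofr s ^+ a j * y j).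

Let v (s : R) : pt := fun j => ofr s ^+ a j * y j.

Lemma bigO_ofr k c : bigO k (fun s => ofr s ^+ k * c).
Proof.
exists (abs c), 1; split; rewrite ?cabs_ge0 // => s /andP[s0 _].
by rewrite cabsM cabsX cabs_ofr ger0_norm ?(ltW s0) // mulrC.
Qed.

Lemma bigO_mpow N (m : {ffun dir -> 'I_N.+1}) : bigO (mweight a m) (fun s => mpow (u s) m).
Proof.
rewrite mweightE; apply: bigO_prod => o; apply: bigO_X; rewrite /wcoord.
by case: o.2; [apply: bigO_conj | ]; exact: uO.
Qed.

Lemma approx_mpow N (m : {ffun dir -> 'I_N.+1}) : mweight a m = l ->
  approx (mweight a m) (fun s => mpow (u s) m) (fun s => mpow (v s) m).
Proof.
move=> ml; rewrite [X in approx X]mweightE; apply: approx_prod => o.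
have [la|h] := uA o.1.
  have -> : nat_of_ord (m o) = 0%N.
    apply/eqP; rewrite -leqn0 leqNgt; apply/negP => mo; move: la; rewrite -ml mweightE ltnNge.
    by rewrite (bigD1 o) //= (leq_trans _ (leq_addr _ _)) // leq_pmulr.
  by rewrite muln0; exact: approx1.
apply: approxX; rewrite /wcoord; case: o.2; last by split; [exact: uO | exact: bigO_ofr | exact: h].
split; [exact: bigO_conj (uO _) | exact: bigO_conj (bigO_ofr _ _) |].
by apply: (bigO_ext _ (bigO_conj h)) => s /=; rewrite rmorphB.
Qed.

Lemma mpow_v N (m : {ffun dir -> 'I_N.+1}) s : mpow (v s) m = ofr s ^+ mweight a m * mpow y m.
Proof.
rewrite mweightE /mpow -prodrXr -big_split /=; apply: eq_bigr => o _.
rewrite exprM -exprMn; congr (_ ^+ _); rewrite /wcoord /v; case: o.2 => //.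
by rewrite rmorphM -ofrX; congr (_ * _); apply/eqP; rewrite eq_complex /= oppr0 !eqxx.
Qed.

(** In the Taylor polynomial, monomials of weight below [l] have coefficient 0 by [lmin], those of
    weight above [l] are [O(s ^ (l + 1))], and those of weight [l] build the face part. All weights
    [a j] being positive, degree is at most weight, so truncating at degree [l] keeps every monomial
    of weight [l]. *)
Lemma leading_asymptotics :
  bigO l.+1 (fun s => ofr (f (u s)) - ofr s ^+ l * Fpart f (weight_face f a l) y).
Proof.
pose N := l.+1.
have [r [K [r0 K0 h]]] := taylor_coef N e0 sf.
have [d [M [d0 M0 hu]]] : exists d M : R, [/\ 0 < d, 0 <= M &
    forall (j : 'I_n) s, 0 < s < d -> abs (u s j) <= M * s].
  apply: uniform_radius_bound => [j r1 r2 K1 K2 h1 r21 K12 s /andP[s0 sr]|j].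
    apply: le_trans (h1 s _) _; first by rewrite s0 (lt_le_trans sr).
    by rewrite ler_wpM2r // ltW.
  have [M [d [M0 d0 hM]]] := bigO_le (a0 j) (uO j).
  by exists d, M; split=> // s /hM; rewrite expr1.
have rest : bigO N (fun s => ofr (f (u s)) - \sum_(m : {ffun dir -> 'I_N.+1} | (msize m < N)%N)
      coef f (index_part m false) (index_part m true) * mpow (u s) m).
  have M1 : 0 < M + 1 by rewrite ltr_wpDl.
  exists (K * (n%:R * M) ^+ N), (Num.min d (r / (M + 1))); split.
  - by rewrite mulr_ge0 // exprn_ge0 // mulr_ge0.
  - by rewrite lt_min d0 divr_gt0.
  move=> s /andP[s0]; rewrite lt_min ltr_pdivlMr // => /andP[sd sr].
  have hs : 0 < s < d by rewrite s0.
  have hp : polydisc O r (u s).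
    by move=> j; rewrite subr0; apply: (le_lt_trans (hu j s hs)); nra.
  have := h _ hp; under eq_bigr do rewrite monom_component.
  move=> /le_trans; apply; rewrite -mulrA ler_wpM2l // -exprMn lerXn2r ?nnegrE ?l1_ge0 //.
    by rewrite !mulr_ge0 // ltW.
  apply: (@le_trans _ _ (\sum_(j < n) M * s)); first by apply: ler_sum => j _; exact: hu.
  by rewrite sumr_const card_ord -[X in X <= _]mulr_natl mulrA.
pose F s (m : {ffun dir -> 'I_N.+1}) := coef f (index_part m false) (index_part m true) * mpow (u s) m -
  (if mweight a m == l then ofr s ^+ l * (coef f (index_part m false) (index_part m true) * mpow y m) else 0).
have sumF : bigO N (fun s => \sum_(m | (msize m < N)%N) F s m).
  apply: bigO_sum => m _; rewrite /F.
  have [c0|c0] := eqVneq (coef f (index_part m false) (index_part m true)) 0.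
    by apply: (bigO_ext _ (bigO_zero _)) => s; rewrite c0 !mul0r mulr0 if_same subrr.
  have lm : (l <= mweight a m)%N.
    by apply: lmin; exists (index_part m false), (index_part m true).
  case: eqVneq => [ml|ne].
    have [_ _ hA] := approx_mpow ml; rewrite ml in hA.
    apply: (bigO_ext _ (bigO_scale (coef f (index_part m false) (index_part m true)) hA)) => s.
    by rewrite mpow_v ml; ring.
  have lm' : (N <= mweight a m)%N by rewrite ltn_neqAle eq_sym ne.
  apply: (bigO_ext _ (bigO_scale (coef f (index_part m false) (index_part m true))
    (bigO_le lm' (bigO_mpow m)))) => s.
  by rewrite subr0.
apply: (bigO_ext _ (bigOD rest sumF)) => s.
rewrite (Fpart_box f a0 (leqnSn l)) /F sumrB addrA subrK; congr (_ - _).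
rewrite mulr_sumr -big_mkcondr; apply: eq_big => [m|m _]; last by rewrite monom_component.
apply/andP/idP => [[]//|/eqP ml]; split; last exact/eqP.
have : (msize m <= mweight a m)%N.
  by rewrite mweightE /msize; apply: leq_sum => o _; exact: leq_pmull.
by rewrite ml.
Qed.

End Asymptotics.

(** * Orders of contact *)

Section ContactOrders.
Variables (R : realType) (n : nat).
Local Notation C := (R[i]).
Local Notation abs := (@cabs R).
Local Notation pt := (pt R n).
Local Notation dir := (dir n).
Local Notation O := (@origin R n).

Lemma bigO_leading l (A : C) : bigO l.+1 (fun s => ofr s ^+ l * A) -> A = 0.
Proof.
move=> [K [d [K0 d0 h]]]; apply/eqP; rewrite -cabs_eq0 eq_le cabs_ge0 andbT.
apply/ler_addgt0Pr => e e0; rewrite add0r.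
have K1 : 0 < K + 1 by rewrite ltr_wpDl.
pose s := Num.min (d / 2%:R) (e / (K + 1)).
have s0 : 0 < s by rewrite lt_min !divr_gt0.
have sd : s < d.
  by apply: (@le_lt_trans _ _ (d / 2%:R)); [rewrite ge_min lexx | move: d0; lra].
have se : s * (K + 1) <= e by rewrite -ler_pdivlMr // ge_min lexx orbT.
have := h s; rewrite s0 sd => /(_ isT); rewrite cabsM cabsX cabs_ofr ger0_norm ?(ltW s0) //.
rewrite exprSr mulrA [X in _ <= X]mulrAC [X in _ <= X]mulrC ler_pM2l ?exprn_gt0 // => /le_trans; apply.
by nra.
Qed.

Lemma vanishes_bigO (h : C -> R) k (t0 : C) : vanishes_to h k -> bigO k (fun s => ofr (h (ofr s * t0))).
Proof.
move=> [c [d [c0 d0 hd]]].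
have T0 : 0 < abs t0 + 1 by rewrite ltr_wpDl // cabs_ge0.
exists (c * abs t0 ^+ k), (d / (abs t0 + 1)); split.
- by rewrite mulr_ge0 ?exprn_ge0 ?cabs_ge0 // ltW.
- by rewrite divr_gt0.
move=> s /andP[s0]; rewrite ltr_pdivlMr // => sd; rewrite cabs_ofr.
have hs : abs (ofr s * t0) = s * abs t0 by rewrite cabsM cabs_ofr ger0_norm // ltW.
apply: (le_trans (hd _ _)); rewrite hs; first by have := cabs_ge0 t0; nra.
by rewrite exprMn mulrA mulrAC.
Qed.

Lemma curve_bigO (h : C -> C) k (K d : R) (t0 : C) : 0 <= K -> 0 < d ->
  (forall t, abs t < d -> abs (h t) <= K * abs t ^+ k) -> bigO k (fun s => h (ofr s * t0)).
Proof.
move=> K0 d0 hd.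
have T0 : 0 < abs t0 + 1 by rewrite ltr_wpDl // cabs_ge0.
exists (K * abs t0 ^+ k), (d / (abs t0 + 1)); split.
- by rewrite mulr_ge0 ?exprn_ge0 ?cabs_ge0.
- by rewrite divr_gt0.
move=> s /andP[s0]; rewrite ltr_pdivlMr // => sd.
have hs : abs (ofr s * t0) = s * abs t0 by rewrite cabsM cabs_ofr ger0_norm // ltW.
apply: (le_trans (hd _ _)); rewrite hs; first by have := cabs_ge0 t0; nra.
by rewrite exprMn mulrA mulrAC.
Qed.

Lemma leading_bound (h : C -> C) (c : C) (k : nat) (K d : R) : 0 <= K -> 0 < d ->
  (forall t, abs t < d -> abs (h t - c * t ^+ k) <= K * abs t ^+ k.+1) ->
  forall t, abs t < Num.min d 1 -> abs (h t) <= (K + abs c) * abs t ^+ k.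
Proof.
move=> K0 d0 hd t; rewrite lt_min => /andP[td t1].
have := ler_cabsD (h t - c * t ^+ k) (c * t ^+ k); rewrite subrK => /le_trans; apply.
rewrite mulrDl; apply: lerD; last by rewrite cabsM cabsX.
apply: (le_trans (hd t td)); rewrite ler_wpM2l // exprS ler_piMl ?exprn_ge0 ?cabs_ge0 //.
exact: ltW.
Qed.

Section Canonical.
Variables (rho : pt -> R) (e : R).
Hypothesis e0 : 0 < e.
Hypothesis srho : smooth_on (polydisc O e) rho.
Hypothesis rho_conv : convenient rho.
Hypothesis rho_nondeg : Nnondeg rho.

(** A common bound for points where the polyhedron meets the axes; it becomes the constant of
    [contact_bound]. *)
Lemma axis_bound : exists K : nat, forall j : 'I_n,
  exists2 xi, Newton_plus rho xi & (forall k, k != j -> xi 0 k = 0) /\ xi 0 j <= K%:R.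
Proof.
have [K K0 hK] : exists2 K : R, 0 <= K & forall j : 'I_n,
    exists2 xi, Newton_plus rho xi & (forall k, k != j -> xi 0 k = 0) /\ xi 0 j <= K.
  apply: uniform_bound => [j K K' [xi h1 [h2 h3]] KK'|j].
    by exists xi => //; split => //; exact: le_trans h3 KK'.
  by have [xi h1 h2] := rho_conv j; exists (xi 0 j), xi.
exists (Num.bound K) => j; have [xi h1 [h2 h3]] := hK j.
by exists xi => //; split => //; apply: (le_trans h3); exact/ltW/archi_boundP.
Qed.

Lemma newton_support xi : Newton_plus rho xi -> exists g, Ssupp rho g.
Proof.
move=> [[|m] [lam [x [_ h1 h2 _]]]]; last by have [g Sg _] := h2 ord0; exists g.
by move: h1; rewrite big_ord0 => /eqP; rewrite eq_sym oner_eq0.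
Qed.

Definition eventually_zero (h : C -> C) := exists2 d : R, 0 < d & forall t, abs t < d -> h t = 0.

(* The weights of the components vanishing identically are chosen so large that those
   variables do not occur in the face part. *)
Lemma contact_bound : exists K : nat, forall G : C -> pt,
  holo_curve G -> G 0 = O -> ~ (exists2 d : R, 0 < d & forall t, abs t < d -> G t = O) ->
  exists mu : nat, [/\ (0 < mu)%N, cvanishes_to G O mu,
    (forall k, cvanishes_to G O k -> (k <= mu)%N) &
    (forall k, vanishes_to (rho \o G) k -> (k <= K * mu)%N)].
Proof.
have [K hK] := axis_bound; exists K => G [eG eG0 hG] G0 Gnc.
pose Z j := eventually_zero (fun t => G t j).
pose lead j (ac : nat * C) := [/\ ac.2 != 0, (0 < ac.1)%N & exists M d : R, [/\ 0 <= M, 0 < d &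
    forall t, abs t < d -> abs (G t j - ac.2 * t ^+ ac.1) <= M * abs t ^+ ac.1.+1]].
have [D hD] : {D : 'I_n -> nat * C & forall j, Z j \/ lead j (D j)}.
  apply: (@choice _ _ (fun j ac => Z j \/ lead j ac)) => j.
  have [z|[a [c [M [d [c0 M0 d0 h]]]]]] := leading_term eG0 (fun t ht => hG t ht j).
    by exists (0%N, 0); left.
  exists (a, c); right; split => //=; last by exists M, d.
  (* Exponent 0 is excluded because [G 0] is the origin: at [t = 0] the estimate would give
     [abs c <= 0]. *)
  case: a h => // h; have := h 0; rewrite cabs0 d0 => /(_ isT).
  rewrite G0 expr0 mulr1 expr1 mulr0 sub0r cabsN => hc.
  by move: c0; rewrite -cabs_gt0 ltNge hc.
have leadP j : ~ Z j -> lead j (D j) by case: (hD j).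
have [j1 nZ1] : exists j, ~ Z j.
  apply: contrapT => /forallNP hZ; apply: Gnc.
  have [d d0 hd] : exists2 d : R, 0 < d & forall j t, abs t < d -> G t j = 0.
    apply: (@uniform_radius R _ (fun j d => forall t, abs t < d -> G t j = 0)).
      by move=> j d d' h _ dd t td; apply: h; exact: lt_le_trans td dd.
    by move=> j; have /contrapT := hZ j.
  by exists d => // t td; apply/funext => j; exact: hd.
have mu_ex : exists m, `[< exists2 j, ~ Z j & (D j).1 = m >].
  by exists (D j1).1; apply/asboolP; exists j1.
case: (ex_minnP mu_ex) => mu /asboolP[j0 nZ0 Dmu] mu_min.
have {}mu_min j : ~ Z j -> (mu <= (D j).1)%N by move=> nZ; apply/mu_min/asboolP; exists j.
have mu0 : (0 < mu)%N by rewrite -Dmu; case: (leadP j0 nZ0).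
(* The value exceeds [K * mu], hence [l], as [leading_asymptotics] requires of such components, and
   it is at least [mu], so the order of the curve is unaffected. *)
pose a j := if `[< Z j >] then (K.+1 * mu).+1 else (D j).1.
(* The coefficient 1 is an arbitrary nonzero value, since [Gamma_kappa] admits no zero
   coefficient. *)
pose c j := if `[< Z j >] then 1 else (D j).2.
have aZ j : Z j -> a j = (K.+1 * mu).+1 by rewrite /a => /asboolP ->.
have aL j : ~ Z j -> a j = (D j).1 by move=> /asboolPn/negbTE; rewrite /a => ->.
have cL j : ~ Z j -> c j = (D j).2 by move=> /asboolPn/negbTE; rewrite /c => ->.
have a0 j : (0 < a j)%N.
  by have [/aZ -> //|nZ] := pselect (Z j); rewrite aL //; case: (leadP j nZ).
have c0 j : c j != 0.
  rewrite /c; case: asboolP => [_|nZ]; first by rewrite oner_eq0.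
  by case: (leadP j nZ).
have [xi0 Nxi0 [xi00 xi0K]] := hK j0.
have l_ex : exists m, `[< exists2 g, Ssupp rho g & weight a g = m >].
  by have [g Sg] := newton_support Nxi0; exists (weight a g); apply/asboolP; exists g.
case: (ex_minnP l_ex) => l /asboolP lex l_min.
have lmin g : Ssupp rho g -> (l <= weight a g)%N by move=> Sg; apply/l_min/asboolP; exists g.
(* The minimum [l] is compared with the weight of the axis point for [j0], the component of least
   exponent [mu]. As [j0] varies with the curve, points on all axes are required. *)
have lK : (l <= K * mu)%N.
  rewrite -(ler_nat R); apply: (le_trans (newton_ge lmin Nxi0)).
  rewrite /wdot (bigD1 j0) //= big1 => [|k kj]; last by rewrite xi00 // mulr0.
  by rewrite addr0 mxE aL // Dmu mulnC natrM ler_wpM2l.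
have [t0 A0] : exists t0, Fpart rho (weight_face rho a l) (fun j => c j * t0 ^+ a j) != 0.
  have hk : Gamma_kappa rho (weight_face rho a l) (fun t j => c j * t ^+ a j).
    by exists c, a; split => //; exists l.
  have := rho_nondeg (weight_face_compact a0 lmin lex) hk.
  by move=> /existsNP[t0 /eqP h]; exists t0.
have bound j : exists M d : R, [/\ 0 <= M, 0 < d & forall t, abs t < d -> abs (G t j) <= M * abs t ^+ a j].
  have [Zj|nZ] := pselect (Z j).
    by have [d d0 hd] := Zj; exists 0, d; split => // t /hd ->; rewrite cabs0 mul0r.
  have [_ _ [M [d [M0 d0 hd]]]] := leadP j nZ.
  exists (M + abs (D j).2), (Num.min d 1); split.
  - by rewrite addr_ge0 // cabs_ge0.
  - by rewrite lt_min d0 ltr01.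
  by rewrite aL //; exact: leading_bound hd.
have asymp : bigO l.+1 (fun s => ofr (rho (G (ofr s * t0))) -
    ofr s ^+ l * Fpart rho (weight_face rho a l) (fun j => c j * t0 ^+ a j)).
  apply: (leading_asymptotics e0 srho a0 lmin (u := fun s => G (ofr s * t0))) => // j.
    by have [M [d [M0 d0 hd]]] := bound j; exact: curve_bigO hd.
  have [Zj|nZ] := pselect (Z j); [left | right].
    by rewrite aZ // ltnS (leq_trans lK) // leq_mul.
  have [_ _ [M [d [M0 d0 hd]]]] := leadP j nZ.
  rewrite aL // cL //.
  apply: (bigO_ext _ (curve_bigO t0 M0 d0 hd)) => s.
  by rewrite exprMn mulrCA.
exists mu; split => //.
- have [r [M [r0 M0 h]]] : exists r M : R, [/\ 0 < r, 0 <= M &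
      forall (j : 'I_n) t, abs t < r -> abs (G t j) <= M * abs t ^+ mu].
    apply: uniform_radius_bound => [j r r' M M' h rr MM t tr|j].
      apply: (le_trans (h t (lt_le_trans tr rr))).
      by rewrite ler_wpM2r // exprn_ge0 // cabs_ge0.
    have [M [d [M0 d0 hd]]] := bound j.
    exists (Num.min d 1), M; split; first by rewrite lt_min d0 ltr01.
    move=> t; rewrite lt_min => /andP[td t1]; apply: (le_trans (hd t td)).
    rewrite ler_wpM2l // ler_wiXn2l ?cabs_ge0 // ?(ltW t1) //.
    have [Zj|nZ] := pselect (Z j); last by rewrite aL // mu_min.
    rewrite aZ //; apply: leqW; exact: leq_pmull.
  exists (M + 1), r; split => //; first by rewrite ltr_wpDl.
  move=> t tr j; rewrite subr0; apply: (le_trans (h j t tr)).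
  by rewrite ler_wpM2r ?exprn_ge0 ?cabs_ge0 // lerDl.
(* An order above [mu] would make the nonzero leading coefficient of the component [j0] vanish. *)
- move=> k [M [d [M0 d0 h]]]; rewrite leqNgt; apply/negP => muk.
  have [Dc _ [M' [d' [M'0 d'0 hd']]]] := leadP j0 nZ0.
  move: Dc; apply/negP; rewrite negbK; apply/eqP.
  have h1 : bigO mu.+1 (fun s => G (ofr s * 1) j0).
    apply: (bigO_le muk); apply: (curve_bigO (h := fun t => G t j0) 1 (ltW M0) d0) => t td.
    by have := h t td j0; rewrite subr0.
  have h2 := curve_bigO 1 M'0 d'0 hd'; rewrite Dmu in h2.
  apply: (@bigO_leading mu).
  apply: (bigO_ext _ (bigOD h1 (bigO_scale (-1) h2))) => s.
  by rewrite mulr1; ring.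
move=> k hk; rewrite leqNgt; apply/negP => kK.
have lk : (l < k)%N := leq_ltn_trans lK kK.
have := bigO_le lk (vanishes_bigO t0 hk).
move=> h1; move: A0; apply/negP; rewrite negbK; apply/eqP.
apply: (@bigO_leading l); apply: (bigO_ext _ (bigOD h1 (bigO_scale (-1) asymp))) => s /=.
by ring.
Qed.
End Canonical.

(** Applied with [F] equal to [Psi] and to [Phi], it carries vanishing orders between a defining
    function at [p] and one in the coordinate, in both directions. *)
Lemma comparison (M M' : set pt) (r r' : pt -> R) (F : pt -> pt) (p q : pt) :
  local_defining_function M p r -> local_defining_function M' q r' -> M' q ->
  F q = p -> (forall j, holo_near (fun z => F z j) q) ->
  (exists2 d : R, 0 < d & forall z, polydisc q d z -> M' z -> M (F z)) ->
  exists d K : R, [/\ 0 < d, 0 <= K & forall z, polydisc q d z -> `|r (F z)| <= K * `|r' z|].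
Proof.
move=> [e e0 [sr Mr _]] [e' e'0 [sr' Mr' gr']] Mq Fq hF [d1 d10 h1].
have qq := polydisc_id q e'0.
have [d dn0] := gr' q qq Mq.
have r'q : r' q = 0 by exact/(Mr' q qq).
have [d2 d20 h2] := holo_map_near e0 hF; rewrite Fq in h2.
apply: (vanishing_comparison e'0 sr' r'q dn0).
  exact: rlip_comp (smooth_lip e0 sr) Fq hF.
exists (Num.min e' (Num.min d1 d2)); first by rewrite !lt_min e'0 d10.
move=> z hz z0.
have hz1 : polydisc q e' z by apply: polydisc_le hz; rewrite ge_min lexx.
have hz2 : polydisc q d1 z by apply: polydisc_le hz; rewrite !ge_min lexx orbT.
have hz3 : polydisc q d2 z by apply: polydisc_le hz; rewrite !ge_min lexx !orbT.
apply/(Mr _ (h2 z hz3)); apply: h1 => //; exact/(Mr' z hz1).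
Qed.

Lemma curve_near (g : C -> pt) p (d : R) : g 0 = p -> holo_curve g -> 0 < d ->
  exists2 r : R, 0 < r & forall t, abs t < r -> polydisc p d (g t).
Proof.
move=> g0 [e e0 hg] d0.
suff [r r0 hr] : exists2 r : R, 0 < r & forall (j : 'I_n) t, abs t < r -> abs (g t j - p j) < d.
  by exists r => // t tr j; exact: hr.
apply: (@uniform_radius R 'I_n (fun j r => forall t, abs t < r -> abs (g t j - p j) < d)) => [j r r' h _ rr t tr|j].
  by apply: h; exact: lt_le_trans tr rr.
have [K K0 [r r0 hr]] := cdiff_cont (hg 0 (ltac:(by rewrite cabs0)) j).
exists (Num.min r (d / K)); first by rewrite lt_min r0 divr_gt0.
move=> t; rewrite lt_min ltr_pdivlMr // => /andP[tr td].
have := hr t; rewrite subr0 g0 => /(_ tr) /le_lt_trans; apply; by rewrite mulrC.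
Qed.

(** From the Lipschitz bound of [F] near [p]; positivity of [k] keeps [g t] in the polydisc where
    that bound holds. *)
Lemma cvanishes_map (F : pt -> pt) (g : C -> pt) p k : (0 < k)%N ->
  (forall j, holo_near (fun z => F z j) p) -> cvanishes_to g p k ->
  cvanishes_to (fun t => F (g t)) (F p) k.
Proof.
move=> k0 hF [c [d [c0 d0 h]]].
have [r [M [r0 M0 hM]]] := holo_map_lip hF.
have q0 : 0 < M * (n%:R * c) + 1 by rewrite ltr_wpDl // !mulr_ge0 // ltW.
exists (M * (n%:R * c) + 1), (Num.min d (Num.min 1 (r / c))); split=> //.
  by rewrite !lt_min d0 ltr01 divr_gt0.
move=> t; rewrite !lt_min ltr_pdivlMr // => /and3P[td t1 tr] j.
have hp : polydisc p r (g t).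
  move=> i; apply: (le_lt_trans (h t td i)); apply: le_lt_trans tr; rewrite mulrC ler_wpM2r ?(ltW c0) //.
  by case: k k0 {h} => // k _; rewrite exprS ler_piMr ?cabs_ge0 // exprn_ile1 ?cabs_ge0 // ltW.
apply: le_trans (l1_ge (fun j => F (g t) j - F p j) j) _.
apply: (le_trans (hM _ _ hp (polydisc_id p r0))).
apply: (@le_trans _ _ (M * (n%:R * c) * abs t ^+ k)); last first.
  by rewrite ler_wpM2r ?exprn_ge0 ?cabs_ge0 // lerDl.
rewrite -!mulrA ler_wpM2l //; apply: (@le_trans _ _ (\sum_(i < n) c * abs t ^+ k)).
  by apply: ler_sum => i _; exact: h.
by rewrite sumr_const card_ord -[X in X <= _]mulr_natl.
Qed.

Lemma holo_curve_map (F : pt -> pt) (g : C -> pt) p : g 0 = p -> holo_curve g ->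
  (forall j, holo_near (fun z => F z j) p) -> holo_curve (fun t => F (g t)).
Proof.
move=> g0 hg hF.
have [d d0 hd] : exists2 d : R, 0 < d & forall j (h : C -> pt) t0,
  polydisc p d (h t0) -> (forall i, cdiff_at (fun t => h t i) t0) -> cdiff_at (fun t => F (h t) j) t0.
  apply: (@uniform_radius R 'I_n (fun j d => forall (h : C -> pt) t0,
    polydisc p d (h t0) -> (forall i, cdiff_at (fun t => h t i) t0) -> cdiff_at (fun t => F (h t) j) t0)).
    by move=> j d d' H _ dd h t0 hp; apply: H; exact: polydisc_le dd hp.
  by move=> j; have [d d0 hd] := cdiff_comp (hF j); exists d.
have [r r0 hr] := curve_near g0 hg d0; have [e e0 he] := hg.
exists (Num.min e r); first by rewrite lt_min e0.
by move=> t; rewrite lt_min => /andP[te tr] j; apply: hd; [exact: hr | exact: he].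
Qed.

End ContactOrders.

(** * The five conditions on the hypersurface *)

Section TypeConditions.
Variables (R : realType) (n : nat).
Local Notation C := (R[i]).
Local Notation abs := (@cabs R).
Local Notation pt := (pt R n).
Local Notation dir := (dir n).
Local Notation O := (@origin R n).

Lemma ord_le (h : C -> R) m : (forall k, vanishes_to h k -> (k <= m)%N) -> (ord h <= (m%:R : R)%:E)%E.
Proof.
by move=> hm; apply: ge_ereal_sup => _ [k /= /hm km <-]; rewrite lee_fin ler_nat.
Qed.

Lemma ord_curve_eq (g : C -> pt) p m : cvanishes_to g p m ->
  (forall k, cvanishes_to g p k -> (k <= m)%N) -> ord_curve g p = (m%:R : R)%:E.
Proof.
move=> gm hm; apply/eqP; rewrite eq_le; apply/andP; split.
  by apply: ge_ereal_sup => _ [k /= /hm km <-]; rewrite lee_fin ler_nat.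
by apply: ereal_sup_ubound; exists m.
Qed.

Lemma ord_infty (h : C -> R) : (forall N, vanishes_to h N) -> ord h = +oo%E.
Proof.
move=> hN; apply/eqyP => A A0; apply: (@le_trans _ _ ((Num.bound A)%:R : R)%:E).
  by rewrite lee_fin ltW // archi_boundP // ltW.
by apply: ereal_sup_ubound; exists (Num.bound A) => //; exact: hN.
Qed.

Variables (M : set pt) (p : pt) (r : pt -> R).
Hypothesis Mp : M p.
Hypothesis hr : local_defining_function M p r.

Section Coordinates.
Variables (Phi Psi : pt -> pt) (rho : pt -> R).
Hypothesis hc : holo_coord p Phi Psi.
Hypothesis hrho : local_defining_function (in_coord M Psi) O rho.

Let MO : in_coord M Psi O.
Proof. by case: hc => _ Psi0 _ _ _; rewrite /in_coord /= Psi0. Qed.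

Lemma origin_comparison : exists d K : R, [/\ 0 < d, 0 <= K &
  forall z, polydisc O d z -> `|r (Psi z)| <= K * `|rho z|].
Proof.
case: hc => _ Psi0 _ hPsi _; apply: (comparison hr hrho MO Psi0 hPsi).
by exists 1.
Qed.

Lemma base_comparison : exists d K : R, [/\ 0 < d, 0 <= K &
  forall z, polydisc p d z -> `|rho (Phi z)| <= K * `|r z|].
Proof.
case: hc => Phi0 _ hPhi _ [e e0 [h1 _]]; apply: (comparison hrho hr Mp Phi0 hPhi).
by exists e => // z /h1 hz; rewrite /in_coord /= hz.
Qed.

Definition axis (j : 'I_n) (t : C) : pt := upd O j t.

Lemma polydisc_axis j t (d : R) : 0 < d -> abs t < d -> polydisc O d (axis j t).
Proof. by move=> d0 td k; rewrite /axis /upd subr0; case: eqVneq => // _; rewrite cabs0. Qed.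

Lemma l1_axis j t : l1 (axis j t) = abs t.
Proof.
rewrite /l1 (bigD1 j) //= /axis /upd eqxx big1 ?addr0 // => k /negbTE ->.
by rewrite cabs0.
Qed.

(** A monomial that is nonzero at some point of the axis involves no other variable, so its
    coefficient is 0; only the Taylor remainder, of arbitrary order, is left. *)
Lemma axis_vanishing j : ~ (exists2 xi, Newton_plus rho xi & forall k, k != j -> xi 0 k = 0) ->
  forall N, vanishes_to (fun t => rho (axis j t)) N.
Proof.
move=> nj N; have [e e0 [srho _ _]] := hrho.
have [d [K [d0 K0 h]]] := taylor_coef N e0 srho.
exists (K + 1), d; split=> //; first by rewrite ltr_wpDl.
move=> t td; have := h _ (polydisc_axis j d0 td); rewrite big1 => [|m _].
  rewrite subr0 cabs_ofr l1_axis => /le_trans; apply.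
  by rewrite ler_wpM2r ?exprn_ge0 ?cabs_ge0 // lerDl.
apply/eqP/negPn/negP; rewrite mulf_eq0 negb_or => /andP[c0 m0].
apply: nj; exists (embed R (madd (index_part m false) (index_part m true))).
  by apply: newton_embed; exists (index_part m false), (index_part m true).
move=> k kj; rewrite mxE ffunE; apply/eqP; rewrite pnatr_eq0 addn_eq0.
move: m0; rewrite monom_component /mpow => /prodf_neq0 hm.
have hk b : index_part m b k == 0%N.
  rewrite ffunE; have := hm (k, b) isT; apply: contraR => mk.
  have zk : wcoord (axis j t) (k, b) = 0.
    by rewrite /wcoord /= /axis /upd (negbTE kj) /origin; case: b {mk}; rewrite // rmorph0.
  by rewrite zk expr0n (negbTE mk).
by rewrite (hk false) (hk true).
Qed.

Lemma axis_curve : ~ convenient rho -> exists g, Gamma_reg p g /\ tangent_inf_order r g.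
Proof.
move=> /existsNP[j nj]; case: (hc) => Phi0 Psi0 hPhi hPsi [e e0 [_ PhiPsi]].
pose g t := Psi (axis j t).
have ax0 : axis j 0 = O by apply/funext => k; rewrite /axis /upd /origin; case: ifP.
have g0 : g 0 = p by rewrite /g ax0.
have Phig t : abs t < e -> Phi (g t) = axis j t.
  by move=> te; apply: PhiPsi; exact: polydisc_axis.
have axj t : axis j t j = t by rewrite /axis /upd eqxx.
have holo_ax : holo_curve (axis j).
  exists 1 => // t _ k; rewrite /axis /upd; case: eqVneq => _; last exact: cdiff_cst.
  by exists 1 => e1 e10; exists 1 => // h /andP[h0 _]; rewrite addrAC subrr add0r divff -?cabs_gt0 // subrr cabs0.
have holo_g : holo_curve g by exact: (holo_curve_map ax0 holo_ax hPsi).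
have Gg : Gamma p g.
  split => //.
  - move=> [d d0 hd].
    pose t : C := ofr (Num.min d e / 2%:R).
    have m0 : 0 < Num.min d e by rewrite lt_min d0.
    have at0 : abs t = Num.min d e / 2%:R by rewrite cabs_ofr ger0_norm // divr_ge0 // ltW.
    have lt2 : abs t < Num.min d e by rewrite at0; lra.
    move: lt2; rewrite lt_min => /andP[td te].
    have := congr1 (fun z => z j) (Phig t te); rewrite (hd t td) Phi0 axj /origin => t0.
    by move: at0; rewrite -t0 cabs0; lra.
  - exists e => // s t se te gst; rewrite -(axj s) -(axj t) -Phig // -Phig //.
    by rewrite gst.
exists g; split.
  split => //; apply: (@ord_curve_eq g p 1).
    rewrite -Psi0; apply: cvanishes_map => //.
    exists 1, 1; split => // t _ k; rewrite mul1r expr1 subr0 /axis /upd.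
    by case: eqVneq => // _; rewrite cabs0 cabs_ge0.
  (* An order of at least 2 would be carried by [Phi] back to the axis, where the [j]-th component
     is [t]. *)
  move=> [|k] // hk; have [c [d [c0 d0 h]]] := cvanishes_map (ltn0Sn k) hPhi hk.
  rewrite ltnS leqNgt; apply/negP => k0.
  have : bigO 2 (fun s => axis j (ofr s * 1) j).
    apply: (@bigO_le _ k.+1 2 _ k0); apply: (@curve_bigO _ (fun t => axis j t j) k.+1 c (Num.min d e)).
    - exact: ltW.
    - by rewrite lt_min d0.
    move=> t; rewrite lt_min => /andP[td te].
    by have := h t td j; rewrite Phi0 subr0 Phig.
  move=> h2; have : (1 : C) = 0.
    by apply: (@bigO_leading _ 1); apply: bigO_ext h2 => s; rewrite axj expr1.
  by move/eqP; rewrite oner_eq0.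
move=> N; have [c1 [d1 [c10 d10 h1]]] := axis_vanishing nj N.
have [d [K [d0 K0 h]]] := origin_comparison.
exists (K * c1 + 1), (Num.min d d1); split; first by rewrite ltr_wpDl // mulr_ge0 // ltW.
  by rewrite lt_min d0.
move=> t; rewrite lt_min => /andP[td td1]; apply: (le_trans (h _ (polydisc_axis j d0 td))).
apply: (@le_trans _ _ (K * c1 * abs t ^+ N)); first by rewrite -mulrA ler_wpM2l // h1.
by rewrite ler_wpM2r ?exprn_ge0 ?cabs_ge0 // lerDl.
Qed.

Lemma gamma_bound : convenient rho -> Nnondeg rho -> exists K : nat, forall g, Gamma p g ->
  exists mu : nat, [/\ (0 < mu)%N, ord_curve g p = (mu%:R : R)%:E &
    forall k, vanishes_to (r \o g) k -> (k <= K * mu)%N].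
Proof.
move=> conv nondeg; have [e e0 [srho _ _]] := hrho.
have [K hK] := contact_bound e0 srho conv nondeg; exists K => g [g0 holo_g gnc _].
case: (hc) => Phi0 Psi0 hPhi hPsi [e1 e10 [PsiPhi _]].
pose G t := Phi (g t).
have G0 : G 0 = O by rewrite /G g0.
have holo_G : holo_curve G by exact: holo_curve_map g0 holo_g hPhi.
have [d1 d10 near1] := curve_near g0 holo_g e10.
have Gnc : ~ (exists2 d : R, 0 < d & forall t, abs t < d -> G t = O).
  move=> [d d0 hd]; apply: gnc; exists (Num.min d d1); first by rewrite lt_min d0.
  move=> t; rewrite lt_min => /andP[td td1].
  by rewrite -(PsiPhi (g t)) -/(G t) ?hd //; exact: near1.
have [mu [mu0 cmu mu_max vmu]] := hK G holo_G G0 Gnc; exists mu; split => //.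
  apply: ord_curve_eq.
    have [c [d [c0 d0 h]]] := cvanishes_map mu0 hPsi cmu.
    exists c, (Num.min d d1); split; rewrite ?lt_min ?d0 // => t.
    rewrite lt_min => /andP[td td1] j.
    by have := h t td j; rewrite Psi0 /G PsiPhi //; exact: near1.
  move=> [//|k] hk; apply: mu_max; rewrite -Phi0.
  exact: cvanishes_map hk.
move=> k [c [d [c0 d0 h]]]; apply: vmu.
have [d2 [K2 [d20 K20 h2]]] := base_comparison.
have [d3 d30 near3] := curve_near g0 holo_g d20.
exists (K2 * c + 1), (Num.min d d3); split; first by rewrite ltr_wpDl // mulr_ge0 // ltW.
  by rewrite lt_min d0.
move=> t; rewrite lt_min => /andP[td td3]; apply: (le_trans (h2 _ (near3 t td3))).
apply: (@le_trans _ _ (K2 * c * abs t ^+ k)); first by rewrite -mulrA ler_wpM2l // h.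
by rewrite ler_wpM2r ?exprn_ge0 ?cabs_ge0 // lerDl.
Qed.

End Coordinates.
End TypeConditions.

Theorem theorem1p3 (R : realType) (n : nat) (M : set (pt R n)) (p : pt R n) :
  real_hypersurface M -> M p ->
  (exists Phi Psi, N_canonical M p Phi Psi) ->
  forall r : pt R n -> R, local_defining_function M p r ->
  [<-> Delta1 r p = +oo%E;
       Delta1_reg r p = +oo%E;
       (exists g, Gamma_reg p g /\ tangent_inf_order r g);
       (exists g, Gamma p g /\ tangent_inf_order r g);
       (exists Phi Psi, holo_coord p Phi Psi /\
          exists rho, local_defining_function (in_coord M Psi) (@origin R n) rho /\
                      ~ convenient rho)].
Proof.
move=> _ Mp [Phi [Psi [hc [rho [hrho nondeg]]]]] r hr.
have canonical_curve := axis_curve Mp hr hc hrho.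
have canonical_bound conv := gamma_bound Mp hr hc hrho conv nondeg.
have not_conv : Delta1 r p = +oo%E -> ~ convenient rho.
  move=> D conv; have [K hK] := canonical_bound conv.
  suff : (Delta1 r p <= (K%:R : R)%:E)%E by rewrite D leye_eq.
  apply: ge_ereal_sup => _ [g [/hK[mu [mu0 -> hmu]] ->]].
  have mu0' : 0 < (mu%:R : R) by rewrite ltr0n.
  rewrite inver gt_eqF // lee_pdivrMr // -EFinM -natrM; exact: ord_le.
have not_conv_reg : Delta1_reg r p = +oo%E -> ~ convenient rho.
  move=> D conv; have [K hK] := canonical_bound conv.
  suff : (Delta1_reg r p <= (K%:R : R)%:E)%E by rewrite D leye_eq.
  apply: ge_ereal_sup => _ [g [[/hK[mu [mu0 -> hmu]] [mu1]] ->]].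
  have mu1' : mu = 1%N by apply/eqP; rewrite -(eqr_nat R) mu1.
  by apply: ord_le => k /hmu; rewrite mu1' muln1.
have curve_reg : (exists g, Gamma_reg p g /\ tangent_inf_order r g) -> Delta1_reg r p = +oo%E.
  move=> [g [Gg tg]]; apply/eqP; rewrite -leye_eq; apply: ereal_sup_ubound.
  by exists g; split => //; rewrite ord_infty.
tfae.
- by move/not_conv/canonical_curve/curve_reg.
- by move/not_conv_reg/canonical_curve.
- by move=> [g [[Gg _] tg]]; exists g.
- move=> [g [Gg tg]]; exists Phi, Psi; split => //; exists rho; split => // conv.
  (* Tangency to infinite order is tested at [K * mu + 1], just beyond the bound. *)
  have [K /(_ g Gg)[mu [_ _ /(_ (K * mu).+1 (tg _))]]] := canonical_bound conv.
  by rewrite ltnn.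
- move=> [Phi' [Psi' [hc' [rho' [hrho' /(axis_curve Mp hr hc' hrho')[g [[Gg g1] tg]]]]]]].
  apply/eqP; rewrite -leye_eq; apply: ereal_sup_ubound; exists g; split => //.
  by rewrite g1 inve1 mule1 ord_infty.
Qed.
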